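(* Fix $d\ge5$ and a vertex $o\in\mathbb{Z}^d$. Let $\varphi(v)$ be the probability that simple random walk on $\mathbb{Z}^d$ (usual nearest-neighbor graph, unit conductances) started at $v$ ever hits $o$ (so $\varphi(o)=1$), and for each edge $\{x,y\}$ of $\mathbb{Z}^d$ let $c_{xy}:=\varphi(x)\varphi(y)$. Then the network $(\mathbb{Z}^d,c,o)$ is recurrent, has a unique potential $h$, and two independent trajectories of the $h$-process have finite intersection almost surely. Therefore, the weighted uniform spanning tree (UST) on this network has more than one end almost surely.
   Context: A network $(G,c)$ is an infinite, connected, locally finite graph $G=(V,E)$ with positive edge weights (conductances) $c_{xy}=c_{yx}$, $xy\in E$; put $c_x=\sum_{z\sim x}c_{xz}$. The network random walk is the Markov chain on $V$ with transition probabilities $p(x,y)=c_{xy}/c_x$ for $x\sim y$. The network is recurrent if this walk is recurrent. A rooted network $(G,c,o)$ is a network with a distinguished vertex $o\in V$. The Laplacian of $f:V\to\mathbb{R}$ is $\Delta f(v)=\sum_{x\sim v}c_{vx}(f(x)-f(v))$. A potential on $(G,c,o)$ is a function $h:V\to[0,\infty)$ with $h(o)=0$, $\Delta h(o)=1$ and $\Delta h(v)=0$ for every $v\ne o$. For a potential $h$, the $h$-process is the Markov chain on $S_h=\{v:h(v)>0\}$ with transition probabilities $p^h(x,y)=p(x,y)h(y)/h(x)$, started from the initial distribution $\mu_h(v)=c_{ov}h(v)$, $v\sim o$ (a probability measure since $\Delta h(o)=1$). The intersection of two trajectories is the set of vertices visited by both. In a finite network, the weighted UST is a random spanning tree drawn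 with probability proportional to the product of the conductances of its edges. In a recurrent infinite network, the weighted UST is the weak limit of the USTs along an exhaustion by finite connected subnetworks; it is almost surely a spanning tree of $G$. An infinite graph has a single end if the complement of any finite set of vertices contains a single infinite connected component. *)

(* Defs.v *)
From HB Require Import structures.
From mathcomp Require Import all_boot all_order all_algebra finmap.
From mathcomp Require Import all_classical all_reals all_analysis.

Set Implicit Arguments.
Unset Strict Implicit.
Unset Printing Implicit Defensive.

Import Order.TTheory GRing.Theory Num.Theory.
Import numFieldNormedType.Exports.

Local Open Scope classical_set_scope.
Local Open Scope ring_scope.

(* Edges are unordered pairs, encoded as two-element [{fset V}]. *)

Section Graphs.
Variable V : choiceType.
Implicit Types (E : set {fset V}) (W K : {fset V}).

Definition adj E : rel V := fun x y => (x != y) && ([fset x; y]%fset \in E).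

Definition joined E (x y : V) : Prop :=
  exists2 p : seq V, path (adj E) x p & y = last x p.

Definition acyclic E : Prop :=
  ~ exists s : seq V, (2 < size s)%N /\ ucycle (adj E) s.

Definition spanning_tree W (T : {fset {fset V}}) : Prop :=
  {in W &, forall x y, joined [set` T] x y} /\ acyclic [set` T].

Definition remove_vertices E K : set {fset V} := [set e | E e /\ [disjoint e & K]%fset].

Definition component E K (x : V) : set V :=
  [set y | joined (remove_vertices E K) x y].

(* For an infinite, connected, locally finite graph every finite K leaves at least one
   infinite component, so this is the negation of having a single end. *)
Definition more_than_one_end E : Prop :=
  exists (K : {fset V}) (x y : V),
    [/\ x \notin K, y \notin K, infinite_set (component E K x),
        infinite_set (component E K y) & ~ component E K x y].

End Graphs.

Record weighted_graph (R : realType) (V : choiceType) := WeightedGraph {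
  edges : set {fset V};
  edge_cond : {fset V} -> R
}.

Section Networks.
Variables (R : realType) (V : choiceType).
Implicit Types (N : weighted_graph R V) (h : V -> R) (o x y v : V).

(* Only meaningful when x and y are adjacent. *)
Definition cond N x y : R := edge_cond N [fset x; y]%fset.

Definition neighbors N x : set V := [set y | adj (edges N) x y].

Record is_network N : Prop := {
  network_infinite : infinite_set [set: V];
  network_edge2 : forall e, edges N e -> #|` e| = 2%N;
  network_connected : forall x y, joined (edges N) x y;
  network_locally_finite : forall x, finite_set (neighbors N x);
  network_cond_gt0 : forall e, edges N e -> 0 < edge_cond N e
}.

Definition vertex_cond N x : R := \sum_(z \in neighbors N x) cond N x z.

Definition walk_kernel N x y : R :=
  if adj (edges N) x y then cond N x y / vertex_cond N x else 0.

Definition laplacian N (f : V -> R) v : R :=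
  \sum_(x \in neighbors N v) cond N v x * (f x - f v).

Definition potential N o h : Prop :=
  [/\ forall v, 0 <= h v, h o = 0, laplacian N h o = 1
    & forall v, v != o -> laplacian N h v = 0].

(* On {v | h v = 0} the division yields a zero row; since moreover
   [h_kernel N h x y = 0] and [h_start N o h y = 0] when [h y = 0], a chain with
   this initial law and this kernel stays in {v | 0 < h v} almost surely. *)
Definition h_kernel N h x y : R := walk_kernel N x y * h y / h x.

Definition h_start N o h v : R :=
  if adj (edges N) o v then cond N o v * h v else 0.

End Networks.

Section MarkovChains.
Variables (R : realType) (V : choiceType).

Definition markov_chain d (Omega : measurableType d) (P : probability Omega R)
    (X : nat -> Omega -> V) (mu : V -> R) (K : V -> V -> R) : Prop :=
  (forall n v, measurable [set w | X n w = v]) /\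
  (forall (n : nat) (x : nat -> V),
     P [set w | forall i, (i <= n)%N -> X i w = x i] =
     (mu (x 0%N) * \prod_(i < n) K (x i) (x i.+1))%:E).

Definition network_walk (N : weighted_graph R V) d (Omega : measurableType d)
    (P : probability Omega R) (X : nat -> Omega -> V) (v : V) : Prop :=
  markov_chain P X (fun u => (u == v)%:R) (walk_kernel N).

Definition h_process (N : weighted_graph R V) (o : V) (h : V -> R)
    d (Omega : measurableType d)
    (P : probability Omega R) (X : nat -> Omega -> V) : Prop :=
  markov_chain P X (h_start N o h) (h_kernel N h).

(* The value does not depend on the realization of the walk, whose law is
   determined by [network_walk]. *)
Definition is_hitting_probability (N : weighted_graph R V) (v o : V) (r : R) : Prop :=
  exists (d : measure_display) (Omega : measurableType d)
    (P : probability Omega R) (X : nat -> Omega -> V),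
    network_walk N P X v /\ P [set w | exists n, X n w = o] = r%:E.

Definition recurrent (N : weighted_graph R V) : Prop :=
  forall (v : V) (d : measure_display) (Omega : measurableType d)
    (P : probability Omega R) (X : nat -> Omega -> V),
    network_walk N P X v -> {ae P, forall w, exists n, X n.+1 w = v}.

Definition generated_events (Omega : Type) (X : nat -> Omega -> V) : set (set Omega) :=
  <<s [set A | exists n v, A = [set w | X n w = v]] >>.

Definition independent_processes d (Omega : measurableType d)
    (P : probability Omega R) (X Y : nat -> Omega -> V) : Prop :=
  forall A B, generated_events X A -> generated_events Y B ->
    P (A `&` B) = (P A * P B)%E.

Definition visited (Omega : Type) (X : nat -> Omega -> V) (w : Omega) : set V :=
  range (fun n => X n w).

Definition h_processes_intersect_finitely (N : weighted_graph R V) (o : V) (h : V -> R)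
    : Prop :=
  forall (d : measure_display) (Omega : measurableType d)
    (P : probability Omega R) (X Y : nat -> Omega -> V),
    h_process N o h P X -> h_process N o h P Y -> independent_processes P X Y ->
    {ae P, forall w, finite_set (visited X w `&` visited Y w)}.

End MarkovChains.

Section UST.
Variables (R : realType) (V : choiceType) (N : weighted_graph R V).

Record subgraph := Subgraph {
  sub_vertices : {fset V};
  sub_edges : {fset {fset V}}
}.

Record is_subnetwork (G : subgraph) : Prop := {
  subnetwork_neq0 : sub_vertices G != fset0;
  subnetwork_edges : [set` sub_edges G] `<=` edges N;
  subnetwork_ends : forall e, e \in sub_edges G -> (e `<=` sub_vertices G)%fset;
  subnetwork_connected :
    {in sub_vertices G &, forall x y, joined [set` sub_edges G] x y}
}.

Record exhaustion (G : nat -> subgraph) : Prop := {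
  exhaustion_sub : forall n, is_subnetwork (G n);
  exhaustion_vertices : forall n, (sub_vertices (G n) `<=` sub_vertices (G n.+1))%fset;
  exhaustion_edges : forall n, (sub_edges (G n) `<=` sub_edges (G n.+1))%fset;
  exhaustion_all_vertices : forall x, exists n, x \in sub_vertices (G n);
  exhaustion_all_edges : forall e, edges N e -> exists n, e \in sub_edges (G n)
}.

Definition spanning_trees (G : subgraph) : {fset {fset {fset V}}} :=
  [fset T in fpowerset (sub_edges G) | `[< spanning_tree (sub_vertices G) T >]]%fset.

Definition tree_weight (T : {fset {fset V}}) : R := \prod_(e <- T) edge_cond N e.

Definition finite_ust_prob (G : subgraph) (A : pred {fset {fset V}}) : R :=
  (\sum_(T <- spanning_trees G | A T) tree_weight T) /
  (\sum_(T <- spanning_trees G) tree_weight T).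

(* [T] is a random edge set whose law is the weak limit of the laws of the weighted
   USTs of [G n]; weak convergence of random edge sets is convergence of the
   probabilities of all cylinder events {T : T ∩ K = A}, K and A finite. *)
Definition ust_limit (G : nat -> subgraph) d (Omega : measurableType d)
    (P : probability Omega R) (T : Omega -> set {fset V}) : Prop :=
  (forall e, measurable [set w | T w e]) /\
  (forall K A : {fset {fset V}},
     (fun n => finite_ust_prob (G n) (fun t => (t `&` K)%fset == A)) @ \oo -->
     fine (P [set w | T w `&` [set` K] = [set` A]])).

Definition weighted_ust d (Omega : measurableType d)
    (P : probability Omega R) (T : Omega -> set {fset V}) : Prop :=
  exists2 G : nat -> subgraph, exhaustion G & ust_limit G P T.

Definition ust_more_than_one_end : Prop :=
  forall (d : measure_display) (Omega : measurableType d)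
    (P : probability Omega R) (T : Omega -> set {fset V}),
    weighted_ust P T -> {ae P, forall w, more_than_one_end (T w)}.

End UST.

Definition Zd_edges (d : nat) : set {fset 'rV[int]_d} :=
  [set e | exists x y : 'rV[int]_d,
     e = [fset x; y]%fset /\ \sum_(i < d) `|x ord0 i - y ord0 i| = 1].

Definition simple_Zd (R : realType) (d : nat) : weighted_graph R 'rV[int]_d :=
  WeightedGraph (@Zd_edges d) (fun=> 1).

(* For an edge {x, y} the product is phi x * phi y, since x != y. *)
Definition reweighted_Zd (R : realType) (d : nat) (phi : 'rV[int]_d -> R) :
    weighted_graph R 'rV[int]_d :=
  WeightedGraph (@Zd_edges d) (fun e => \prod_(v <- e) phi v).

(* Main.v *)
Require Import Defs.
From mathcomp Require Import all_boot all_order all_algebra finmap.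
From mathcomp Require Import all_classical all_reals all_analysis.
From mathcomp Require Import ring lra zify.

(** Write [G] for the Green function of simple random walk. It is square-summable for
    [d >= 5]: the return probability is an average over multinomial step counts of products
    of one-dimensional return probabilities, and [sum (n + 1) p_n(0)] dominates
    [sum_x G(x)^2]. Moreover [phi = G(_ - o) / G(0)], so the network walk is simple random
    walk conditioned to hit [o].

    Recurrence: if [s] is superharmonic for the network then [phi * s] is superharmonic off
    [o], hence at least [s(o) phi]; so [s] is minimal at [o] and therefore constant. A
    potential [h] makes [phi * h + (G(0) / 2d) phi] positive harmonic on the lattice, hence
    constant, which gives [h = (G(0) / 2d) (1 / phi - 1)]. The [h]-process is simple random
    walk conditioned to avoid [o]; it visits [v] with probability at most [G(v - o)], so
    two independent copies share a summable expected number of points.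

    Spanning trees: let [sigma_u(z) = G(z - u) phi(u) / (G(0) phi(z))]. In the UST of a large
    finite piece, rooted at [o], the probability that the branches of [z1] and [z2] merge at
    [u] is subharmonic in each of [z1] and [z2], hence at most
    [sigma_u(z1) sigma_u(z2)] up to a small error. Averaged over suitable far away starting
    points [z], [sigma_u(z)] is at most [phi(u)]. Thus, for suitable far away [z1] and [z2],
    the branches merge in a fixed finite set with probability close to one, by
    square-summability. A pigeonhole argument then yields a vertex [u] from which two
    infinite families of branches leave along different edges, and removing [u] separates
    them because the limit has no cycle. *)

Set Implicit Arguments.
Unset Strict Implicit.
Unset Printing Implicit Defensive.

Import Order.TTheory GRing.Theory Num.Theory.
Import numFieldNormedType.Exports.

Local Open Scope classical_set_scope.
Local Open Scope ring_scope.

(** * Return probabilities *)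

(** The claim on the tree is not deduced from the claim on the [h]-process; both rest on the same
    square-summability, and that amounts to (n + 1) n^(-d/2) being summable, that is, d > 4.
    Liouville is needed for nonnegative rather than bounded functions, because a potential comes
    with no growth bound; hence the detour through exponentials. The finite pieces of an exhaustion
    are arbitrary subnetworks that agree with the lattice only well inside. Two devices deal with
    this. Exchanging parents in rooted trees gives subharmonicity of tree events on every finite
    weighted graph, in place of a sampling algorithm. The function [e / phi] is harmonic for the
    network off [o] and exceeds 1 where [phi < e], so whatever happens near the boundary of a piece
    costs at most [e / phi z] from a start [z]. A fixed start [z] would not do:
    [green_ratio phi u z] is 1 at [u = z], however far away that is. Averaging over starts removes
    this. *)

Section ReturnBound.
Variables (R : realType).

(** The probability that simple random walk on the integers is at 0 after [n] steps from [j]. *)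
Fixpoint walk1 (n : nat) (j : int) : R :=
  if n is m.+1 then (walk1 m (j + 1) + walk1 m (j - 1)) / 2 else (j == 0)%:R.

Lemma walk1_support n j : walk1 n j != 0 -> exists l : nat, j = n%:Z - 2 * l%:Z.
Proof.
elim: n j => [|n IH] j /=.
  by have [-> _|_] := eqVneq j 0; [exists 0%N | rewrite eqxx].
have [h0|/IH[l hl] _] := eqVneq (walk1 n (j + 1)) 0; last first.
  by exists l.+1; lia.
have [h1|/IH[l hl] _] := eqVneq (walk1 n (j - 1)) 0; last first.
  by exists l; lia.
by rewrite h0 h1 addr0 mul0r eqxx.
Qed.

Lemma walk1E n (l : nat) : walk1 n (n%:Z - 2 * l%:Z) = 'C(n, l)%:R / 2 ^+ n.
Proof.
elim: n l => [|n IH] [|l] /=.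
- by rewrite bin0 expr0 divr1.
- by rewrite bin0n expr0 divr1; case: eqP => //; lia.
- have -> : walk1 n (n.+1%:Z - 2 * 0 + 1) = 0.
    by apply/eqP; apply: contraT => /walk1_support [l hl]; lia.
  have -> : n.+1%:Z - 2 * 0 - 1 = n%:Z - 2 * 0%N%:Z by lia.
  by rewrite IH !bin0 add0r exprS; field; rewrite expf_neq0// pnatr_eq0.
- have -> : n.+1%:Z - 2 * l.+1%:Z + 1 = n%:Z - 2 * l%:Z by lia.
  have -> : n.+1%:Z - 2 * l.+1%:Z - 1 = n%:Z - 2 * l.+1%:Z by lia.
  rewrite !IH binS natrD exprS; field.
  by rewrite expf_neq0// pnatr_eq0.
Qed.

(** Raising [m] by one multiplies the central probability by (2m+1)/(2m+2), and ((2m+1)/(2m+2))^2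
    (2m+3) <= 2m+1, so the left side never rises above its value 1 at [m = 0]. *)
Lemma central_bin_bound m : (('C(m.*2, m)%:R / 2 ^+ m.*2) ^+ 2 * (m.*2.+1)%:R : R) <= 1.
Proof.
elim: m => [|m IH]; first by rewrite bin0 expr0 divr1 expr1n mul1r.
have hb : ('C(m.*2.+2, m.+1) * m.+1 = 2 * m.*2.+1 * 'C(m.*2, m))%N.
  rewrite binS -(bin_sub (m := m)); last by lia.
  have -> : (m.*2.+1 - m = m.+1)%N by lia.
  have := mul_bin_diag m.*2.+1 m; rewrite /=; lia.
have hbR : ('C(m.*2.+2, m.+1)%:R * (m%:R + 1) : R) = 2 * (2 * m%:R + 1) * 'C(m.*2, m)%:R.
  have -> : m%:R + 1 = (m.+1)%:R :> R by rewrite -natr1.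
  have -> : 2 * m%:R + 1 = (m.*2.+1)%:R :> R by rewrite -[m.*2.+1]addn1 natrD -mul2n natrM.
  by rewrite -!natrM hb.
rewrite doubleS.
move: IH hbR.
have -> : (m.*2.+1)%:R = 2 * m%:R + 1 :> R by rewrite -[m.*2.+1]addn1 natrD -mul2n natrM.
have -> : (m.*2.+3)%:R = 2 * m%:R + 3 :> R by rewrite -[m.*2.+3]addn3 natrD -mul2n natrM.
set C := 'C(m.*2, m)%:R. set C' := 'C(_, _)%:R.
have e2 : (2 : R) ^+ m.*2.+2 = 4 * 2 ^+ m.*2 by rewrite !exprS; ring.
rewrite e2; set D := 2 ^+ m.*2.
have D0 : 0 < D by rewrite exprn_gt0.
have m0 : 0 <= m%:R :> R by [].
move: (m%:R) m0 => x x0 IH h.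
clearbody C C' D; clear e2 hb.
have -> : C' / (4 * D) = (C / D) * ((2 * x + 1) / (2 * (x + 1))).
  have : C' = 2 * (2 * x + 1) * C / (x + 1) by rewrite -h; field; lra.
  move=> ->; field; lra.
rewrite exprMn -mulrA.
have hle : ((2 * x + 1) / (2 * (x + 1))) ^+ 2 * (2 * x + 3) <= 2 * x + 1.
  rewrite expr_div_n mulrAC ler_pdivrMr; last by rewrite exprn_gt0//; lra.
  nra.
apply: le_trans IH; apply: ler_wpM2l hle; exact: sqr_ge0.
Qed.

(** Squared, so that the bound is a rational function of [n], which [count_sum_inv] can average over
    multinomial counts. *)
Lemma walk1_bound n : walk1 n 0 ^+ 2 <= (n.+1)%:R^-1.
Proof.
have [->|/walk1_support [l hl]] := eqVneq (walk1 n 0) 0.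
  by rewrite expr0n invr_ge0.
have -> : walk1 n 0 = walk1 n (n%:Z - 2 * l%:Z) by rewrite -hl.
have en : n = l.*2 by lia.
rewrite walk1E en -[leRHS]mul1r ler_pdivlMr ?ltr0n//.
exact: central_bin_bound.
Qed.

Variable d : nat.
Implicit Types (k : 'I_d -> nat) (f g : ('I_d -> nat) -> R).

Definition bump k (i : 'I_d) : 'I_d -> nat := fun j => (k j + (i == j))%N.

(* The sum of [f] over the letter counts of all words of length [n], shifted by [k]. *)
Fixpoint count_sum n f k : R :=
  if n is m.+1 then \sum_i count_sum m f (bump k i) else f k.

Lemma bumpC k i j : bump (bump k i) j = bump (bump k j) i.
Proof. by apply/funext => l; rewrite /bump addnAC. Qed.

Lemma count_sumS i n f k : count_sum n.+1 f k =
  count_sum n f (bump k i) + \sum_(j | j != i) count_sum n f (bump k j).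
Proof. by rewrite /= (bigD1 i). Qed.

Lemma count_sum_le n f g k : (forall k, f k <= g k) -> count_sum n f k <= count_sum n g k.
Proof. by move=> fg; elim: n k => [//|n IH] k /=; apply: ler_sum => i _; exact: IH. Qed.

Lemma count_sum_ge0 n f k : (forall k, 0 <= f k) -> 0 <= count_sum n f k.
Proof. by move=> f0; elim: n k => [//|n IH] k /=; apply: sumr_ge0 => i _; exact: IH. Qed.

Lemma count_sum_indep n g k i : (forall k, g (bump k i) = g k) ->
  count_sum n g (bump k i) = count_sum n g k.
Proof.
move=> gi; elim: n k => [|n IH] k //=.
by apply: eq_bigr => j _; rewrite bumpC IH.
Qed.

Lemma sqr_sum_le (I : finType) (a : I -> R) :
  (\sum_i a i) ^+ 2 <= #|I|%:R * \sum_i a i ^+ 2.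
Proof.
have h : 0 <= \sum_i \sum_j (a i - a j) ^+ 2.
  by apply: sumr_ge0 => i _; apply: sumr_ge0 => j _; exact: sqr_ge0.
suff e : \sum_i \sum_j (a i - a j) ^+ 2 =
    2 * (#|I|%:R * (\sum_i a i ^+ 2) - (\sum_i a i) ^+ 2).
  by move: h; rewrite e pmulr_rge0// subr_ge0.
transitivity (\sum_i \sum_j (a i ^+ 2 + a j ^+ 2 - 2 * (a i * a j))).
  by apply: eq_bigr => i _; apply: eq_bigr => j _; ring.
transitivity (\sum_i (#|I|%:R * a i ^+ 2 + \sum_j a j ^+ 2 - 2 * (\sum_j a j) * a i)).
  apply: eq_bigr => i _; rewrite sumrB big_split /= sumr_const -!mulr_sumr.
  by rewrite -[_ *+ _]mulr_natl; ring.
rewrite sumrB big_split /= sumr_const -!mulr_sumr.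
move: (\sum_i a i) (\sum_i _ ^+ 2) => x y; rewrite -[y *+ _]mulr_natl.
by have -> : #|xpredT : pred I| = #|I| by []; ring.
Qed.

Lemma count_sum_sqr n f k :
  (count_sum n f k) ^+ 2 <= d%:R ^+ n * count_sum n (fun k => f k ^+ 2) k.
Proof.
elim: n k => [|n IH] k /=; first by rewrite expr0 mul1r.
apply: (le_trans (sqr_sum_le _)); rewrite card_ord exprS -mulrA.
by apply: ler_wpM2l => //; rewrite mulr_sumr; apply: ler_sum => i _; exact: IH.
Qed.

(* A discrete integration by parts: [1 / (k i).+1] is the integral of [s ^+ k i] over [0, 1].
   The case [k i = 0], which has no predecessor, is [count_sum_inv]. *)
Lemma count_sum_inv_aux n f g k i : (forall k, 0 <= g k) -> (forall k, g (bump k i) = g k) ->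
  (forall k, f k = g k / (k i).+1%:R) ->
  n.+1%:R * count_sum n f (bump k i) + (k i).+1%:R * count_sum n.+1 f k
    <= count_sum n.+1 g k.
Proof.
move=> g0 gi fE; elim: n k => [|n IH] k.
  rewrite /= mul1r (bigD1 i)//= [leRHS](bigD1 i)//= mulrDr addrA.
  rewrite !fE gi {1 2}/bump eqxx !addn1 mulr_sumr; apply: lerD.
    rewrite -natr1; have : 0 < (k i).+1%:R :> R by [].
    move: (k i).+1%:R => x x0.
    suff -> : g k / (x + 1) + x * (g k / (x + 1)) = g k by [].
    by field; lra.
  apply: ler_sum => j ji; rewrite fE /bump (negPf ji) addn0 mulrC divfK ?pnatr_eq0//.
have h1 := IH (bump k i).
have h2 : \sum_(j | j != i) (n.+1%:R * count_sum n f (bump (bump k i) j)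
     + (k i).+1%:R * count_sum n.+1 f (bump k j))
   <= \sum_(j | j != i) count_sum n.+1 g (bump k j).
  apply: ler_sum => j ji; have := IH (bump k j).
  by rewrite {3}/bump (negPf ji) addn0 bumpC.
rewrite big_split /= -!mulr_sumr in h2.
rewrite -natr1 mulrDl mul1r (count_sumS i n.+1 f k) (count_sumS i n.+1 g k).
have h3 := congr1 (fun x => n.+1%:R * x) (count_sumS i n f (bump k i)).
rewrite /= mulrDr in h3.
move: h1; rewrite {3}/bump eqxx addn1 -[X in X * count_sum n.+1 f _]natr1.
move: h2 h3; rewrite -/(count_sum n.+1 f (bump k i)).
move: (\sum_(j | j != i) _) (\sum_(j | j != i) _) (\sum_(j | j != i) _).
move: (count_sum n.+1 f (bump k i)) (count_sum n f _) (count_sum n.+1 g _).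
move: (n.+1%:R : R) (_.+1%:R : R) => *; lra.
Qed.

Lemma count_sum_inv n g k i : (forall k, 0 <= g k) -> (forall k, g (bump k i) = g k) ->
  k i = 0%N ->
  n.+1%:R * count_sum n (fun k => g k / (k i).+1%:R) k <= count_sum n.+1 g k.
Proof.
move=> g0 gi; set f := (fun k => _); elim: n k => [|n IH] k ki.
  rewrite /= mul1r /f ki divr1 (bigD1 i)//= gi lerDl.
  by apply: sumr_ge0 => j _; exact: g0.
(* A first letter [i] is handled by the auxiliary lemma, whose second term supplies the extra copy
   that turns [n.+1] into [n.+2]; any other first letter keeps [k i = 0], where the induction
   hypothesis applies. *)
have h1 := count_sum_inv_aux n k g0 gi (fun=> erefl).
have h2 : \sum_(j | j != i) (n.+1%:R * count_sum n f (bump k j))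
   <= \sum_(j | j != i) count_sum n.+1 g (bump k j).
  by apply: ler_sum => j ji; apply: IH; rewrite /bump (negPf ji) ki.
have h3 : count_sum n.+1 g (bump k i) = count_sum n.+1 g k by exact: count_sum_indep.
have h4 := count_sumS i n f k.
rewrite -mulr_sumr in h2.
rewrite (count_sumS i n.+1 g k) h3 -natr1 mulrDl mul1r.
move: h1; rewrite -/f ki mul1r.
by move: h2 h4; move: (n.+1%:R : R) (\sum_(j | j != i) _) (\sum_(j | j != i) _) => *; nra.
Qed.

Lemma count_sum_const n k c : count_sum n (fun=> c) k = d%:R ^+ n * c.
Proof.
elim: n k => [|n IH] k /=; first by rewrite expr0 mul1r.
under eq_bigr => i _ do rewrite IH.
by rewrite sumr_const card_ord exprS -mulrA mulr_natl.
Qed.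

(** For the letter counts of a uniform random word of length [n], the mean of the product is at most
    (d / (n + 1)) ^ size s. Each use of [count_sum_inv] removes one factor and lengthens the words
    by one letter, which accounts for the exponent [n + size s]. *)
Lemma count_sum_prod_inv n (s : seq 'I_d) : uniq s ->
  n.+1%:R ^+ size s * count_sum n (fun k => \prod_(i <- s) (k i).+1%:R^-1) (fun=> 0%N)
    <= d%:R ^+ (n + size s).
Proof.
elim: s n => [|i s IH] n /=.
  move=> _; rewrite expr0 mul1r addn0; rewrite -[leRHS]mulr1 -(count_sum_const n (fun=> 0%N)).
  by apply: count_sum_le => k; rewrite big_nil.
move=> /andP[nis us].
set g := fun k : 'I_d -> nat => \prod_(j <- s) (k j).+1%:R^-1 : R.
have -> : (fun k : 'I_d -> nat => \prod_(j <- i :: s) (k j).+1%:R^-1 : R) =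
   (fun k => g k / (k i).+1%:R).
  by apply/funext => k; rewrite big_cons mulrC.
have g0 k : 0 <= g k by apply: prodr_ge0 => j _; rewrite invr_ge0.
have gi k : g (bump k i) = g k.
  apply: eq_big_seq => j js; rewrite /bump (_ : (i == j) = false) ?addn0//.
  by apply/eqP => ij; rewrite ij js in nis.
rewrite exprSr -mulrA.
have h := count_sum_inv n g0 gi (erefl ((fun=> 0%N) i)).
apply: (le_trans (ler_wpM2l _ h)); first by rewrite exprn_ge0.
apply: (@le_trans _ _ (n.+2%:R ^+ size s * count_sum n.+1 g (fun=> 0%N))).
  apply: ler_wpM2r; last by rewrite lerXn2r ?nnegrE// ler_nat.
  exact: count_sum_ge0.
by apply: (le_trans (IH _ us)); rewrite addnS addSn.
Qed.

End ReturnBound.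

(** * The lattice and its averaging operator *)

Section Lattice.
Variable d : nat.
Local Notation V := 'rV[int]_d.
Local Notation D := ('I_d * bool)%type.
Implicit Types (x y z : V) (k : D).

Definition dir k : V := (-1) ^+ k.2 *: delta_mx ord0 k.1.

Definition opp k : D := (k.1, ~~ k.2).

Lemma dirE k j : dir k ord0 j = if k.1 == j then (-1) ^+ k.2 else 0.
Proof.
rewrite /dir !mxE eqxx /= [j == _]eq_sym.
by case: eqP => _; rewrite ?mulr1 ?mulr0.
Qed.

Lemma dir_opp k : dir (opp k) = - dir k.
Proof. by rewrite /dir /opp /= -scaleNr; case: k.2; rewrite ?expr0 ?expr1 ?opprK. Qed.

Lemma oppK : involutive opp.
Proof. by case=> i b; rewrite /opp /= negbK. Qed.

Lemma addr_dirK x k : x + dir k + dir (opp k) = x.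
Proof. by rewrite dir_opp addrK. Qed.

Lemma dir_neq0 k : dir k != 0.
Proof.
apply/eqP => /rowP /(_ k.1); rewrite dirE eqxx mxE => /eqP.
by rewrite expf_eq0 andbC.
Qed.

Lemma dir_inj : injective dir.
Proof.
move=> [i b] [j c] /rowP e.
have ij : i = j.
  apply/eqP; have := e i; rewrite !dirE eqxx /= [j == i]eq_sym.
  by case: eqP => // _ /eqP; rewrite expf_eq0 andbC.
by have := e i; rewrite !dirE /= ij eqxx; case: b {e}; case: c => //; rewrite ij.
Qed.

(** Connectedness of the lattice as an induction principle; it later carries Harnack bounds and
    equality cases of maximum principles from one point to all. *)
Lemma lattice_ind (S : V -> Prop) x0 : S x0 ->
  (forall x k, S x -> S (x + dir k)) -> forall x, S x.
Proof.
move=> S0 Sd.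
have Sn n k x : S x -> S (x + dir k *+ n).
  elim: n x => [|n IH] x Sx; first by rewrite addr0.
  by rewrite mulrS addrA; apply: IH; exact: Sd.
have Sz (i : 'I_d) (c : int) x : S x -> S (x + c *: delta_mx ord0 i).
  case: c => n Sx.
    have := Sn n (i, false) x Sx; rewrite /dir expr0 scale1r.
    by rewrite -scaler_nat natz.
  have := Sn n.+1 (i, true) x Sx; rewrite /dir expr1 scaleN1r.
  by rewrite -scaler_nat natz NegzE scaleNr scalerN.
have Ss (s : seq 'I_d) (c : 'I_d -> int) : S (x0 + \sum_(i <- s) c i *: delta_mx ord0 i).
  elim: s => [|i s IH]; first by rewrite big_nil addr0.
  by rewrite big_cons [X in S (_ + X)]addrC addrA; exact: Sz.
move=> x; have := Ss (index_enum 'I_d) (fun i => (x - x0) ord0 i).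
by rewrite -row_sum_delta subrKC.
Qed.

Lemma zd_edgesP x y : adj (@Zd_edges d) x y <-> exists k, y = x + dir k.
Proof.
have l1 k : \sum_(i < d) `|dir k ord0 i| = 1 :> int.
  rewrite (bigD1 k.1)//= dirE eqxx normrX normrN1 expr1n big1 ?addr0// => i ik.
  by rewrite dirE eq_sym (negPf ik) normr0.
split; last first.
  move=> [k ->]; apply/andP; split.
    by rewrite -subr_eq0 opprD addNKr oppr_eq0 dir_neq0.
  rewrite inE; exists x, (x + dir k); split=> //.
  apply: etrans (l1 k); apply: eq_bigr => i _; rewrite [(x + _) _ _]mxE.
  by rewrite opprD addNKr normrN.
move=> /andP[xy]; rewrite inE => -[a [b [e h]]].
suff [k hk] : exists k, b = a + dir k.
  have : x \in [fset a; b]%fset by rewrite -e !inE eqxx.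
  have : y \in [fset a; b]%fset by rewrite -e !inE eqxx orbT.
  rewrite !inE => /orP[]/eqP ya /orP[]/eqP xa; subst x y; rewrite ?eqxx// in xy *.
  - by exists (opp k); rewrite hk addr_dirK.
  - by exists k.
have [i hi] : exists i, a ord0 i != b ord0 i.
  apply/existsP; apply: contraT => /existsPn hn.
  move: h; rewrite big1 // => i _.
  by have /negPn/eqP -> := hn i; rewrite subrr normr0.
move: h; rewrite (bigD1 i)//= => h.
have h1 : 1 <= `|a ord0 i - b ord0 i| by rewrite -gtz0_ge1 normr_gt0 subr_eq0.
have h2 : 0 <= \sum_(j < d | j != i) `|a ord0 j - b ord0 j| by apply: sumr_ge0.
have [h3 h4] : \sum_(j < d | j != i) `|a ord0 j - b ord0 j| = 0 /\
    `|a ord0 i - b ord0 i| = 1.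
  move: (\sum_(j < d | _) _) (`|_|) h h1 h2 => t s h h1 h2.
  have t0 : t = 0 by apply/eqP; rewrite eq_le h2 andbT -(lerD2l s) h addr0.
  by rewrite t0 addr0 in h.
exists (i, a ord0 i - b ord0 i == 1); apply/rowP => j; rewrite mxE dirE /=.
case: eqP => [<-|/eqP ij]; first last.
  have /eqP := h3; rewrite psumr_eq0// => /allP/(_ j (mem_index_enum _)).
  by rewrite eq_sym ij normr_eq0 subr_eq0 /= addr0 => /eqP.
move: (a ord0 i) (b ord0 i) h4 => p q h4; clear -h4.
by case: eqP => h5 /=; rewrite ?expr1 ?expr0; lia.
Qed.

Variable R : realType.
Implicit Types (f g : V -> R).

Definition avg f x : R := (2 * d)%:R^-1 * \sum_k f (x + dir k).

Definition delta0 x : R := (x == 0)%:R.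

Lemma avgD f g : avg (fun x => f x + g x) = (fun x => avg f x + avg g x).
Proof. by apply/funext => x; rewrite /avg big_split mulrDr. Qed.

Lemma avgZ c f : avg (fun x => c * f x) = (fun x => c * avg f x).
Proof. by apply/funext => x; rewrite /avg -mulr_sumr mulrCA. Qed.

Lemma avgB f g : avg (fun x => f x - g x) = (fun x => avg f x - avg g x).
Proof. by apply/funext => x; rewrite /avg sumrB mulrBr. Qed.

Lemma avg_sum (I : Type) (s : seq I) (F : I -> V -> R) :
  avg (fun x => \sum_(i <- s) F i x) = (fun x => \sum_(i <- s) avg (F i) x).
Proof. by apply/funext => x; rewrite /avg exchange_big mulr_sumr. Qed.

Lemma avg_le f g : (forall x, f x <= g x) -> forall x, avg f x <= avg g x.
Proof. by move=> fg x; rewrite /avg ler_wpM2l// ?invr_ge0//; apply: ler_sum. Qed.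

Lemma avg_ge0 f : (forall x, 0 <= f x) -> forall x, 0 <= avg f x.
Proof. by move=> f0 x; rewrite /avg mulr_ge0 ?invr_ge0//; apply: sumr_ge0. Qed.

Lemma avg_shift v f : avg (fun x => f (x + v)) = (fun x => avg f (x + v)).
Proof. by apply/funext => x; rewrite /avg; under eq_bigr do rewrite addrAC. Qed.

Lemma avg_opp f : avg (fun x => f (- x)) = (fun x => avg f (- x)).
Proof.
apply/funext => x; rewrite /avg (reindex_inj (inv_inj oppK)).
by under eq_bigr do rewrite dir_opp opprD opprK.
Qed.

Lemma avg_cst c : (0 < d)%N -> avg (fun=> c) = (fun=> c).
Proof.
move=> d0; apply/funext => x; rewrite /avg sumr_const card_prod card_ord card_bool.
by rewrite -(mulr_natl c) mulnC mulKf// pnatr_eq0; lia.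
Qed.

Lemma sum_dir f x : (0 < d)%N -> \sum_k f (x + dir k) = (2 * d)%:R * avg f x.
Proof. by move=> d0; rewrite /avg mulVKf// pnatr_eq0; lia. Qed.

Lemma iter_avg_le n f g : (forall x, f x <= g x) ->
  forall x, iter n avg f x <= iter n avg g x.
Proof. by move=> fg; elim: n => //= n IH x; exact: avg_le. Qed.

Lemma iter_avg_ge0 n f : (forall x, 0 <= f x) -> forall x, 0 <= iter n avg f x.
Proof. by move=> fg; elim: n => //= n IH x; exact: avg_ge0. Qed.

Lemma iter_avgD n f g :
  iter n avg (fun x => f x + g x) = (fun x => iter n avg f x + iter n avg g x).
Proof. by elim: n => //= n ->; rewrite avgD. Qed.

Lemma iter_avgZ n c f : iter n avg (fun x => c * f x) = (fun x => c * iter n avg f x).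
Proof. by elim: n => //= n ->; rewrite avgZ. Qed.

Lemma iter_avg_sum n (I : Type) (s : seq I) (F : I -> V -> R) :
  iter n avg (fun x => \sum_(i <- s) F i x) = (fun x => \sum_(i <- s) iter n avg (F i) x).
Proof. by elim: n => //= n ->; rewrite avg_sum. Qed.

Lemma iter_avg_shift n v f :
  iter n avg (fun x => f (x + v)) = (fun x => iter n avg f (x + v)).
Proof. by elim: n => //= n ->; rewrite avg_shift. Qed.

Lemma iter_avg_opp n f : iter n avg (fun x => f (- x)) = (fun x => iter n avg f (- x)).
Proof. by elim: n => //= n ->; rewrite avg_opp. Qed.

Lemma subharmonic_iter n f : (forall x, f x <= avg f x) -> forall x, f x <= iter n avg f x.
Proof.
move=> sf; elim: n => //= n IH x.
exact: le_trans (sf x) (avg_le IH x).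
Qed.

Definition heat n x : R := iter n avg delta0 x.

Lemma heat_ge0 n x : 0 <= heat n x.
Proof. by apply: iter_avg_ge0 => y; exact: ler0n. Qed.

Lemma heatN n x : heat n (- x) = heat n x.
Proof.
rewrite /heat -[LHS](congr1 (fun f => f x) (iter_avg_opp n delta0)).
by congr (iter _ _ _ _); apply/funext => y; rewrite /delta0 oppr_eq0.
Qed.

(** By symmetry of the walk, a sum over the whole lattice would give equality. The induction moves
    one step from [heat] to [f] by translating [s]; terms outside [s] are nonnegative and
    dropped. *)
Lemma sum_heat_le n f (s : seq V) : uniq s -> (forall x, 0 <= f x) ->
  \sum_(x <- s) heat n x * f x <= iter n avg f 0.
Proof.
elim: n f s => [|n IH] f s us f0.
  rewrite /heat /=; have [s0|s0] := boolP (0 \in s).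
    rewrite (bigD1_seq 0)//= /delta0 eqxx mul1r big1 ?addr0// => x x0.
    by rewrite (negPf x0) mul0r.
  rewrite big1_seq// => x /= xs; rewrite /delta0; case: eqP => [x0|]; rewrite ?mul0r//.
  by rewrite -x0 xs in s0.
have -> : iter n.+1 avg f 0 =
    (2 * d)%:R^-1 * \sum_k iter n avg (fun x => f (x + dir k)) 0.
  by rewrite /= /avg; under [in RHS]eq_bigr do rewrite iter_avg_shift.
under eq_bigr do rewrite /heat /= /avg -mulrA mulr_suml.
rewrite -mulr_sumr ler_wpM2l ?invr_ge0// exchange_big /=.
rewrite (reindex_inj (inv_inj oppK)) /=; apply: ler_sum => k _.
have -> : \sum_(x <- s) iter n avg delta0 (x + dir (opp k)) * f x =
  \sum_(y <- [seq x + dir (opp k) | x <- s]) heat n y * f (y + dir k).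
  by rewrite big_map; apply: eq_bigr => x _; rewrite dir_opp addrNK.
apply: IH => // ; rewrite map_inj_uniq//; exact: addIr.
Qed.

Lemma heat_iter n m x : iter n avg (heat m) x = heat (n + m) x.
Proof. by rewrite /heat iterD. Qed.

(** [k i] counts the steps made so far in coordinate [i]. A lattice step picks a coordinate
    uniformly and then a sign, and the average over signs is exactly the recursion of [walk1], so
    only the choice of coordinates remains to be summed. *)
Lemma iter_avg_prod n (k : 'I_d -> nat) x : (0 < d)%N ->
  iter n avg (fun x => \prod_i walk1 R (k i) (x ord0 i)) x =
  d%:R^-1 ^+ n * count_sum n (fun c => \prod_i walk1 R (c i) (x ord0 i)) k.
Proof.
move=> d0; elim: n k => [|n IH] k; first by rewrite expr0 mul1r.
rewrite iterSr.
have -> : avg (fun x => \prod_i walk1 R (k i) (x ord0 i)) =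
   (fun x => d%:R^-1 * \sum_i \prod_j walk1 R (bump k i j) (x ord0 j)).
  apply/funext => y; rewrite /avg.
  suff -> : \sum_k0 \prod_i walk1 R (k i) ((y + dir k0) ord0 i) =
      2 * \sum_i \prod_j walk1 R (bump k i j) (y ord0 j).
    by rewrite natrM invfM mulrACA mulVf ?pnatr_eq0// mul1r.
  transitivity (\sum_i \sum_b \prod_j walk1 R (k j) ((y + dir (i, b)) ord0 j)).
    by rewrite pair_big; apply: eq_bigr => -[].
  rewrite mulr_sumr; apply: eq_bigr => i _; rewrite big_bool /=.
  have e b : \prod_j walk1 R (k j) ((y + dir (i, b)) ord0 j) =
     walk1 R (k i) (y ord0 i + (-1) ^+ b) * \prod_(j | j != i) walk1 R (k j) (y ord0 j).
    rewrite (bigD1 i)//= mxE dirE eqxx; congr (_ * _).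
    by apply: eq_bigr => j ji; rewrite mxE dirE eq_sym (negPf ji) addr0.
  rewrite !e [in RHS](bigD1 i)//= /bump eqxx addn1 /= expr0 expr1.
  under [in RHS]eq_bigr => j ji do rewrite eq_sym (negPf ji) addn0.
  by rewrite -mulrDl mulrA [X in X * _ = _]addrC; congr (_ * _); rewrite mulrC divfK ?pnatr_eq0.
rewrite iter_avgZ iter_avg_sum; under eq_bigr do rewrite IH.
by rewrite -mulr_sumr mulrA exprS.
Qed.

Lemma heat_bound n : (0 < d)%N -> heat n 0 ^+ 2 <= d%:R ^+ d / n.+1%:R ^+ d.
Proof.
move=> d0.
have d0R : 0 < d%:R :> R by rewrite ltr0n.
have -> : heat n 0 = d%:R^-1 ^+ n *
    count_sum n (fun k : 'I_d -> nat => \prod_i walk1 R (k i) 0) (fun=> 0%N).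
  rewrite /heat (_ : delta0 = (fun x => \prod_i walk1 R ((fun=> 0%N) i) (x ord0 i))).
    rewrite iter_avg_prod//; congr (_ * count_sum _ _ _).
    by apply/funext => k; apply: eq_bigr => i _; rewrite mxE.
  apply/funext => x; rewrite /delta0 /=; case: eqP => [->|/eqP x0].
    by rewrite big1// => i _; rewrite mxE eqxx.
  have [i xi] : exists i, x ord0 i != 0.
    apply/existsP; apply: contraNT x0 => /existsPn hn; apply/eqP/rowP => i.
    by rewrite mxE; apply/eqP; rewrite -[_ == _]negbK; exact: hn.
  by rewrite (bigD1 i)//= (negPf xi) mul0r.
rewrite exprMn !exprVn -exprM.
(* Jensen: the square passes inside the multinomial average, where [walk1_bound] applies to each
   factor. *)
apply: (le_trans (ler_wpM2l _ (count_sum_sqr _ _ _))).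
  by rewrite invr_ge0 exprn_ge0.
have h := count_sum_prod_inv R n (enum_uniq 'I_d).
rewrite size_enum_ord in h.
have h1 : count_sum n (fun k : 'I_d -> nat => (\prod_i walk1 R (k i) 0) ^+ 2) (fun=> 0%N) <=
  count_sum n (fun c => \prod_(i <- enum 'I_d) (c i).+1%:R^-1) (fun=> 0%N).
  apply: count_sum_le => k; rewrite big_enum -prodrXl /=.
  by apply: ler_prod => i _; rewrite sqr_ge0 walk1_bound.
have n0 : 0 < n.+1%:R ^+ d :> R by rewrite exprn_gt0.
rewrite ler_pdivlMr// -mulrA -mulrA mulrA.
have h2 : count_sum n (fun k : 'I_d -> nat => (\prod_i walk1 R (k i) 0) ^+ 2) (fun=> 0%N)
    * n.+1%:R ^+ d <= d%:R ^+ (n + d).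
  by apply: le_trans h; rewrite mulrC ler_wpM2l// ltW.
apply: (le_trans (ler_wpM2l _ h2)).
  by rewrite mulr_ge0 ?invr_ge0 ?exprn_ge0.
rewrite exprM exprD; have : d%:R ^+ n != 0 :> R by rewrite expf_neq0 ?gt_eqF.
by move: (d%:R ^+ n) (d%:R ^+ d) => a b a0; rewrite le_eqVlt; apply/orP; left; apply/eqP; field.
Qed.

End Lattice.

(** * The Green function *)

Section Green.
Variables (R : realType) (d : nat).
Hypothesis hd : (5 <= d)%N.
Local Notation V := 'rV[int]_d.
Local Notation heat := (@heat d R).
Local Notation avg := (@avg d R).
Implicit Types (x y : V) (s : seq V) (f F : V -> R).

Let d0 : (0 < d)%N. Proof. by lia. Qed.

(** The source of the restriction on the dimension: [heat n 0] is of order n^(-d/2), so with the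
    extra factor [n.+1] the exponent is at most -3/2 once [5 <= d]. *)
Lemma heat0_le n : n.+1%:R * heat n 0 <= Num.sqrt (d%:R ^+ d) / Num.sqrt n.+1%:R ^+ 3.
Proof.
have s0 : 0 < Num.sqrt n.+1%:R :> R by rewrite sqrtr_gt0.
have s1 : Num.sqrt n.+1%:R ^+ 2 = n.+1%:R :> R by rewrite sqr_sqrtr.
have D1 : Num.sqrt (d%:R ^+ d) ^+ 2 = d%:R ^+ d :> R by rewrite sqr_sqrtr// exprn_ge0.
have h : heat n 0 ^+ 2 <= d%:R ^+ d / n.+1%:R ^+ 5.
  apply: (le_trans (heat_bound R n d0)); rewrite ler_wpM2l ?exprn_ge0//.
  rewrite lef_pV2 ?posrE ?exprn_gt0//.
  by rewrite ler_weXn2l// ler1n.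
rewrite -ler_sqr ?nnegrE; last 2 first.
- by rewrite mulr_ge0 ?heat_ge0.
- by rewrite divr_ge0 ?sqrtr_ge0 ?exprn_ge0// sqrtr_ge0.
rewrite exprMn expr_div_n D1 -exprM mulnC exprM s1.
have n0 : 0 < n.+1%:R :> R by [].
apply: (le_trans (ler_wpM2l _ h)); first by rewrite exprn_ge0.
by rewrite le_eqVlt; apply/orP; left; apply/eqP; field; rewrite gt_eqF.
Qed.

(** Telescoping: if t^2 = s^2 + 1 then t^(-3) <= 2/s - 2/t, the discrete form of integrating
    x^(-3/2). The first term is 1 = 3 - 2. *)
Lemma sum_sqrt_inv3 n :
  \sum_(k < n.+1) (Num.sqrt k.+1%:R ^+ 3)^-1 <= 3 - 2 / Num.sqrt n.+1%:R :> R.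
Proof.
elim: n => [|n IH]; first by rewrite big_ord_recl big_ord0 sqrtr1; lra.
rewrite big_ord_recr /=; apply: (le_trans (lerD IH (lexx _))).
have s0 : 0 < Num.sqrt n.+1%:R :> R by rewrite sqrtr_gt0.
have t0 : 0 < Num.sqrt n.+2%:R :> R by rewrite sqrtr_gt0.
have s1 : Num.sqrt n.+1%:R ^+ 2 = n.+1%:R :> R by rewrite sqr_sqrtr.
have t1 : Num.sqrt n.+2%:R ^+ 2 = n.+2%:R :> R by rewrite sqr_sqrtr.
have st : Num.sqrt n.+1%:R <= Num.sqrt n.+2%:R :> R by rewrite ler_sqrt ?ler_nat// ltr0n.
have e : Num.sqrt n.+2%:R ^+ 2 = Num.sqrt n.+1%:R ^+ 2 + 1 :> R by rewrite s1 t1 natr1.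
move: (Num.sqrt n.+1%:R) (Num.sqrt n.+2%:R) s0 t0 st e => s t s0 t0 st e.
suff : (t ^+ 3)^-1 <= 2 / s - 2 / t by lra.
have -> : 2 / s - 2 / t = 2 * (t - s) / (s * t) by field; rewrite !gt_eqF.
have -> : t - s = (t + s)^-1.
  by apply: (mulIf (x := t + s)); [rewrite gt_eqF// addr_gt0 | rewrite mulVf ?gt_eqF ?addr_gt0//; lra].
rewrite -mulrA -invfM -[leLHS]mul1r -[leLHS]/(1 / _) ler_pdivrMr ?exprn_gt0//.
rewrite mulrAC ler_pdivlMr ?mulr_gt0 ?addr_gt0// mul1r.
have h1 : s * t <= t ^+ 2 by rewrite expr2 ler_wpM2r// ltW.
rewrite exprS; nra.
Qed.

Definition green_cst : R := 3 * Num.sqrt (d%:R ^+ d).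

Lemma sum_heat0 n : \sum_(k < n) k.+1%:R * heat k 0 <= green_cst.
Proof.
have D0 := sqrtr_ge0 (d%:R ^+ d : R).
case: n => [|n]; first by rewrite big_ord0 mulr_ge0.
apply: (@le_trans _ _ (\sum_(k < n.+1) Num.sqrt (d%:R ^+ d) / Num.sqrt k.+1%:R ^+ 3)).
  by apply: ler_sum => k _; exact: heat0_le.
rewrite -mulr_sumr /green_cst mulrC ler_wpM2r//.
apply: (le_trans (sum_sqrt_inv3 n)); rewrite gerBl divr_ge0//; exact: sqrtr_ge0.
Qed.

(** At most [k.+1] pairs [(i, j)] have [i + j = k], which produces the weight in [sum_heat0]. *)
Lemma sum_heat_add n : \sum_(i < n) \sum_(j < n) heat (i + j) 0 <= green_cst.
Proof.
have hk (i : 'I_n) : \sum_(j < n) heat (i + j) 0 <=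
    \sum_(k < n + n) (i <= k)%:R * heat k 0.
  rewrite -(big_mkord xpredT (fun j => heat (i + j) 0)).
  rewrite -(big_mkord xpredT (fun k => (i <= k)%:R * heat k 0)).
  have g0 a b : 0 <= \sum_(a <= k < b) (i <= k)%:R * heat k 0.
    by apply: sumr_ge0 => k _; rewrite mulr_ge0// heat_ge0.
  have e : \sum_(0 <= k < n + n) (i <= k)%:R * heat k 0 =
      \sum_(0 <= k < i) (i <= k)%:R * heat k 0 +
      \sum_(i <= k < i + n) (i <= k)%:R * heat k 0 +
      \sum_(i + n <= k < n + n) (i <= k)%:R * heat k 0.
    by rewrite -!big_cat_nat//; have := ltn_ord i; lia.
  have e2 : \sum_(i <= k < i + n) (i <= k)%:R * heat k 0 = \sum_(0 <= j < n) heat (i + j) 0.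
    rewrite -{1}[nat_of_ord i]add0n big_addn addKn.
    by apply: eq_bigr => j _; rewrite leq_addl mul1r addnC.
  rewrite e e2; have := g0 0%N i; have := g0 (i + n)%N (n + n)%N; lra.
apply: (le_trans (ler_sum _ (fun i _ => hk i))).
rewrite exchange_big /=; apply: le_trans (sum_heat0 (n + n)).
apply: ler_sum => k _; rewrite -mulr_suml ler_wpM2r ?heat_ge0//.
rewrite -natr_sum ler_nat.
have : (\sum_(i < n) (i <= k) <= minn n k.+1)%N.
  elim: n {hk k} (nat_of_ord k) => [|n IH] k; first by rewrite big_ord0.
  by rewrite big_ord_recr /=; have := IH k; case: leqP => /=; lia.
by move=> h; apply: leq_trans h _; exact: geq_minr.
Qed.

Definition greenN n x : R := \sum_(k < n) heat k x.

Lemma greenN_ge0 n x : 0 <= greenN n x.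
Proof. by apply: sumr_ge0 => k _; exact: heat_ge0. Qed.

(** Expanding the square gives pairs of times, and by Chapman-Kolmogorov the sum over [x] of
    [heat i x * heat j x] is at most [heat (i + j) 0]. *)
Lemma greenN_sqr n s : uniq s -> \sum_(x <- s) greenN n x ^+ 2 <= green_cst.
Proof.
move=> us; apply: le_trans (sum_heat_add n).
have -> : \sum_(x <- s) greenN n x ^+ 2 =
    \sum_(i < n) \sum_(j < n) \sum_(x <- s) heat i x * heat j x.
  under eq_bigr => x _.
    rewrite expr2 /greenN mulr_suml.
    under eq_bigr => i _ do rewrite mulr_sumr.
    over.
  by rewrite exchange_big /=; apply: eq_bigr => i _; rewrite exchange_big.
apply: ler_sum => i _; apply: ler_sum => j _.
rewrite -heat_iter; apply: sum_heat_le => // x; exact: heat_ge0.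
Qed.

Lemma greenN_nd x : {homo (greenN ^~ x) : n m / (n <= m)%N >-> n <= m}.
Proof.
move=> n m /subnKC <-; elim: (m - n)%N => [|k IH]; first by rewrite addn0.
by rewrite addnS /greenN big_ord_recr /= ler_wpDr// heat_ge0.
Qed.

Lemma cvg_greenN x : cvgn (greenN ^~ x).
Proof.
apply: nondecreasing_is_cvgn; first exact: greenN_nd.
exists (1 + green_cst) => _ [n _ <-].
have := @greenN_sqr n [:: x] isT; rewrite big_seq1; have := greenN_ge0 n x.
nra.
Qed.

Definition green x : R := limn (greenN ^~ x).

Lemma green_cvg x : greenN n x @[n --> \oo] --> green x.
Proof. exact: cvg_greenN. Qed.

Lemma greenN_le n x : greenN n x <= green x.
Proof.
by apply: (nondecreasing_cvgn_le (u_ := greenN ^~ x)); [exact: greenN_nd | exact: cvg_greenN].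
Qed.

Lemma green_ge0 x : 0 <= green x.
Proof. exact: le_trans (greenN_ge0 0 x) (greenN_le 0 x). Qed.

Lemma cvg_sumr (T : Type) (H : set_system T) (I : Type) (r : seq I) (P : pred I)
    (a : I -> T -> R) (l : I -> R) : Filter H ->
  (forall i, P i -> a i t @[t --> H] --> l i) ->
  \sum_(i <- r | P i) a i t @[t --> H] --> \sum_(i <- r | P i) l i.
Proof. by move=> FH h; apply: cvg_big => //; exact: add_continuous. Qed.

Lemma green_sqr s : uniq s -> \sum_(x <- s) green x ^+ 2 <= green_cst.
Proof.
move=> us.
have : \sum_(x <- s) greenN n x ^+ 2 @[n --> \oo] --> \sum_(x <- s) green x ^+ 2.
  by apply: cvg_sumr => x _; rewrite expr2; apply: cvgM; exact: green_cvg.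
by move=> /cvgr_to_le; apply; apply: nearW => n; exact: greenN_sqr.
Qed.

Lemma cvg_avg (T : Type) (H : set_system T) (a : T -> V -> R) (l : V -> R) x : Filter H ->
  (forall x, a t x @[t --> H] --> l x) -> avg (a t) x @[t --> H] --> avg l x.
Proof. by move=> FH h; apply: cvgMl_tmp; apply: cvg_sumr => k _; exact: h. Qed.

Lemma avg_greenN n : avg (greenN n) = (fun x => greenN n.+1 x - delta0 R x).
Proof.
rewrite /greenN avg_sum; apply/funext => x.
by rewrite big_ord_recl /= addrAC subrr add0r.
Qed.

Lemma avg_green : avg green = (fun x => green x - delta0 R x).
Proof.
apply/funext => x.
have h1 : avg (greenN n) x @[n --> \oo] --> avg green x by apply: cvg_avg => y; exact: green_cvg.
have h2 : greenN n.+1 x - delta0 R x @[n --> \oo] --> green x - delta0 R x.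
  apply: cvgB; last exact: cvg_cst.
  by move: (@green_cvg x); rewrite -cvg_shiftS.
have e : (fun n => avg (greenN n) x) = (fun n => greenN n.+1 x - delta0 R x).
  by apply/funext => n; rewrite avg_greenN.
by apply: (cvg_unique _ h1) => //; rewrite e.
Qed.

Lemma iter_avg_green n x : iter n avg green x = green x - greenN n x.
Proof.
elim: n x => [|n IH] x; first by rewrite /greenN big_ord0 subr0.
have e : iter n avg green = (fun x => green x - greenN n x) by exact/funext.
rewrite iterS e.
by rewrite avgB avg_green avg_greenN; lra.
Qed.

Lemma iter_avg_green_cvg x : iter n avg green x @[n --> \oo] --> (0 : R).
Proof.
have e : (fun n => iter n avg green x) = (fun n => green x - greenN n x).
  by apply/funext => n; rewrite iter_avg_green.
rewrite e -(subrr (green x)); apply: cvgB; [exact: cvg_cst|exact: green_cvg].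
Qed.

Lemma green0_ge1 : 1 <= green 0.
Proof.
apply: le_trans (greenN_le 1 0); rewrite /greenN big_ord_recl big_ord0 addr0.
by rewrite /heat /= /delta0 eqxx.
Qed.

Lemma green0_gt0 : 0 < green 0.
Proof. exact: lt_le_trans ltr01 green0_ge1. Qed.

Lemma greenN_arg x : green (- x) = green x.
Proof.
rewrite /green; congr (limn _); apply/funext => n; rewrite /greenN.
by apply: eq_bigr => k _; rewrite heatN.
Qed.

Lemma superharmonic_gt0 (f : V -> R) x0 : (forall x, 0 <= f x) ->
  (forall x, x != x0 -> avg f x <= f x) -> 0 < f x0 -> forall x, 0 < f x.
Proof.
move=> f0 fs; pose S x := 0 < f x; move=> S0; apply: (@lattice_ind _ S x0) => // x k Sx.
have [e|ne] := eqVneq (x + dir k) x0; first by rewrite /S e.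
apply: lt_le_trans (fs _ ne); rewrite /avg mulr_gt0 ?invr_gt0 ?ltr0n ?muln_gt0//.
rewrite (bigD1 (opp k))//= addr_dirK ltr_wpDr//.
by apply: sumr_ge0.
Qed.

Lemma green_gt0 x : 0 < green x.
Proof.
move: x; apply: (@superharmonic_gt0 _ 0); [exact: green_ge0 | | exact: green0_gt0].
by move=> x _; rewrite avg_green gerBl ler0n.
Qed.

(** A maximum principle at infinity: f <= avg^n f <= avg^n F. Domination by such an [F] replaces
    boundary values. *)
Lemma subharmonic_le0 f F : (forall x, f x <= avg f x) -> (forall x, f x <= F x) ->
  (forall x, iter n avg F x @[n --> \oo] --> (0 : R)) -> forall x, f x <= 0.
Proof.
move=> sf fF hF x; apply: (cvgr_to_ge (hF x)); apply: nearW => n /=.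
exact: le_trans (subharmonic_iter n sf x) (iter_avg_le n fF x).
Qed.

Lemma green_tail (e : R) : 0 < e -> exists B : {fset V}, forall s, uniq s ->
  (forall x, x \in s -> x \notin B) -> \sum_(x <- s) green x ^+ 2 <= e.
Proof.
move=> e0; pose A := [set \sum_(x <- s) green x ^+ 2 | s in [set s : seq V | uniq s]].
have As : has_sup A.
  split; first by exists 0; exists [::] => //; rewrite big_nil.
  by exists green_cst => _ [s us <-]; exact: green_sqr.
(* A finite set whose sum is within [e] of the supremum leaves at most [e] for any set disjoint from
   it. *)
have [_ [s us <-] hs] := sup_adherent e0 As.
exists [fset x in s]%fset => s' us' dis.
have : \sum_(x <- s ++ s') green x ^+ 2 <= sup A.
  apply: ub_le_sup; first by case: As.
  exists (s ++ s') => //=; rewrite cat_uniq us us' andbT /=.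
  apply/hasPn => x xs'; have := dis x xs'; by rewrite !inE.
rewrite big_cat /=; lra.
Qed.

Lemma green_small (e : R) : 0 < e -> exists B : {fset V}, forall x, x \notin B -> green x < e.
Proof.
move=> e0; have e2 : 0 < e ^+ 2 / 2 by rewrite divr_gt0// exprn_gt0.
have [B hB] := green_tail e2.
exists B => x xB; have := hB [:: x] isT.
rewrite big_seq1 => h; have {}h : green x ^+ 2 <= e ^+ 2 / 2.
  by apply: h => y; rewrite inE => /eqP ->.
have := green_gt0 x; nra.
Qed.

End Green.

(** * Positive harmonic functions *)

Section Liouville.
Variables (R : realType) (d : nat).
Hypothesis hd : (5 <= d)%N.
Local Notation V := 'rV[int]_d.
Local Notation D := ('I_d * bool)%type.
Local Notation avg := (@avg d R).
Implicit Types (x y : V) (f g : V -> R) (k : D) (m : seq (D * R)).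

Let d0 : (0 < d)%N. Proof. by lia. Qed.
Let d2 : 0 < (2 * d)%:R :> R. Proof. by rewrite ltr0n muln_gt0. Qed.

Lemma ultra_fmap (T U : Type) (a : T -> U) (G : set_system T) :
  UltraFilter G -> UltraFilter (a @ G).
Proof.
move=> GU; have GP : ProperFilter G by exact: ultra_proper.
split=> [|H HP sub]; first exact: fmap_proper_filter.
apply/seteqP; split=> [B HB|]; last exact: sub.
have [//|GB] := in_ultra_setVsetC (a @^-1` B) GU.
have HnB : H (~` B) by apply: sub.
by have [y []] := filter_ex (filterI HB HnB).
Qed.

(** An ultrafilter makes all coordinates converge at once, without a diagonal subsequence; since it
    refines [\oo], ordinary limits persist along it. *)
Lemma ultralimit (u : nat -> V -> R) (C : V -> R) : (forall n x, 0 <= u n x <= C x) ->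
  exists F : set_system nat, [/\ ProperFilter F, \oo `<=` F &
    exists f : V -> R, forall x, u n x @[n --> F] --> f x].
Proof.
move=> hu; have [G [Gu oG]] := ultraFilterLemma (eventually_filter : ProperFilter \oo).
have GP : ProperFilter G by exact: ultra_proper.
exists G; split => //.
suff h x : exists l : R, u n x @[n --> G] --> l.
  by have [f hf] := choice h; exists f.
have cpt := @segment_compact R 0 (C x).
rewrite compact_ultra in cpt.
have [||l [_ hl]] := cpt (u n x @[n --> G]).
- exact: ultra_fmap.
- by apply: (@filterE _ G) => n /=; rewrite in_itv /=; exact: hu.
- by exists l.
Qed.

Definition pos_harmonic f := (forall x, 0 < f x) /\ (forall x, avg f x = f x).

Lemma pos_harmonic_step f x k : (forall x, 0 <= f x) -> avg f x <= f x ->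
  f (x + dir k) <= (2 * d)%:R * f x.
Proof.
move=> f0 fh; apply: le_trans (ler_wpM2l (ltW d2) fh); rewrite -sum_dir//.
by rewrite (bigD1 k)//= lerDl sumr_ge0.
Qed.

Lemma harnack x : exists C : R, forall f, pos_harmonic f -> f 0 = 1 -> f x <= C.
Proof.
move: x; apply: (@lattice_ind d _ 0); first by exists 1 => f _ ->.
move=> x k [C hC]; exists ((2 * d)%:R * C) => f [f0 fh] f1.
have := @pos_harmonic_step f x k (fun x => ltW (f0 x)); rewrite fh => /(_ (lexx _)) h.
by apply: (le_trans h); apply: ler_wpM2l; [exact: ltW | exact: hC].
Qed.

(** Each pair in [m] is a direction with its multiplier; when every direction occurs, these
    functions are exponentials. *)
Definition multiplicative m f := pos_harmonic f /\
  forall p, p \in m -> forall x, f (x + dir p.1) = p.2 * f x.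

Lemma multiplicative_normalize m f x : multiplicative m f ->
  multiplicative m (fun y => (f x)^-1 * f (y + x)).
Proof.
move=> [[f0 fh] fm]; split; first split => y.
- by rewrite mulr_gt0// invr_gt0.
- by rewrite avgZ avg_shift fh.
by move=> p pm y; rewrite addrAC fm//; ring.
Qed.

(* The supremum of [f (dir k) / f 0] over the class is attained by compactness. A maximizer
   is then multiplicative in the direction [k], since [M f - f (_ + dir k)] is a nonnegative
   harmonic function vanishing at 0. *)
Lemma multiplicative_extend m k : (exists f, multiplicative m f) ->
  exists M : R, (forall f, multiplicative m f -> forall x, f (x + dir k) <= M * f x) /\
    exists f, multiplicative ((k, M) :: m) f.
Proof.
move=> [f1 hf1].
pose A := [set f (dir k) | f in [set f | multiplicative m f /\ f 0 = 1]].
have normed f x : multiplicative m f -> A (f (x + dir k) / f x).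
  move=> hf; exists (fun y => (f x)^-1 * f (y + x)); last by rewrite addrC mulrC.
  split; first exact: multiplicative_normalize.
  by rewrite add0r mulVf// gt_eqF//; case: hf => -[].
have As : has_sup A.
  split; first by eexists; exact: (normed f1 0).
  exists (2 * d)%:R => _ [f [[[f0 fh] _] f01] <-].
  have := @pos_harmonic_step f 0 k (fun x => ltW (f0 x)); rewrite fh => /(_ (lexx _)).
  by rewrite add0r f01 mulr1.
have ub := sup_upper_bound As.
exists (sup A); split.
  move=> f hf x; rewrite -ler_pdivrMr; last by case: hf => -[].
  by apply: ub; exact: normed.
have /choice[u hu] (n : nat) : exists f, [/\ multiplicative m f, f 0 = 1 &
    sup A - n.+1%:R^-1 < f (dir k)].
  have n0 : 0 < n.+1%:R^-1 :> R by rewrite invr_gt0.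
  by have [_ [f [hf f01] <-] hh] := sup_adherent n0 As; exists f.
have [C hC] := choice harnack.
have [|F [FP oF [f hf]]] := @ultralimit u C.
  move=> n x; have [[fp _] f01 _] := hu n.
  by rewrite hC// andbT ltW//; case: fp.
exists f.
have f01 : f 0 = 1.
  apply: (cvg_unique _ (hf 0)) => //.
  have -> : (fun n => u n 0) = (fun=> 1) by apply/funext => n; case: (hu n).
  exact: cvg_cst.
have f0 x : 0 <= f x.
  apply: (cvgr_to_ge (hf x)); apply: nearW => n.
  by have [[[up _] _] _ _] := hu n; exact: ltW.
have fh x : avg f x = f x.
  have h1 : avg (u n) x @[n --> F] --> avg f x by exact: cvg_avg.
  apply: (cvg_unique _ h1) => //.
  have -> : (fun n => avg (u n) x) = (fun n => u n x).
    by apply/funext => n; have [[[_ ->] _] _ _] := hu n.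
  exact: hf.
have fp x : 0 < f x.
  apply: (@superharmonic_gt0 R d hd f 0) => //; first by move=> y _; rewrite fh.
  by rewrite f01.
have fm p : p \in m -> forall x, f (x + dir p.1) = p.2 * f x.
  move=> pm x; apply: (cvg_unique _ (hf _)) => //.
  have -> : (fun n => u n (x + dir p.1)) = (fun n => p.2 * u n x).
    by apply/funext => n; have [[_ um] _ _] := hu n; exact: um.
  by apply: cvgMl_tmp; exact: hf.
have fM : multiplicative m f by split.
have fk : f (dir k) = sup A.
  apply/eqP; rewrite eq_le; apply/andP; split.
    by apply: ub; exists f.
  have h1 : sup A - n.+1%:R^-1 @[n --> F] --> sup A - 0.
    apply: cvgB; first exact: cvg_cst.
    by move=> B hB; apply: oF; exact: (cvg_harmonic hB).
  rewrite subr0 in h1; apply: (ler_cvg_to h1 (hf (dir k))).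
  by apply: nearW => n; have [_ _ /ltW] := hu n.
split => // p; rewrite inE => /orP[/eqP -> x /=|]; last exact: fm.
pose w x := sup A * f x - f (x + dir k).
have w0 y : 0 <= w y.
  rewrite subr_ge0 -ler_pdivrMr ?fp//.
  by apply: ub; exact: normed.
have wh y : avg w y = w y by rewrite avgB avgZ avg_shift !fh.
apply/eqP; rewrite eq_sym -subr_eq0 -/(w x); apply: contraT => wx.
have : 0 < w 0.
  apply: (@superharmonic_gt0 R d hd w x) => //; first by move=> y _; rewrite wh.
  by rewrite lt_neqAle eq_sym wx w0.
by rewrite /w f01 add0r fk mulr1 subrr ltxx.
Qed.

Lemma multiplicative_all (s : seq D) m : (exists f, multiplicative m f) ->
  exists m', [/\ {subset m <= m'}, exists f, multiplicative m' f &
    forall k, k \in s -> exists a, (k, a) \in m'].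
Proof.
elim: s m => [|k s IH] m hm; first by exists m; split.
have [M [_ hM]] := multiplicative_extend k hm.
have [m' [mm hm' hs]] := IH _ hM.
exists m'; split => //; first by move=> p pm; apply: mm; rewrite inE pm orbT.
move=> k'; rewrite inE => /orP[/eqP ->|/hs//].
by exists M; apply: mm; rewrite inE eqxx.
Qed.

(** The best constant [M] in direction [k] over all positive harmonic functions is realised by an
    exponential [g]. Harmonicity makes the multipliers of [g] average to 1, while opposite ones have
    product 1; by the arithmetic-geometric inequality all are 1, so [M = 1]. *)
Lemma pos_harmonic_dir_le f x k : pos_harmonic f -> f (x + dir k) <= f x.
Proof.
move=> hf.
have h0 : exists f, multiplicative [::] f by exists f; split.
have [M [hM hex]] := multiplicative_extend k h0.
suff M1 : M = 1 by have := hM f _ x; rewrite M1 mul1r; apply; split.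
have [m [mm [g [[g0 gh] gm]] hs]] := multiplicative_all (enum [set: D]) hex.
have /choice[a ha] l : exists b, (l, b) \in m by apply: hs; rewrite mem_enum inE.
have ga l y : g (y + dir l) = a l * g y by exact: (gm (l, a l)).
have gn0 y : g y != 0 by rewrite gt_eqF.
have aE l : a l * a (opp l) = 1.
  by apply: (mulIf (gn0 0)); rewrite mul1r mulrC mulrA [g 0 * _]mulrC -ga mulrC -ga addr_dirK.
have asum : \sum_l a l = (2 * d)%:R.
  apply: (mulIf (gn0 0)); rewrite mulr_suml -[in RHS]gh -sum_dir//.
  by apply: eq_bigr => l _; rewrite ga.
have asum' : \sum_l (a l + a (opp l) - 2) = 0.
  have e : \sum_l a (opp l) = \sum_l a l by rewrite [RHS](reindex_inj (inv_inj (@oppK d))).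
  rewrite sumrB big_split /= e asum sumr_const card_prod card_ord card_bool.
  by rewrite -(mulr_natr 2) !natrM; ring.
have ap l : 0 < a l by rewrite -(pmulr_lgt0 _ (g0 0)) -ga.
have age l : 0 <= a l + a (opp l) - 2.
  have := sqr_ge0 (a l - 1); have := aE l; have := ap l; have := ap (opp l).
  move: (a l) (a (opp l)) => p q q0 p0 pq; nra.
have /eqP := asum'; rewrite psumr_eq0// => /allP/(_ k (mem_index_enum _)) /eqP /= ak.
have -> : M = a k.
  apply: (mulIf (gn0 0)); rewrite -ga (gm (k, M))//.
  by apply: mm; rewrite inE eqxx.
have := aE k; have := ap k; move: ak; move: (a k) (a (opp k)) => p q h p0 pq.
apply/eqP; rewrite -subr_eq0 -sqrf_eq0; apply/eqP.
have qE : q = 2 - p by lra.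
by rewrite qE in pq; lra.
Qed.

Theorem liouville f : (forall x, 0 <= f x) -> (forall x, avg f x = f x) ->
  forall x, f x = f 0.
Proof.
move=> f0 fh.
(* Adding 1 gives strict positivity; the one-step inequality in a direction and in its opposite then
   yields equality. *)
have hp : pos_harmonic (fun x => f x + 1).
  split=> x; first by rewrite ltr_wpDl.
  by rewrite avgD fh avg_cst.
have le x k : f (x + dir k) <= f x.
  by have := pos_harmonic_dir_le x k hp; rewrite lerD2r.
apply: (@lattice_ind d _ 0) => // x k hx; rewrite -hx.
by apply/eqP; rewrite eq_le le /= -{1}(addr_dirK x k) le.
Qed.

End Liouville.

(** * Hitting probabilities of Markov chains *)

Section MeasureFacts.
Variables (R : realType) (V : countType).
Context {disp : measure_display} {Omega : measurableType disp}.
Variable P : probability Omega R.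

Lemma countable_bigcup_le (A : V -> set Omega) (Q : set V) (e : R) :
  (forall v, measurable (A v)) ->
  (forall s, uniq s -> (forall v, v \in s -> Q v) ->
     (\sum_(v <- s) P (A v) <= e%:E)%E) ->
  measurable (\bigcup_(v in Q) A v) /\ (P (\bigcup_(v in Q) A v) <= e%:E)%E.
Proof.
move=> mA hA.
(* [B] lists the events by the code of their index, and other codes give the empty event. The test
   [choice.pickle v = n] prevents an index from being counted twice. *)
pose B n := if @choice.unpickle V n is Some v then
  (if `[< Q v /\ choice.pickle v = n >] then A v else set0) else set0.
have mB n : measurable (B n) by rewrite /B; case: choice.unpickle => // v; case: asbool.
have eB : \bigcup_(v in Q) A v = \bigcup_n B n.
  apply/seteqP; split=> w.
    by move=> [v Qv Aw]; exists (choice.pickle v) => //; rewrite /B choice.pickleK asboolT.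
  move=> [n _]; rewrite /B; case: choice.unpickle => // v.
  by case: asboolP => // -[Qv _] Aw; exists v.
have mU : measurable (\bigcup_n B n) by exact: bigcup_measurable.
rewrite eB; split => //.
have h := @measure_sigma_subadditive _ _ _ P (\bigcup_n B n) B mB mU (@subset_refl _ _).
apply: (le_trans h); apply: lime_le; first by apply: is_cvg_nneseries => n _ _.
apply: nearW => n.
pose ok k := if @choice.unpickle V k is Some v then `[< Q v /\ choice.pickle v = k >] else false.
pose s := pmap (fun k => if ok k then @choice.unpickle V k else None) (iota 0 n).
have -> : (\sum_(0 <= i < n) P (B i) = \sum_(v <- s) P (A v))%E.
  rewrite /index_iota subn0 {}/s; elim: (iota 0 n) => [|k r IH]; first by rewrite !big_nil.
  rewrite big_cons /= IH /B /ok; case e1 : (@choice.unpickle V k) => [v|]; last by rewrite measure0 add0e.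
  by case: asboolP => _ /=; rewrite ?big_cons// measure0 add0e.
apply: hA.
  have : uniq (iota 0 n) by exact: iota_uniq.
  rewrite /s; elim: (iota 0 n) => //= k r IH /andP[kr ur].
  case e1 : (ok k); last exact: IH.
  move: (e1); rewrite {1}/ok; case e2 : (@choice.unpickle V k) => [v|] //= /asboolP[Qv vk].
  rewrite IH// andbT; apply: contra kr; rewrite mem_pmap => /mapP[j jr].
  case e3 : (ok j) => // e4; move: e3; rewrite /ok -e4 => /asboolP[_ vj].
  by rewrite -vk vj.
move=> v; rewrite /s mem_pmap => /mapP[j jr]; case e3 : (ok j) => // e4.
by move: e3; rewrite /ok -e4 => /asboolP[].
Qed.

Lemma countable_bigcup_null (A : V -> set Omega) (Q : set V) :
  (forall v, measurable (A v)) -> (forall v, Q v -> P (A v) = 0%E) ->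
  measurable (\bigcup_(v in Q) A v) /\ P (\bigcup_(v in Q) A v) = 0%E.
Proof.
move=> mA A0; have [|mU h] := @countable_bigcup_le A Q 0 mA.
  by move=> s _ sQ; rewrite big1_seq// => v /= /sQ/A0.
by split=> //; apply/eqP; rewrite eq_le h measure_ge0.
Qed.

Lemma measure_split (A : set Omega) (Z : Omega -> V) (s : seq V) :
  measurable A -> (forall v, measurable [set w | Z w = v]) -> uniq s ->
  (forall v, v \notin s -> P (A `&` [set w | Z w = v]) = 0%E) ->
  P A = (\sum_(v <- s) P (A `&` [set w | Z w = v]))%E.
Proof.
move=> + mZ; elim: s A => [|v s IH] A mA /=.
  move=> _ A0; rewrite big_nil.
  have mAZ v : measurable (A `&` [set w | Z w = v]) by exact: measurableI.
  have [_ h] := countable_bigcup_null mAZ (fun v (_ : setT v) => A0 v isT).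
  rewrite -h; congr (P _); apply/seteqP; split => w; first by move=> Aw; exists (Z w).
  by move=> [u _ []].
move=> /andP[vs us] A0; rewrite big_cons.
have -> : P A = (P (A `&` [set w | Z w = v]) + P (A `\` [set w | Z w = v]))%E.
  by rewrite addeC -measureDI.
congr (_ + _)%E; rewrite (IH (A `\` _)).
- apply: eq_big_seq => u us'; congr (P _); apply/seteqP; split => w /=.
    by move=> [[]].
  by move=> [Aw wu]; split=> //; split=> // wv; rewrite -wv wu us' in vs.
- exact: measurableD.
- exact: us.
move=> u hu; have [->|uv] := eqVneq u v.
  by rewrite (_ : _ `&` _ = set0) ?measure0//; apply/seteqP; split => // w [[_ h]] /=.
rewrite (_ : _ `&` _ = A `&` [set w | Z w = u]); first by apply: A0; rewrite inE negb_or uv.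
apply/seteqP; split => w /=; first by move=> [[]].
by move=> [Aw wu]; split=> //; split=> // wv; rewrite -wv wu eqxx in uv.
Qed.

End MeasureFacts.

Section Hitting.
Variables (R : realType) (d : nat).
Local Notation V := 'rV[int]_d.
Local Notation D := ('I_d * bool)%type.
Variable K : V -> V -> R.
Hypothesis K_local : forall x y, K x y != 0 -> exists k, y = x + dir k.
Variable a : V.

(** The probability of visiting [a] within [n] steps from [x]. Summing over lattice directions loses
    nothing, by [K_local]. *)
Fixpoint hit n (x : V) : R :=
  if x == a then 1
  else if n is m.+1 then \sum_k K x (x + dir k) * hit m (x + dir k) else 0.

Lemma hit_target n : hit n a = 1.
Proof. by case: n => [|n] /=; rewrite eqxx. Qed.

Lemma hit_le (s : V -> R) : (forall x y, 0 <= K x y) -> (forall x, 0 <= s x) -> 1 <= s a ->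
  (forall x, x != a -> \sum_k K x (x + dir k) * s (x + dir k) <= s x) ->
  forall n x, hit n x <= s x.
Proof.
move=> K0 s0 sa sK; elim=> [|n IH] x /=; case: eqVneq => [->//|xa] //.
apply: le_trans (sK _ xa); apply: ler_sum => k _; exact: ler_wpM2l.
Qed.

Lemma hit_ge0 n x : (forall x y, 0 <= K x y) -> 0 <= hit n x.
Proof.
move=> K0; elim: n x => [|n IH] x /=; case: ifP => // _.
by apply: sumr_ge0 => k _; rewrite mulr_ge0.
Qed.

Lemma hit_nd n x : (forall x y, 0 <= K x y) -> hit n x <= hit n.+1 x.
Proof.
move=> K0; elim: n x => [|n IH] x /=; case: ifP => // _.
  by apply: sumr_ge0 => k _; rewrite mulr_ge0//; exact: (hit_ge0 0).
by apply: ler_sum => k _; rewrite ler_wpM2l//; exact: IH.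
Qed.

Context {disp : measure_display} {Omega : measurableType disp}.
Variables (P : probability Omega R) (X : nat -> Omega -> V) (mu : V -> R).
Hypothesis chain : markov_chain P X mu K.

Lemma measurable_state n v : measurable [set w | X n w = v].
Proof. by case: chain. Qed.

Lemma measurable_prefix n (x : nat -> V) :
  measurable [set w | forall i, (i <= n)%N -> X i w = x i].
Proof.
rewrite (_ : mkset _ = \bigcap_(i in [set i | (i <= n)%N]) [set w | X i w = x i]).
  by apply: bigcap_measurable => [|i _]; [exists n => /= | exact: measurable_state].
by apply/seteqP; split => w h i; exact: h.
Qed.

Lemma measurable_visit m n v : measurable [set w | exists j, (m <= j <= n)%N /\ X j w = v].
Proof.
rewrite (_ : mkset _ = \bigcup_(i in [set j | (m <= j <= n)%N]) [set w | X i w = v]).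
  by apply: bigcup_measurable => i _; exact: measurable_state.
by apply/seteqP; split => w [j]; [move=> [? ?]; exists j | move=> ? ?; exists j].
Qed.

(** This stands for the Markov property: [markov_chain] gives only the probabilities of initial
    segments, so the whole segment is carried along, and the induction on [n] lengthens it by one
    state. *)
Lemma prefix_visit n m (x : nat -> V) :
  P ([set w | forall i, (i <= m)%N -> X i w = x i] `&`
     [set w | exists j, (m <= j <= m + n)%N /\ X j w = a]) =
  (mu (x 0%N) * (\prod_(i < m) K (x i) (x i.+1)) * hit n (x m))%:E.
Proof.
elim: n m x => [|n IH] m x; have [xa|xa] := eqVneq (x m) a.
- rewrite xa hit_target mulr1; case: chain => _ <-; congr (P _).
  apply/seteqP; split => w /=; first by case.
  by move=> h; split=> //; exists m; rewrite addn0 leqnn h.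
- rewrite /= (negPf xa) mulr0 (_ : _ `&` _ = set0) ?measure0//.
  apply/seteqP; split => // w /= [h [j [jm]]].
  have -> : j = m by lia.
  by rewrite h// => e; rewrite e eqxx in xa.
- rewrite xa hit_target mulr1; case: chain => _ <-; congr (P _).
  apply/seteqP; split => w /=; first by case.
  by move=> h; split=> //; exists m; rewrite h//; split => //; lia.
pose s := [seq x m + dir k | k <- index_enum D].
have us : uniq s by rewrite map_inj_uniq ?index_enum_uniq// => k l /addrI /dir_inj.
pose x' v i := if i == m.+1 then v else x i.
have x'E v i : (i <= m)%N -> x' v i = x i.
  by move=> im; rewrite /x'; case: eqP => //; lia.
have x'm v : x' v m.+1 = v by rewrite /x' eqxx.
have hv v : P (([set w | forall i, (i <= m)%N -> X i w = x i] `&`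
     [set w | exists j, (m <= j <= m + n.+1)%N /\ X j w = a]) `&` [set w | X m.+1 w = v]) =
   (mu (x 0%N) * (\prod_(i < m) K (x i) (x i.+1)) * (K (x m) v * hit n v))%:E.
  have e1 : \prod_(i < m.+1) K (x' v i) (x' v i.+1) =
     (\prod_(i < m) K (x i) (x i.+1)) * K (x m) v.
    rewrite big_ord_recr /= x'E// x'm; congr (_ * _).
    by apply: eq_bigr => i _; rewrite !x'E//; have := ltn_ord i; lia.
  have := IH m.+1 (x' v); rewrite e1 x'E// x'm !mulrA => <-.
  congr (P _); apply/seteqP; split => w /=.
    move=> [[h [j [jm Xj]]] Xv]; split.
      by move=> i im; rewrite /x'; case: eqP => [->//|ine]; apply: h; lia.
    exists j; split=> //; apply/andP; split; last by lia.
    have : j <> m by move=> jm'; move: xa; rewrite -h// -jm' Xj eqxx.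
    by lia.
  move=> [h [j [jm Xj]]]; split; last by rewrite h// x'm.
  split; first by move=> i im; rewrite h ?x'E//; lia.
  by exists j; split => //; lia.
rewrite (@measure_split _ V _ _ P _ (X m.+1) s) //.
- under eq_bigr do rewrite hv.
  by rewrite sumEFin -mulr_sumr /s big_map /= (negPf xa).
- by apply: measurableI; [exact: measurable_prefix | exact: measurable_visit].
- exact: measurable_state.
move=> v vs; rewrite hv.
suff -> : K (x m) v = 0 by rewrite mul0r mulr0.
apply/eqP; apply: contraNT vs => /K_local[k ->].
by apply/mapP; exists k => //; rewrite mem_index_enum.
Qed.

Variable supp : seq V.
Hypothesis supp_uniq : uniq supp.
Hypothesis mu_supp : forall v, v \notin supp -> mu v = 0.

Lemma visit_before n :
  P [set w | exists j, (0 <= j <= n)%N /\ X j w = a] =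
  (\sum_(v <- supp) mu v * hit n v)%:E.
Proof.
have hv v : P ([set w | exists j, (0 <= j <= n)%N /\ X j w = a] `&` [set w | X 0%N w = v]) =
    (mu v * hit n v)%:E.
  have := prefix_visit n 0%N (fun=> v); rewrite big_ord0 mulr1 add0n => <-.
  rewrite setIC; congr (P (_ `&` _)); apply/seteqP; split => w /=; last exact.
  by move=> <- i; rewrite leqn0 => /eqP ->.
rewrite (@measure_split _ V _ _ P _ (X 0%N) supp) //.
- by under eq_bigr do rewrite hv; rewrite sumEFin.
- exact: measurable_visit.
- exact: measurable_state.
by move=> v vs; rewrite hv mu_supp// mul0r.
Qed.

Lemma measurable_ever : measurable [set w | exists n, X n w = a].
Proof.
rewrite (_ : mkset _ = \bigcup_i [set w | X i w = a]).
  by apply: bigcup_measurable => i _; exact: measurable_state.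
by apply/seteqP; split => w [j]; [move=> ?; exists j | move=> ? ?; exists j].
Qed.

Lemma visit_cvg :
  (\sum_(v <- supp) mu v * hit n v)%:E @[n --> \oo] --> P [set w | exists n, X n w = a].
Proof.
have -> : [set w | exists n, X n w = a] =
    \bigcup_n [set w | exists j, (0 <= j <= n)%N /\ X j w = a].
  apply/seteqP; split => w /=; first by move=> [n hn]; exists n => //; exists n.
  by move=> [n _ [j [_ hj]]]; exists j.
have -> : (fun n => (\sum_(v <- supp) mu v * hit n v)%:E) =
  P \o (fun n => [set w | exists j, (0 <= j <= n)%N /\ X j w = a]).
  by apply/funext => n /=; rewrite visit_before.
apply: nondecreasing_cvg_mu.
- by move=> n; exact: measurable_visit.
- by apply: bigcup_measurable => n _; exact: measurable_visit.
move=> n m nm; apply/subsetPset => w [j [jn Xj]]; exists j; split => //; lia.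
Qed.

End Hitting.

(** * The reweighted network *)

Section LatticeNetwork.
Variables (R : realType) (d : nat).
Hypothesis hd : (5 <= d)%N.
Local Notation V := 'rV[int]_d.
Local Notation D := ('I_d * bool)%type.
Local Notation avg := (@avg d R).
Local Notation green := (@green R d).

Let d0 : (0 < d)%N. Proof. by lia. Qed.
Let d2 : 0 < (2 * d)%:R :> R. Proof. by rewrite ltr0n muln_gt0. Qed.

Lemma neighbors_sum (N : weighted_graph R V) x (F : V -> R) : edges N = @Zd_edges d ->
  \sum_(z \in neighbors N x) F z = \sum_k F (x + dir k).
Proof.
move=> eN; pose s := [seq x + dir k | k <- index_enum D].
have us : uniq s by rewrite map_inj_uniq ?index_enum_uniq// => k l /addrI /dir_inj.
have -> : neighbors N x = [set` s].
  apply/seteqP; split => z /=.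
    rewrite /neighbors /= eN => /zd_edgesP[k ->].
    by apply/mapP; exists k => //; rewrite mem_index_enum.
  by move=> /mapP[k _ ->]; rewrite /neighbors /= eN; apply/zd_edgesP; exists k.
by rewrite -fsbig_seq// /s big_map.
Qed.

Lemma adj_dir x k : adj (@Zd_edges d) x (x + dir k).
Proof. by apply/zd_edgesP; exists k. Qed.

Lemma walk_kernel_local (N : weighted_graph R V) x y : edges N = @Zd_edges d ->
  walk_kernel N x y != 0 -> exists k, y = x + dir k.
Proof.
by move=> eN; rewrite /walk_kernel eN; case: ifP => [/zd_edgesP//|_]; rewrite eqxx.
Qed.

Lemma simple_kernel x k : walk_kernel (simple_Zd R d) x (x + dir k) = (2 * d)%:R^-1.
Proof.
rewrite /walk_kernel adj_dir /vertex_cond neighbors_sum// /cond /=.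
by rewrite sumr_const card_prod card_ord card_bool mulnC mul1r.
Qed.

Lemma simple_kernel_ge0 x y : 0 <= walk_kernel (simple_Zd R d) x y.
Proof.
rewrite /walk_kernel; case: ifP => // /zd_edgesP[k ->].
by have := simple_kernel x k; rewrite /walk_kernel adj_dir => ->; rewrite invr_ge0.
Qed.

Lemma hit_simple o n x : hit (walk_kernel (simple_Zd R d)) o n.+1 x =
  if x == o then 1 else avg (hit (walk_kernel (simple_Zd R d)) o n) x.
Proof.
rewrite /=; case: eqP => // _; rewrite /avg mulr_sumr.
by apply: eq_bigr => k _; rewrite simple_kernel.
Qed.

Variables (o : V) (phi : V -> R).

Section HittingProbability.
Hypothesis hphi : forall v, is_hitting_probability (simple_Zd R d) v o (phi v).

(** The hypothesis on [phi] only asserts that some realisation of the walk exists; this expresses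
    [phi] through the kernel alone. *)
Lemma phi_cvg v : hit (walk_kernel (simple_Zd R d)) o n v @[n --> \oo] --> phi v.
Proof.
have [disp [ Omega [P [X [hX hP]]]]] := hphi v.
have := visit_cvg (fun x y => @walk_kernel_local (simple_Zd R d) x y erefl) (a := o) hX
  (supp := [:: v]) isT.
have -> : (fun n => (\sum_(u <- [:: v]) (u == v)%:R *
    hit (walk_kernel (simple_Zd R d)) o n u)%:E) =
    EFin \o (fun n => hit (walk_kernel (simple_Zd R d)) o n v).
  by apply/funext => n; rewrite big_seq1 eqxx mul1r.
rewrite hP => h; suff /fine_cvgP[] : (EFin \o (fun n => hit (walk_kernel (simple_Zd R d)) o n v)) n
  @[n --> \oo] --> (phi v)%:E by [].
by apply: h => u; rewrite inE => /negPf ->.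
Qed.

Lemma phi_avg x : x != o -> avg phi x = phi x.
Proof.
move=> xo.
have h1 : avg (hit (walk_kernel (simple_Zd R d)) o n) x @[n --> \oo] --> avg phi x.
  by apply: cvg_avg => y; exact: phi_cvg.
have h2 : hit (walk_kernel (simple_Zd R d)) o n.+1 x @[n --> \oo] --> phi x.
  by have := @phi_cvg x; rewrite -cvg_shiftS.
apply: (cvg_unique _ h1) => //.
have -> : (fun n => avg (hit (walk_kernel (simple_Zd R d)) o n) x) =
    (fun n => hit (walk_kernel (simple_Zd R d)) o n.+1 x).
  by apply/funext => n; rewrite hit_simple (negPf xo).
exact: h2.
Qed.

Lemma phi_target : phi o = 1.
Proof.
apply: (cvg_unique _ (@phi_cvg o)) => //.
have -> : (fun n => hit (walk_kernel (simple_Zd R d)) o n o) = (fun=> 1).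
  by apply/funext => n; rewrite hit_target.
exact: cvg_cst.
Qed.

Lemma phi_min (t : V -> R) : (forall x, 0 <= t x) -> 1 <= t o ->
  (forall x, x != o -> avg t x <= t x) -> forall x, phi x <= t x.
Proof.
move=> t0 to ts x; apply: (cvgr_to_le (@phi_cvg x)); apply: nearW => n /=.
apply: hit_le => //; first exact: simple_kernel_ge0.
move=> y yo; apply: le_trans (ts y yo); rewrite /avg mulr_sumr.
by apply: ler_sum => k _; rewrite simple_kernel.
Qed.

(** The Green quotient [G] is superharmonic with value 1 at [o], so minimality of [phi] gives one
    inequality. The difference [G - phi] is harmonic off [o] and has its minimum 0 at [o], hence is
    subharmonic; as it is dominated by [G], whose iterated averages vanish, it is nonpositive. *)
Lemma phiE x : phi x = green (x - o) / green 0.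
Proof.
have g0 := green0_gt0 R hd.
pose G y := green (y - o) / green 0.
have Ge y : G y = (green 0)^-1 * green (y - o) by rewrite /G mulrC.
have avgG : avg G = (fun y => (green 0)^-1 * (green (y - o) - delta0 R (y - o))).
  have -> : G = (fun y => (green 0)^-1 * green (y + - o)) by apply/funext.
  by rewrite avgZ avg_shift avg_green.
have Go : G o = 1 by rewrite /G subrr mulfV// gt_eqF.
have G0 y : 0 <= G y by rewrite divr_ge0 ?ltW// green_gt0.
have leG y : phi y <= G y.
  apply: phi_min => //; first by rewrite Go.
  move=> z zo; rewrite avgG Ge; apply: ler_wpM2l; first by rewrite invr_ge0 ltW.
  by rewrite gerBl ler0n.
apply/eqP; rewrite eq_le leG -subr_le0 -/(G x) /=.
apply: (@subharmonic_le0 R d (fun y => G y - phi y) G).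
- move=> y; rewrite avgB; have [->|yo] := eqVneq y o.
    rewrite Go phi_target subrr; have : 0 <= avg (fun y => G y - phi y) o.
      by apply: avg_ge0 => z; rewrite subr_ge0.
    by rewrite avgB.
  rewrite phi_avg// avgG Ge /delta0 subr_eq0 (negPf yo) subr0//.
- move=> y; rewrite gerBl; apply: (cvgr_to_ge (@phi_cvg y)); apply: nearW => n /=.
  by apply: hit_ge0; exact: simple_kernel_ge0.
move=> y.
have -> : (fun n => iter n avg G y) = (fun n => (green 0)^-1 * iter n avg green (y - o)).
  apply/funext => n; have -> : G = (fun y => (green 0)^-1 * green (y + - o)) by apply/funext.
  by rewrite iter_avgZ iter_avg_shift.
rewrite -(mulr0 (green 0)^-1); apply: cvgMl_tmp; exact: iter_avg_green_cvg.
Qed.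

Lemma phi_gt0 x : 0 < phi x.
Proof. by rewrite phiE divr_gt0 ?green_gt0// green0_gt0. Qed.

Lemma phi_neq0 x : phi x != 0.
Proof. by rewrite gt_eqF ?phi_gt0. Qed.

Lemma phi_le1 x : phi x <= 1.
Proof. by apply: (@phi_min (fun=> 1)) => // y _; rewrite avg_cst. Qed.

Lemma phi_min_scaled (t : V -> R) : (forall x, 0 <= t x) ->
  (forall x, x != o -> avg t x <= t x) -> forall x, t o * phi x <= t x.
Proof.
move=> t0 ts x; have [e|to] := eqVneq (t o) 0; first by rewrite e mul0r.
have to0 : 0 < t o by rewrite lt_neqAle eq_sym to t0.
rewrite mulrC -ler_pdivlMr// mulrC.
apply: (@phi_min (fun y => (t o)^-1 * t y)).
- by move=> y; rewrite mulr_ge0// invr_ge0.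
- by rewrite mulVf.
by move=> y yo; rewrite avgZ ler_wpM2l ?invr_ge0//; exact: ts.
Qed.

Lemma avg_phi_target : avg phi o = 1 - (green 0)^-1.
Proof.
have -> : phi = (fun y => (green 0)^-1 * green (y + - o)).
  by apply/funext => y; rewrite phiE mulrC.
by rewrite avgZ avg_shift avg_green// subrr /delta0 eqxx mulrBr mulr1 mulVf// gt_eqF ?green0_gt0.
Qed.

Lemma avg_phi_gt0 x : 0 < avg phi x.
Proof.
rewrite /avg mulr_gt0 ?invr_gt0// (bigD1 (Ordinal d0, true))//=.
by rewrite ltr_pwDl ?phi_gt0// sumr_ge0// => k _; rewrite ltW ?phi_gt0.
Qed.

Lemma phi_small (e : R) : 0 < e -> exists B : {fset V}, forall x, x \notin B -> phi x < e.
Proof.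
move=> e0; have g0 := green0_gt0 R hd.
have [B hB] := green_small hd (mulr_gt0 e0 g0).
exists [fset (x + o)%R | x in B]%fset => x xB; rewrite phiE ltr_pdivrMr//.
apply: hB; apply: contra xB => xB.
by apply/imfsetP; exists (x - o) => //=; rewrite subrK.
Qed.

Local Notation N := (reweighted_Zd phi).

Lemma condE x k : cond N x (x + dir k) = phi x * phi (x + dir k).
Proof.
rewrite /cond /= big_fsetU1 ?big_seq_fset1//= inE -subr_eq0 opprD addNKr oppr_eq0.
exact: dir_neq0.
Qed.

Lemma vertex_condE x : vertex_cond N x = (2 * d)%:R * phi x * avg phi x.
Proof.
rewrite /vertex_cond neighbors_sum//; under eq_bigr do rewrite condE.
by rewrite -mulr_sumr sum_dir//; ring.
Qed.

Lemma reweighted_kernel x k :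
  walk_kernel N x (x + dir k) = phi (x + dir k) / ((2 * d)%:R * avg phi x).
Proof.
rewrite /walk_kernel adj_dir condE vertex_condE.
have := phi_neq0 x; have : avg phi x != 0 by rewrite gt_eqF ?avg_phi_gt0.
have : (2 * d)%:R != 0 :> R by rewrite gt_eqF.
move: (2 * d)%:R (avg phi x) (phi x) (phi (x + _)) => e a b c e0 a0 b0.
by field; rewrite a0 e0 b0.
Qed.

Lemma reweighted_kernel_ge0 x y : 0 <= walk_kernel N x y.
Proof.
have [->//|/walk_kernel_local[//|k ->]] := eqVneq (walk_kernel N x y) 0.
rewrite reweighted_kernel; apply/ltW/divr_gt0; first exact: phi_gt0.
by apply: mulr_gt0 => //; exact: avg_phi_gt0.
Qed.

Lemma laplacianE f x :
  laplacian N f x = \sum_k phi x * phi (x + dir k) * (f (x + dir k) - f x).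
Proof. by rewrite /laplacian neighbors_sum//; under eq_bigr do rewrite condE. Qed.

Lemma reweighted_is_network : is_network N.
Proof.
split=> /=.
- move=> fV; have i0 := Ordinal d0.
  have inj : {in [set: nat] &, injective (fun n : nat => dir (i0, false) *+ n : V)}.
    move=> n m _ _ /rowP/(_ i0); rewrite !mulmxnE !dirE eqxx /= expr0.
    by rewrite !natz => -[].
  have := finite_preimage inj fV; exact: infinite_nat.
- move=> e [x [y [-> h]]]; rewrite cardfs2 (_ : x != y)//.
  apply/eqP => xy; move: h; rewrite xy big1 => [//|i _].
  by rewrite subrr normr0.
- move=> x; apply: (@lattice_ind d _ x); first by exists [::].
  move=> y k [p xp ->]; exists (rcons p (last x p + dir k)); last by rewrite last_rcons.
  by rewrite rcons_path xp adj_dir.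
- move=> x; apply: (@sub_finite_set _ _ [set` [seq x + dir k | k <- index_enum D]]).
    move=> y /zd_edgesP[k ->] /=; apply/mapP; exists k => //; exact: mem_index_enum.
  exact: finite_seq.
- by move=> e _; apply: prodr_gt0 => v _; exact: phi_gt0.
Qed.

Lemma superharmonic_cst (s : V -> R) : (forall x, 0 <= s x) ->
  (forall x, \sum_k phi (x + dir k) * s (x + dir k) <= (2 * d)%:R * avg phi x * s x) ->
  forall x, s x = s o.
Proof.
move=> s0 hs.
have le x : s o <= s x.
  rewrite -(ler_pM2r (phi_gt0 x)).
  have := @phi_min_scaled (fun x => s x * phi x); rewrite phi_target mulr1; apply.
    by move=> y; rewrite mulr_ge0// ltW ?phi_gt0.
  move=> y yo; rewrite -(ler_pM2l d2) -sum_dir//.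
  have := hs y; rewrite phi_avg// -mulrA [s y * _]mulrC; apply: le_trans.
  by rewrite le_eqVlt; apply/orP; left; apply/eqP; apply: eq_bigr => k _; rewrite mulrC.
(* Where [s] attains its minimum [s o], the weighted sum of the nonnegative differences is at most
   0, so every neighbour attains the minimum too. *)
apply: (@lattice_ind d _ o) => // x k hx; apply/eqP; rewrite eq_le le andbT.
have h : \sum_k phi (x + dir k) * (s (x + dir k) - s o) <= 0.
  under eq_bigr do rewrite mulrBr.
  by rewrite sumrB -mulr_suml sum_dir// subr_le0 -hx.
have h0 l : 0 <= phi (x + dir l) * (s (x + dir l) - s o).
  by rewrite mulr_ge0 ?subr_ge0// ltW ?phi_gt0.
have : phi (x + dir k) * (s (x + dir k) - s o) <= 0.
  by apply: le_trans h; rewrite (bigD1 k)//= lerDl sumr_ge0.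
by rewrite pmulr_rle0 ?phi_gt0// subr_le0.
Qed.

Lemma reweighted_hit_cvg v x : hit (walk_kernel N) v n x @[n --> \oo] --> (1 : R).
Proof.
have k1 y : \sum_k walk_kernel N y (y + dir k) = 1.
  under eq_bigr do rewrite reweighted_kernel.
  rewrite -mulr_suml sum_dir// mulfV// mulf_neq0 ?(gt_eqF d2)//.
  by rewrite gt_eqF ?avg_phi_gt0.
have le1 n y : hit (walk_kernel N) v n y <= 1.
  apply: (@hit_le R d _ v (fun=> 1)) => //; first exact: reweighted_kernel_ge0.
  by move=> z _; rewrite -mulr_suml k1 mulr1.
have ge0 n y : 0 <= hit (walk_kernel N) v n y by apply: hit_ge0; exact: reweighted_kernel_ge0.
pose psi y := limn (fun n => hit (walk_kernel N) v n y).
have cvg y : hit (walk_kernel N) v n y @[n --> \oo] --> psi y.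
  apply: nondecreasing_is_cvgn; last by exists 1 => _ [n _ <-].
  by apply/nondecreasing_seqP => n; apply: hit_nd; exact: reweighted_kernel_ge0.
have psi0 y : 0 <= psi y by apply: (cvgr_to_ge (cvg y)); apply: nearW => n.
have psi1 y : psi y <= 1 by apply: (cvgr_to_le (cvg y)); apply: nearW => n.
have psiv : psi v = 1.
  apply: (cvg_unique _ (cvg v)) => //.
  have -> : (fun n => hit (walk_kernel N) v n v) = (fun=> 1).
    by apply/funext => n; rewrite hit_target.
  exact: cvg_cst.
have hpsi y : \sum_k walk_kernel N y (y + dir k) * psi (y + dir k) <= psi y.
  have [->|yv] := eqVneq y v.
    rewrite psiv -(k1 v); apply: ler_sum => k _.
    by rewrite -[leRHS]mulr1 ler_wpM2l// reweighted_kernel_ge0.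
  have h1 : \sum_k walk_kernel N y (y + dir k) * hit (walk_kernel N) v n (y + dir k)
      @[n --> \oo] --> \sum_k walk_kernel N y (y + dir k) * psi (y + dir k).
    by apply: cvg_sumr => k _; apply: cvgMl_tmp; exact: cvg.
  have h2 : hit (walk_kernel N) v n.+1 y @[n --> \oo] --> psi y.
    by have := cvg y; rewrite -cvg_shiftS.
  apply: (ler_cvg_to h1 h2); apply: nearW => n /=.
  by rewrite (negPf yv).
have hc y : psi y = psi o.
  apply: superharmonic_cst => // z.
  have := hpsi z; under eq_bigr do rewrite reweighted_kernel mulrAC.
  rewrite -mulr_suml ler_pdivrMr; last by rewrite mulr_gt0 ?avg_phi_gt0.
  by rewrite [psi z * _]mulrC.
by rewrite -psiv (hc v) -(hc x); exact: cvg.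
Qed.

Lemma reweighted_recurrent : recurrent N.
Proof.
move=> v disp Omega P X hX.
have mX n u : measurable [set w | X n w = u] by exact: measurable_state hX _ _.
have KL := fun x y => @walk_kernel_local N x y erefl.
have mE : measurable [set w | exists n, X n.+1 w = v].
  rewrite (_ : mkset _ = \bigcup_i [set w | X i.+1 w = v]).
    by apply: bigcup_measurable => i _; exact: mX.
  by apply/seteqP; split => w [j]; [move=> ?; exists j | move=> ? ?; exists j].
pose s := [seq v + dir k | k <- index_enum D].
have us : uniq s by rewrite map_inj_uniq ?index_enum_uniq// => k l /addrI /dir_inj.
(* The window of visits opens at time 1, so that the start at [v] does not count as a return. *)
pose A n := [set w | X 0%N w = v] `&` [set w | exists j, (1 <= j <= 1 + n)%N /\ X j w = v].
have mA n : measurable (A n).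
  by apply: measurableI => //; exact: measurable_visit hX _ _ _.
have hv n u : P (A n `&` [set w | X 1%N w = u]) =
    (walk_kernel N v u * hit (walk_kernel N) v n u)%:E.
  have := @prefix_visit R d _ KL v _ _ P X _ hX n 1%N (fun i => if i == 0%N then v else u).
  rewrite big_ord_recl big_ord0 /= eqxx mul1r mulr1 => <-; congr (P _).
  apply/seteqP; split => w /=.
    by move=> [[h0 h1] h2]; split=> // -[|[]].
  by move=> [h h1]; split; [split=> //; exact: (h 0%N) | exact: (h 1%N)].
have PA n : P (A n) = (\sum_k walk_kernel N v (v + dir k) * hit (walk_kernel N) v n (v + dir k))%:E.
  rewrite (@measure_split _ V _ _ P _ (X 1%N) s)//.
    by under eq_bigr do rewrite hv; rewrite sumEFin /s big_map.
  move=> u hu; rewrite hv; suff -> : walk_kernel N v u = 0 by rewrite mul0r.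
  apply/eqP; apply: contraNT hu => /KL[k ->].
  by apply/mapP; exists k => //; rewrite mem_index_enum.
have k1 : \sum_k walk_kernel N v (v + dir k) = 1.
  under eq_bigr do rewrite reweighted_kernel.
  rewrite -mulr_suml sum_dir// mulfV// mulf_neq0 ?(gt_eqF d2)//.
  by rewrite gt_eqF ?avg_phi_gt0.
have h1 : \sum_k walk_kernel N v (v + dir k) * hit (walk_kernel N) v n (v + dir k)
    @[n --> \oo] --> (1 : R).
  rewrite -k1; apply: cvg_sumr => k _; rewrite -[X in _ --> X]mulr1.
  by apply: cvgMl_tmp; exact: reweighted_hit_cvg.
have PE : P [set w | exists n, X n.+1 w = v] = 1%E.
  apply/eqP; rewrite eq_le probability_le1//=.
  have hle n : \sum_k walk_kernel N v (v + dir k) * hit (walk_kernel N) v n (v + dir k) <=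
      fine (P [set w | exists n, X n.+1 w = v]).
    rewrite -lee_fin -PA fineK ?fin_num_measure//.
    apply: le_measure; rewrite ?inE//.
    by move=> w [_ [[|j] [//]]]; exists j.
  rewrite -[leRHS]fineK ?fin_num_measure// lee_fin.
  by apply: (cvgr_to_le h1); apply: nearW => n; exact: hle.
exists (~` [set w | exists n, X n.+1 w = v]); split.
- exact: measurableC.
- by rewrite probability_setC// PE subee.
by move=> w /=.
Qed.

End HittingProbability.

End LatticeNetwork.

(** * The potential and its process *)

Section Potential.
Variables (R : realType) (d : nat).
Hypothesis hd : (5 <= d)%N.
Local Notation V := 'rV[int]_d.
Local Notation D := ('I_d * bool)%type.
Local Notation avg := (@avg d R).
Local Notation green := (@green R d).
Variables (o : V) (phi : V -> R).
Hypothesis hphi : forall v, is_hitting_probability (simple_Zd R d) v o (phi v).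
Local Notation N := (reweighted_Zd phi).

Let d0 : (0 < d)%N. Proof. by lia. Qed.
Let d2 : 0 < (2 * d)%:R :> R. Proof. by rewrite ltr0n muln_gt0. Qed.
Let d2n : (2 * d)%:R != 0 :> R. Proof. by rewrite gt_eqF. Qed.
Let g0 : 0 < green 0. Proof. exact: green0_gt0. Qed.
Let g0n : green 0 != 0. Proof. by rewrite gt_eqF. Qed.
Let phi0 x : 0 < phi x. Proof. exact: phi_gt0. Qed.
Let phin x : phi x != 0. Proof. by rewrite gt_eqF. Qed.

Definition potential_kernel (x : V) : R := green 0 / (2 * d)%:R * ((phi x)^-1 - 1).

Lemma potential_kernelP : potential N o potential_kernel.
Proof.
(* The increments collapse, phi x * phi y * (1 / phi y - 1 / phi x) = phi x - phi y, which leaves a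
   multiple of the lattice Laplacian of [phi]. *)
have lap x : laplacian N potential_kernel x = green 0 * (phi x - avg phi x).
  rewrite laplacianE.
  transitivity (\sum_k green 0 / (2 * d)%:R * (phi x - phi (x + dir k))).
    apply: eq_bigr => k _; rewrite /potential_kernel.
    have := phin x; have := phin (x + dir k); move: (phi x) (phi _) => a b b0 a0.
    by move: ((2 * d)%:R) d2n => e e0; field; rewrite ?e0 ?a0 ?b0.
  rewrite -mulr_sumr sumrB sum_dir// sumr_const card_prod card_ord card_bool.
  rewrite -(mulr_natr (phi x)) [(d * 2)%N]mulnC; move: ((2 * d)%:R) d2n => e en.
  by field.
split.
- move=> x; rewrite mulr_ge0 ?divr_ge0 ?(ltW g0)//.
  by rewrite subr_ge0 -[leLHS]invr1 lef_pV2 ?posrE//; exact: phi_le1.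
- by rewrite /potential_kernel (phi_target hphi) invr1 subrr mulr0.
- by rewrite lap (phi_target hphi) (avg_phi_target hd hphi) opprB addrCA subrr addr0 mulfV.
- by move=> x xo; rewrite lap (phi_avg hphi)// subrr mulr0.
Qed.

Lemma potential_unique h : potential N o h -> h = potential_kernel.
Proof.
move=> [h0 ho lapo lap].
(* [c] balances the sources at [o]: there the average of [phi * h] exceeds its value by 1 / (2 d),
   and that of [c * phi] falls short of its value by [c / green 0]. *)
pose c := green 0 / (2 * d)%:R.
have c0 : 0 < c by rewrite divr_gt0.
pose f x := phi x * h x + c * phi x.
have lapE x : laplacian N h x = (2 * d)%:R * phi x * (avg (fun y => phi y * h y) x - h x * avg phi x).
  rewrite laplacianE; transitivity (phi x * (\sum_k phi (x + dir k) * h (x + dir k) -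
      h x * \sum_k phi (x + dir k))).
    by rewrite mulr_sumr -sumrB mulr_sumr; apply: eq_bigr => k _; ring.
  by rewrite (sum_dir phi)// (sum_dir (fun y => phi y * h y))//; ring.
have fh x : avg f x = f x.
  rewrite avgD avgZ; have [->|xo] := eqVneq x o.
    move: lapo; rewrite lapE ho mul0r subr0 (phi_target hphi) mulr1 => h1.
    rewrite (avg_phi_target hd hphi) /f ho (phi_target hphi) mulr0 add0r mulr1.
    have -> : avg (fun y => phi y * h y) o = (2 * d)%:R^-1.
      by apply: (mulfI d2n); rewrite h1 mulfV.
    by rewrite /c; move: ((2 * d)%:R) d2n => e en; field; rewrite ?g0n ?en.
  move: (lap x xo); rewrite lapE => /eqP; rewrite mulf_eq0 mulf_eq0 (negPf d2n) (negPf (phin x)) /=.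
  by rewrite (phi_avg hphi)// subr_eq0 => /eqP ->; rewrite /f mulrC.
have f0 x : 0 <= f x by rewrite addr_ge0// mulr_ge0// ltW.
have fc := liouville hd f0 fh.
apply/funext => x; rewrite /potential_kernel -/c.
have fx : f x = c by rewrite fc -(fc o) /f ho (phi_target hphi) mulr0 add0r mulr1.
apply: (mulfI (phin x)); rewrite mulrCA mulrBr mulfV// mulr1.
by move: fx; rewrite /f; clearbody c => e; lra.
Qed.

Section HProcess.
Variable h : V -> R.
Hypothesis hh : h = potential_kernel.

Let h0 x : 0 <= h x. Proof. by rewrite hh; case: potential_kernelP. Qed.

Let ho : h o = 0. Proof. by rewrite hh; case: potential_kernelP. Qed.

Lemma phi_h_le x : phi x * h x <= green 0 / (2 * d)%:R.
Proof.
rewrite hh /potential_kernel mulrCA mulrBr mulfV// mulr1 ler_piMr//.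
  by rewrite divr_ge0 ?ltW.
by rewrite gerBl ltW.
Qed.

Lemma h_kernel_local x y : h_kernel N h x y != 0 -> exists k, y = x + dir k.
Proof.
rewrite /h_kernel => e; apply: (@walk_kernel_local R d N x y erefl).
by apply: contra e => /eqP ->; rewrite !mul0r.
Qed.

Lemma h_kernel_ge0 x y : 0 <= h_kernel N h x y.
Proof. by rewrite divr_ge0// mulr_ge0// (reweighted_kernel_ge0 hd hphi). Qed.

Lemma h_start_dir k : h_start N o h (o + dir k) = phi (o + dir k) * h (o + dir k).
Proof. by rewrite /h_start adj_dir condE (phi_target hphi) mul1r. Qed.

Lemma h_process_visit disp (Omega : measurableType disp) (P : probability Omega R)
    (X : nat -> Omega -> V) v : h_process N o h P X ->
  (P [set w | exists n, X n w = v] <= (green (v - o))%:E)%E.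
Proof.
move=> hX; pose g y := phi y * h y.
have gg y : 0 <= g y by rewrite mulr_ge0// ltW.
(* The transform by [g] of the lattice bound [green (y - v) / green 0]. The value at [v] is set to 1
   by hand, because the quotient is 0 there when [g v = 0], as for [v = o]. *)
pose S y := if y == v then 1 else green (y - v) / green 0 * (g v / g y).
have green0 y : 0 <= green y by exact: green_ge0.
have S0 y : 0 <= S y.
  by rewrite /S; case: ifP => // _; rewrite mulr_ge0 ?divr_ge0// ltW.
have gS y : g y * S y <= g v * (green (y - v) / green 0).
  rewrite /S; case: eqP => [->|_]; first by rewrite subrr mulfV.
  have [->|gn] := eqVneq (g y) 0; first by rewrite mul0r mulr_ge0 ?divr_ge0// ltW.
  by rewrite mulrCA [g y * _]mulrC divfK// mulrC.
have kE x k : x != o -> h x != 0 ->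
    h_kernel N h x (x + dir k) = g (x + dir k) / ((2 * d)%:R * g x).
  move=> xo hx; rewrite /h_kernel (reweighted_kernel hd hphi) (phi_avg hphi)// /g.
  have := phin x; move: ((2 * d)%:R) d2n (phi x) (h x) hx => e e0 a b b0 a0.
  by field; rewrite ?e0 ?a0 ?b0.
have hS x : x != v -> \sum_k h_kernel N h x (x + dir k) * S (x + dir k) <= S x.
  move=> xv; have [hx|hx] := eqVneq (h x) 0.
    by rewrite big1// => k _; rewrite /h_kernel hx invr0 mulr0 mul0r.
  have xo : x != o by apply: contraNneq hx => ->; rewrite ho.
  have gx : 0 < g x by rewrite mulr_gt0// lt_neqAle eq_sym hx h0.
  apply: (@le_trans _ _ (\sum_k ((2 * d)%:R * g x)^-1 * (g v * (green (x + dir k - v) / green 0)))).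
    apply: ler_sum => k _; rewrite kE// mulrAC mulrC ler_wpM2l//.
    by rewrite invr_ge0 mulr_ge0// ltW.
  have -> : \sum_k ((2 * d)%:R * g x)^-1 * (g v * (green (x + dir k - v) / green 0)) =
     g v / green 0 / g x * avg green (x - v).
    rewrite -!mulr_sumr -mulr_suml; under eq_bigr do rewrite addrAC.
    rewrite sum_dir//; move: ((2 * d)%:R) d2n (avg _ _) => e e0 a.
    by field; rewrite ?e0 ?g0n ?gt_eqF.
  rewrite avg_green// /S (negPf xv) /delta0 subr_eq0 (negPf xv) subr0.
  by rewrite le_eqVlt; apply/orP; left; apply/eqP; ring.
pose s := [seq o + dir k | k <- index_enum D].
have us : uniq s by rewrite map_inj_uniq ?index_enum_uniq// => k l /addrI /dir_inj.
have ss u : u \notin s -> h_start N o h u = 0.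
  rewrite /h_start; case: ifP => // /zd_edgesP[k ->] /mapP[].
  by exists k => //; rewrite mem_index_enum.
have c := visit_cvg h_kernel_local hX us ss (a := v).
have le n : \sum_(u <- s) h_start N o h u * hit (h_kernel N h) v n u <= green (v - o).
  have hu u : hit (h_kernel N h) v n u <= S u.
    by apply: hit_le => //; [exact: h_kernel_ge0 | rewrite /S eqxx].
  rewrite /s big_map.
  apply: (@le_trans _ _ (\sum_k (g v * (green (o + dir k - v) / green 0)))).
    apply: ler_sum => k _; rewrite h_start_dir; apply: le_trans (gS _).
    by apply: ler_wpM2l; [exact: gg | exact: hu].
  rewrite -mulr_sumr -mulr_suml; under eq_bigr do rewrite addrAC.
  rewrite sum_dir// avg_green//.
  rewrite -[v - o]opprB greenN_arg//.
  (* [g v] is at most [green 0 / (2 d)] by [phi_h_le], which cancels the factor [2 d] coming from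
     the sum over the starting neighbours. *)
  have gv : g v / green 0 * (2 * d)%:R <= 1.
    by rewrite mulrAC ler_pdivrMr// mul1r -ler_pdivlMr// phi_h_le.
  have -> : g v * ((2 * d)%:R * (green (o - v) - delta0 R (o - v)) / green 0) =
     (g v / green 0 * (2 * d)%:R) * (green (o - v) - delta0 R (o - v)) by ring.
  apply: (@le_trans _ _ (g v / green 0 * (2 * d)%:R * green (o - v))).
    rewrite ler_wpM2l ?gerBl ?ler0n//.
    by rewrite mulr_ge0// divr_ge0// ltW.
  by rewrite -[leRHS]mul1r ler_wpM2r.
apply: (cvge_to_le c); apply: nearW => n; rewrite lee_fin; exact: le.
Qed.

Lemma ever_generated (Omega : Type) (X : nat -> Omega -> V) v :
  generated_events X [set w | exists n, X n w = v].
Proof.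
rewrite (_ : mkset _ = \bigcup_i [set w | X i w = v]); last first.
  by apply/seteqP; split => w [j]; [move=> ?; exists j | move=> ? ?; exists j].
apply: sigma_algebra_bigcup => i.
by apply: sub_sigma_algebra; exists i, v.
Qed.

Lemma h_processes_finite_intersection : h_processes_intersect_finitely N o h.
Proof.
move=> disp Omega P X Y hX hY indep.
pose A v := [set w | exists n, X n w = v] `&` [set w | exists n, Y n w = v].
have mA v : measurable (A v).
  by apply: measurableI; [exact: measurable_ever hX | exact: measurable_ever hY].
have PA v : (P (A v) <= (green (v - o) ^+ 2)%:E)%E.
  rewrite indep; try exact: ever_generated.
  rewrite expr2 EFinM; apply: lee_pmul; rewrite ?measure_ge0//; exact: h_process_visit.
have /choice[B hB] (n : nat) : exists B : {fset V}, forall s, uniq s ->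
    (forall x, x \in s -> x \notin B) -> \sum_(x <- s) green x ^+ 2 <= n.+1%:R^-1.
  by apply: green_tail => //; rewrite invr_gt0.
(* A common point outside the finite set given by [B n] has probability at most 1 / (n + 1). Off the
   null set where this happens for every [n], the intersection is finite. *)
pose U n := \bigcup_(v in [set v | v - o \notin B n]) A v.
have hU n : measurable (U n) /\ (P (U n) <= (n.+1%:R^-1)%:E)%E.
  apply: (@countable_bigcup_le R V) => // s us sB.
  apply: (@le_trans _ _ (\sum_(v <- s) (green (v - o) ^+ 2)%:E)%E).
    by apply: lee_sum => v _; exact: PA.
  rewrite sumEFin lee_fin -(big_map (fun v => v - o) xpredT (fun v => green v ^+ 2)).
  apply: hB; first by rewrite map_inj_uniq// => a b /addIr.
  by move=> _ /mapP[v vs ->]; exact: sB.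
have mU : measurable (\bigcap_n U n).
  by apply: bigcap_measurable => [|n _]; [exists 0%N | case: (hU n)].
exists (\bigcap_n U n); split => //.
  apply/eqP; rewrite eq_le measure_ge0 andbT; apply/lee_addgt0Pr => e e0.
  rewrite add0e; have [n hn] : exists n : nat, n.+1%:R^-1 < e.
    have [n _ /(_ n (leqnn n)) hn] := near_infty_natSinv_lt (PosNum e0).
    by exists n.
  apply: (@le_trans _ _ (P (U n))).
    by apply: le_measure; rewrite ?inE//; [case: (hU n) | exact: bigcap_inf].
  by apply: (le_trans (hU n).2); rewrite lee_fin ltW.
move=> w /= hw; apply: contrapT => nU; apply: hw.
have [n nUn] : exists n, ~ U n w.
  by apply: contrapT => hn; apply: nU => n _; apply: contrapT => hn'; apply: hn; exists n.
apply: (@sub_finite_set _ _ [set` [fset (x + o)%R | x in B n]%fset]); last exact: finite_fset.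
move=> v [[i _ Xi] [j _ Yj]] /=; have [vB|vB] := boolP (v - o \in B n).
  by apply/imfsetP; exists (v - o) => //=; rewrite subrK.
by case: nUn; exists v => //; split; [exists i | exists j].
Qed.

End HProcess.
End Potential.

(** * Subharmonicity in weighted rooted trees *)

Section ParentFunctions.
Variables (R : realType) (W : finType) (o : W).
Implicit Types (p : {ffun W -> W}) (x y z u v : W).

(** A tree rooted at [o] is encoded by its parent map, with [o] its own parent; [fconnect p x u]
    then says that [u] lies on the branch from [x] to [o]. *)
Definition rooted p := (p o == o) && [forall z, fconnect p z o].

Definition redirect p z y : {ffun W -> W} := [ffun v => if v == z then y else p v].

Lemma fconnectP p x y : reflect (exists n, iter n p x = y) (fconnect p x y).
Proof.
apply: (iffP idP) => [h|[n <-]]; last exact: fconnect_iter.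
by exists (findex p x y); exact: iter_findex.
Qed.

Lemma fconnect_step p x y : fconnect p x y = (x == y) || fconnect p (p x) y.
Proof.
apply/fconnectP/idP.
  move=> [[|n]]; first by move=> /= ->; rewrite eqxx.
  by rewrite iterSr => <-; rewrite fconnect_iter orbT.
move=> /orP[/eqP ->|/fconnectP[n <-]]; first by exists 0%N.
by exists n.+1; rewrite iterSr.
Qed.

Lemma fconnect_linear p x y z : fconnect p x y -> fconnect p x z ->
  fconnect p y z || fconnect p z y.
Proof.
move=> /fconnectP[n <-] /fconnectP[m <-].
have [nm|mn] := leqP n m.
  by rewrite -(subnK nm) iterD fconnect_iter.
by rewrite -(subnK (ltnW mn)) iterD fconnect_iter orbT.
Qed.

Lemma iter_root p n : rooted p -> iter n p o = o.
Proof. by move=> /andP[/eqP po _]; elim: n => //= n ->. Qed.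

Lemma rooted_acyclic p z : rooted p -> z != o -> fconnect p (p z) z = false.
Proof.
move=> rp zo; apply/negP => /fconnectP[n hn].
have /andP[_ /forallP/(_ z)/fconnectP[k hk]] := rp.
have per m : iter (m * n.+1) p z = z.
  by elim: m => [//|m IH]; rewrite mulSn iterD IH iterSr.
have kn : (k <= k * n.+1)%N by rewrite mulnS leq_addr.
have := per k; rewrite -(subnK kn).
by rewrite iterD hk iter_root// => oz; rewrite oz eqxx in zo.
Qed.

Lemma rooted_antisym p x y : rooted p -> fconnect p x y -> fconnect p y x -> x = y.
Proof.
move=> rp xy yx; apply/eqP; apply: contraT => nxy.
have [xo|xo] := eqVneq x o.
  move: xy; rewrite xo => /fconnectP[n]; rewrite iter_root// => oy.
  by rewrite xo oy eqxx in nxy.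
move: xy; rewrite fconnect_step (negPf nxy) /= => h.
by rewrite -(rooted_acyclic rp xo); exact: connect_trans h yx.
Qed.

Lemma redirect_id p z y : redirect p z y z = y.
Proof. by rewrite ffunE eqxx. Qed.

Lemma iter_redirect p z y x n : (forall i, (i < n)%N -> iter i p x != z) ->
  iter n (redirect p z y) x = iter n p x.
Proof.
elim: n => //= n IH h; rewrite IH; last by move=> i im; apply: h; exact: ltnW.
by rewrite ffunE (negPf (h n (ltnSn n))).
Qed.

Lemma fconnect_redirect p z y x w : ~~ fconnect p x z ->
  fconnect (redirect p z y) x w = fconnect p x w.
Proof.
move=> xz.
have h n : iter n (redirect p z y) x = iter n p x.
  apply: iter_redirect => i _; apply: contra xz => /eqP <-; exact: fconnect_iter.
by apply/fconnectP/fconnectP => -[n hn]; exists n; rewrite -hn h.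
Qed.

Lemma fconnect_redirect_self p z y x :
  fconnect (redirect p z y) x z = fconnect p x z.
Proof.
have [xz|xz] := boolP (fconnect p x z); last by rewrite fconnect_redirect// (negPf xz).
have /fconnectP ex := xz.
have ex' : exists n, iter n p x == z by have [n hn] := ex; exists n; rewrite hn.
case: (ex_minnP ex') => n /eqP hn hmin; apply/fconnectP; exists n.
rewrite iter_redirect// => i im; apply/negP => /hmin; lia.
Qed.

Lemma redirect_rooted p z y : rooted p -> z != o -> ~~ fconnect p y z ->
  rooted (redirect p z y).
Proof.
move=> rp zo yz; have /andP[/eqP po /forallP hr] := rp.
apply/andP; split; first by rewrite ffunE (eq_sym o) (negPf zo) po.
apply/forallP => v; have [vz|vz] := boolP (fconnect p v z); last first.
  by rewrite fconnect_redirect.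
have h1 : fconnect (redirect p z y) v z by rewrite fconnect_redirect_self.
apply: connect_trans h1 _; rewrite fconnect_step redirect_id.
by rewrite fconnect_redirect// hr orbT.
Qed.

Lemma redirectK p z y : redirect (redirect p z y) z (p z) = p.
Proof. by apply/ffunP => v; rewrite !ffunE; case: eqP => [->|]. Qed.

Variable c : W -> W -> R.
Hypothesis c0 : forall x y, 0 <= c x y.

Definition parent_weight p := \prod_(v | v != o) c v (p v).

Lemma parent_weight_ge0 p : 0 <= parent_weight p.
Proof. by apply: prodr_ge0. Qed.

(** Multiplied out because [c z (p z)] may be 0. *)
Lemma parent_weight_redirect p z y : z != o ->
  parent_weight (redirect p z y) * c z (p z) = parent_weight p * c z y.
Proof.
move=> zo; rewrite /parent_weight (bigD1 z)//= [in RHS](bigD1 z)//= redirect_id.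
rewrite (eq_bigr (fun v => c v (p v))); first by rewrite mulrAC [RHS]mulrAC [c z y * _]mulrC.
by move=> v /andP[_ vz]; rewrite ffunE (negPf vz).
Qed.

Definition forest_sum (Q : {ffun W -> W} -> bool) : R :=
  \sum_(p | rooted p) parent_weight p * (Q p)%:R.

Lemma forest_sum_ge0 Q : 0 <= forest_sum Q.
Proof. by apply: sumr_ge0 => p _; rewrite mulr_ge0 ?parent_weight_ge0. Qed.

Lemma forest_sum_le (Q Q' : {ffun W -> W} -> bool) : (forall p, rooted p -> Q p -> Q' p) ->
  forest_sum Q <= forest_sum Q'.
Proof.
move=> h; apply: ler_sum => p rp; rewrite ler_wpM2l ?parent_weight_ge0// ler_nat.
by have := h p rp; case: (Q p); case: (Q' p) => // /(_ isT).
Qed.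

(* Pairs [(p, y)] with [z] not above [y] are permuted by exchanging [y] with the parent of
   [z], which preserves the weight [parent_weight p * c z y]. *)
Lemma forest_sum_subharmonic (Q : {ffun W -> W} -> W -> bool) z : z != o ->
  (forall p y, rooted p -> fconnect p y z -> Q p z -> Q p y) ->
  (forall p y, rooted p -> ~~ fconnect p y z ->
     (Q p z + Q (redirect p z y) z <= Q p y + Q (redirect p z y) (p z))%N) ->
  0 <= \sum_y c z y * (forest_sum (Q ^~ y) - forest_sum (Q ^~ z)).
Proof.
move=> zo Q1 Q2.
pose t (q : {ffun W -> W} * W) : R :=
  parent_weight q.1 * c z q.2 * ((Q q.1 q.2)%:R - (Q q.1 z)%:R).
have -> : \sum_y c z y * (forest_sum (Q ^~ y) - forest_sum (Q ^~ z)) =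
    \sum_(q : {ffun W -> W} * W | rooted q.1) t q.
  transitivity (\sum_(p | rooted p) \sum_y t (p, y)); last first.
    by rewrite pair_big /=; apply: eq_big => -[p y] //=; rewrite andbT.
  rewrite exchange_big /=; apply: eq_bigr => y _.
  rewrite -sumrB mulr_sumr; apply: eq_bigr => p _.
  by rewrite /t /=; ring.
rewrite (bigID (fun q : {ffun W -> W} * W => fconnect q.1 q.2 z)) /=; apply: addr_ge0.
  apply: sumr_ge0 => -[p y] /= /andP[rp yz]; rewrite mulr_ge0//.
    by rewrite mulr_ge0 ?parent_weight_ge0.
  rewrite subr_ge0 ler_nat; have := Q1 p y rp yz.
  by case: (Q p z) => // /(_ isT) ->.
pose s (q : {ffun W -> W} * W) := (redirect q.1 z q.2, q.1 z).
pose A (q : {ffun W -> W} * W) := rooted q.1 && ~~ fconnect q.1 q.2 z.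
have sA q : A q -> A (s q).
  case: q => p y /andP[/= rp yz]; rewrite /A /= redirect_rooted//=.
  by rewrite fconnect_redirect_self rooted_acyclic.
have sK q : s (s q) = q by case: q => p y; rewrite /s /= redirectK redirect_id.
have e : \sum_(q | A q) t q = \sum_(q | A q) t (s q).
  rewrite (reindex_inj (can_inj sK)) /=; apply: eq_bigl => q.
  by apply/idP/idP => [/sA|/sA //]; rewrite sK.
(* The sum is doubled and the second copy re-indexed by the exchange [s]; [Q2] makes each combined
   term nonnegative. *)
suff : 0 <= \sum_(q | A q) t q + \sum_(q | A q) t q by lra.
rewrite {2}e -big_split /=; apply: sumr_ge0 => -[p y] /andP[/= rp yz].
rewrite /t /s /= parent_weight_redirect// -mulrDr mulr_ge0//.
  by rewrite mulr_ge0 ?parent_weight_ge0.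
have := Q2 p y rp yz; rewrite -(ler_nat R) !natrD; lra.
Qed.

Definition meets (U : pred W) p x := [exists u, U u && fconnect p x u].

(** As [z] is not in [U], its branch meets [U] exactly when that of its parent does, and branches
    avoiding [z] ignore the exchange. So the exchange condition holds with equality. *)
Lemma meets_subharmonic (U : pred W) z : z != o -> ~~ U z ->
  0 <= \sum_y c z y * (forest_sum (fun p => meets U p y) - forest_sum (fun p => meets U p z)).
Proof.
move=> zo Uz; apply: (@forest_sum_subharmonic (meets U)) => // p y rp yz.
  move=> /existsP[u /andP[Uu zu]]; apply/existsP; exists u; rewrite Uu.
  exact: connect_trans yz zu.
have up (q : {ffun W -> W}) : meets U q z = meets U q (q z).
  apply: eq_existsb => u; rewrite fconnect_step.
  by case: eqP => [<-|//]; rewrite (negPf Uz).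
have av (q : {ffun W -> W}) v x : ~~ fconnect q x z -> meets U (redirect q z v) x = meets U q x.
  by move=> xz; apply: eq_existsb => u; rewrite fconnect_redirect.
rewrite !up redirect_id !av ?rooted_acyclic//; lia.
Qed.

(* When [p] is rooted at [o], [u] is the point where the tree path from [y] to [o] first
   meets the one from [x]. *)
Definition lca u p x y := [&& fconnect p x u, fconnect p y u &
  [forall v, fconnect p x v && fconnect p y v ==> fconnect p u v]].

Lemma lcaC u p x y : lca u p x y = lca u p y x.
Proof.
rewrite /lca andbCA; congr [&& _, _ & _].
by apply: eq_forallb => v; rewrite [fconnect p x v && _]andbC.
Qed.

Lemma lca_self u p x : lca u p x u = fconnect p x u.
Proof.
rewrite /lca connect0 /=; apply: andb_idr => _; apply/forallP => v.
by apply/implyP => /andP[].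
Qed.

Lemma lca_exists p x y : rooted p -> exists u, lca u p x y.
Proof.
move=> /andP[po /forallP hr].
have /fconnectP[n hn] := hr x.
have ex : exists n, fconnect p y (iter n p x) by exists n; rewrite hn.
case: (ex_minnP ex) => m hm hmin; exists (iter m p x).
rewrite /lca fconnect_iter hm /=; apply/forallP => v; apply/implyP => /andP[/fconnectP[k <-] hk].
by rewrite -(subnK (hmin k hk)) iterD fconnect_iter.
Qed.

(** If the branch of [x] passes through [z], the branches of [x] and [z] merge at [z] and not at
    [u], so the left side of the exchange condition is 0. Otherwise [z] can be replaced by its
    parent, and there is equality. *)
Lemma lca_subharmonic u x z : z != o -> z != u ->
  0 <= \sum_y c z y * (forest_sum (fun p => lca u p x y) - forest_sum (fun p => lca u p x z)).
Proof.
move=> zo zu; apply: (@forest_sum_subharmonic (fun p => lca u p x)) => // p y rp yz.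
  move=> /and3P[xu zu' /forallP hu]; rewrite /lca xu (connect_trans yz zu') /=.
  apply/forallP => v; apply/implyP => /andP[xv yv].
  have /orP[zv|vz] := fconnect_linear yz yv.
    by have := hu v; rewrite xv zv.
  have uz : fconnect p u z by have := hu z; rewrite connect0 (connect_trans xv vz).
  by rewrite (rooted_antisym rp zu' uz) eqxx in zu.
have none (q : {ffun W -> W}) : rooted q -> fconnect q x z -> lca u q x z = false.
  move=> rq xz; apply/negP => /and3P[_ zu' /forallP/(_ z)].
  rewrite connect0 xz /= => uz.
  by rewrite (rooted_antisym rq zu' uz) eqxx in zu.
have [xz|xz] := boolP (fconnect p x z).
  rewrite !none// ?redirect_rooted// ?fconnect_redirect_self//.
have up (q : {ffun W -> W}) : ~~ fconnect q x z -> lca u q x z = lca u q x (q z).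
  move=> xz'; rewrite /lca [fconnect q z u]fconnect_step (negPf zu) /=.
  congr [&& _, _ & _]; apply: eq_forallb => v; rewrite [fconnect q z v]fconnect_step.
  by case: eqP => [<-|//]; rewrite (negPf xz').
have av (q : {ffun W -> W}) v w : ~~ fconnect q w z -> ~~ fconnect q x z ->
    lca u (redirect q z v) x w = lca u q x w.
  move=> wz xz'; rewrite /lca !fconnect_redirect//.
  case: (boolP (fconnect q x u)) => //= xu; congr (_ && _); apply: eq_forallb => v'.
  rewrite !fconnect_redirect//; apply: contra xz' => h; exact: connect_trans xu h.
rewrite (up p)// (up (redirect p z y)) ?fconnect_redirect_self// redirect_id.
rewrite !av ?rooted_acyclic//; lia.
Qed.

End ParentFunctions.

(** * Spanning trees as parent functions *)

Section Joined.
Variable V : choiceType.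
Implicit Types (E : set {fset V}) (x y z : V).

Lemma fset2_eq (a b c e : V) : [fset a; b]%fset = [fset c; e]%fset ->
  (a = c /\ b = e) \/ (a = e /\ b = c).
Proof.
move=> h.
have ha : a \in [fset c; e]%fset by rewrite -h !inE eqxx.
have hb : b \in [fset c; e]%fset by rewrite -h !inE eqxx orbT.
have hc : c \in [fset a; b]%fset by rewrite h !inE eqxx.
have he : e \in [fset a; b]%fset by rewrite h !inE eqxx orbT.
move: ha hb hc he; rewrite !inE.
by move=> /orP[]/eqP ha /orP[]/eqP hb /orP[]/eqP hc /orP[]/eqP he; subst; auto.
Qed.

Lemma adj_sym E x y : adj E x y = adj E y x.
Proof. by rewrite /adj eq_sym fsetUC. Qed.

Lemma adj_sub E E' x y : E `<=` E' -> adj E x y -> adj E' x y.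
Proof. by move=> EE' /andP[xy]; rewrite /adj xy !inE => /EE'. Qed.

Lemma joined_refl E x : joined E x x.
Proof. by exists [::]. Qed.

Lemma joined_trans E x y z : joined E x y -> joined E y z -> joined E x z.
Proof.
move=> [p xp ->] [q yq ->]; exists (p ++ q); last by rewrite last_cat.
by rewrite cat_path xp.
Qed.

Lemma joined_step E x y : adj E x y -> joined E x y.
Proof. by move=> xy; exists [:: y] => //=; rewrite xy. Qed.

Lemma joined_sym E x y : joined E x y -> joined E y x.
Proof.
move=> [p xp ->]; elim: p x xp => [|u p IH] x /=; first by move=> _; exact: joined_refl.
move=> /andP[xu up]; apply: joined_trans (IH _ up) _.
by apply: joined_step; rewrite adj_sym.
Qed.

Lemma next_prev_size (T : eqType) (s : seq T) v : uniq s -> v \in s ->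
  next s v = prev s v -> (size s <= 2)%N.
Proof.
move=> us vs; have [i s' es] := rot_to vs.
rewrite -(next_rot i us) -(prev_rot i us) -(size_rot i) es.
have /andP[vs' us'] : uniq (v :: s') by rewrite -es rot_uniq.
rewrite next_nth prev_nth mem_head /= eqxx memNindex//.
case: s' {es} vs' us' => [|a [|b t]] //= _ /andP[abt _].
by move=> h; rewrite h mem_nth in abt.
Qed.

End Joined.

Section SpanningTrees.
Variables (R : realType) (V : choiceType) (W : {fset V}) (E : {fset {fset V}}).
Variables (wgt : {fset V} -> R) (o : W).
Implicit Types (p : {ffun W -> W}).
Hypothesis E_ends : forall e, e \in E -> exists x y : W, x != y /\ e = [fset val x; val y]%fset.

Definition edge_of (x y : W) : {fset V} := [fset val x; val y]%fset.

(** Zero off [E], so that sums over all rooted parent maps of [W] see only trees of the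
    subnetwork. *)
Definition edge_weight (x y : W) : R :=
  if (x != y) && (edge_of x y \in E) then wgt (edge_of x y) else 0.

Definition tree_of (p : {ffun W -> W}) : {fset {fset V}} :=
  [fset edge_of v (p v) | v in [pred v : W | v != o]]%fset.

Definition inner p := rooted o p &&
  [forall v : W, (v != o) ==> (v != p v) && (edge_of v (p v) \in E)].

Lemma innerP p : inner p -> forall v, v != o -> (v != p v) && (edge_of v (p v) \in E).
Proof. by move=> /andP[_ /forallP h] v vo; have := h v; rewrite vo. Qed.

Lemma inner_rooted p : inner p -> rooted o p.
Proof. by case/andP. Qed.

Lemma edge_of_eq (a b c e : W) : edge_of a b = edge_of c e ->
  (a = c /\ b = e) \/ (a = e /\ b = c).
Proof.
by move=> /fset2_eq[[h1 h2]|[h1 h2]]; [left|right]; split; exact: val_inj.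
Qed.

Lemma tree_ofP p e : reflect (exists2 v : W, v != o & e = edge_of v (p v)) (e \in tree_of p).
Proof.
apply: (iffP (imfsetP _ _ _ _)) => [[v /= vo ->]|[v vo ->]]; first by exists v.
by exists v.
Qed.

Lemma adj_tree_of p (x y : W) : adj [set` tree_of p] (val x) (val y) ->
  (x != o /\ y = p x) \/ (y != o /\ x = p y).
Proof.
move=> /andP[_]; rewrite inE => /tree_ofP[v vo /edge_of_eq[[-> ->]|[-> ->]]]; first by left.
by right.
Qed.

Definition depth p (x : W) := #|fconnect p x|.

Lemma depth_parent p x : rooted o p -> x != o -> (depth p (p x) < depth p x)%N.
Proof.
move=> rp xo; apply: proper_card; apply/properP; split.
  apply/fintype.subsetP => y; rewrite !inE => h.
  by rewrite -[connect _ _ _]/(fconnect p x y) fconnect_step h orbT.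
exists x; first by rewrite inE connect0.
by rewrite inE -[connect _ _ _]/(fconnect p (p x) x) (rooted_acyclic rp xo).
Qed.

Lemma tree_of_joined p (x : W) : rooted o p -> (forall v, v != o -> v != p v) ->
  joined [set` tree_of p] (val x) (val o).
Proof.
move=> rp np; have /andP[_ /forallP/(_ x)/fconnectP[n]] := rp.
elim: n x => [|n IH] x; first by move=> /= ->; exact: joined_refl.
rewrite iterSr => /IH; have [->|xo] := eqVneq x o; first by move=> _; exact: joined_refl.
apply: joined_trans; apply: joined_step; apply/andP; split; first by rewrite val_eqE np.
by rewrite inE; apply/tree_ofP; exists x.
Qed.

(** On a cycle, take the vertex with the most ancestors: both its neighbours there must be its
    parent, which [next_prev_size] excludes for length above 2. *)
Lemma tree_of_acyclic p : rooted o p -> acyclic [set` tree_of p].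
Proof.
move=> rp [s [s2 /andP[cs us]]].
have inW v : v \in s -> exists x : W, v = val x.
  move=> /(next_cycle cs) /andP[_]; rewrite inE => /tree_ofP[x _ e].
  have : v \in edge_of x (p x) by rewrite -e !inE eqxx.
  by rewrite !inE => /orP[]/eqP ->; [exists x | exists (p x)].
have [x0 x0s] : exists x : W, val x \in s.
  case: s s2 inW {cs us} => // v s _ /(_ v (mem_head _ _))[x ->].
  by exists x; rewrite mem_head.
pose x := [arg max_(x > x0 | val x \in s) depth p x].
have [xs xmax] : val x \in s /\ forall y : W, val y \in s -> (depth p y <= depth p x)%N.
  by rewrite /x; case: arg_maxnP.
have up (y : W) : val y \in s -> adj [set` tree_of p] (val x) (val y) -> y = p x.
  move=> ys /adj_tree_of[[_ //]|[yo xy]].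
  by have := xmax y ys; have := depth_parent rp yo; rewrite -xy; lia.
have ns : next s (val x) \in s by rewrite mem_next.
have ps : prev s (val x) \in s by rewrite mem_prev.
have [yn en] := inW _ ns; have [yp ep] := inW _ ps.
have an := next_cycle cs xs; have ap := prev_cycle cs xs.
have h1 : yn = p x by apply: up; rewrite -en.
have h2 : yp = p x by apply: up; rewrite -ep// adj_sym.
have := next_prev_size us xs; rewrite en ep h1 h2 => /(_ erefl).
by rewrite leqNgt s2.
Qed.

Lemma tree_of_sub p : inner p -> (tree_of p `<=` E)%fset.
Proof.
by move=> ip; apply/fsubsetP => e /tree_ofP[v vo ->]; have /andP[] := innerP ip vo.
Qed.

Lemma tree_of_spanning p : inner p -> spanning_tree W (tree_of p).
Proof.
move=> ip; have rp := inner_rooted ip.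
have np v : v != o -> v != p v by move=> vo; have /andP[] := innerP ip vo.
split; last exact: tree_of_acyclic.
move=> x y xW yW.
apply: (joined_trans (tree_of_joined [` xW]%fset rp np)).
by apply: joined_sym; exact: (tree_of_joined [` yW]%fset rp np).
Qed.

(** Induction from the root: the edge from [v] to [p v] lies in the second tree either as the edge
    above [v], as wanted, or as the edge above [p v]; the latter would make [v] the parent of [p v]
    in both maps. *)
Lemma tree_of_inj p p' : inner p -> inner p' -> tree_of p = tree_of p' -> p = p'.
Proof.
move=> ip ip' e; have rp := inner_rooted ip; have rp' := inner_rooted ip'.
suff h n (v : W) : (depth p v <= n)%N -> p' v = p v.
  by apply/ffunP => v; rewrite (h (depth p v)).
elim: n v => [|n IH] v.
  have : (0 < depth p v)%N by apply/card_gt0P; exists v; rewrite inE connect0.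
  by lia.
move=> dv; have [->|vo] := eqVneq v o.
  by have /andP[/eqP -> _] := rp; have /andP[/eqP -> _] := rp'.
have : edge_of v (p v) \in tree_of p' by rewrite -e; apply/tree_ofP; exists v.
move=> /tree_ofP[w wo /edge_of_eq[[-> ->//]|[vw pvw]]].
have dp := depth_parent rp vo.
have := IH (p v); rewrite pvw -vw => /(_ _) pw.
have pp : p w = v by rewrite -pw// -pvw; lia.
have := rooted_acyclic rp vo.
by rewrite pvw fconnect_step pp connect0 orbT.
Qed.

(** Each vertex other than [o] is sent to a neighbour closer to [o] in [T]. The resulting tree lies
    in [T] and connects all of [W], so a further edge of [T] would close a cycle. *)
Lemma spanning_tree_parent (T : {fset {fset V}}) : (T `<=` E)%fset -> spanning_tree W T ->
  exists2 p, inner p & tree_of p = T.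
Proof.
move=> /fsubsetP TE [conn acyc].
have T_ends (x : V) (y : W) : adj [set` T] (val y) x -> x \in W.
  move=> /andP[_]; rewrite inE => /TE/E_ends[a [b [_ e]]].
  have : x \in [fset val a; val b]%fset by rewrite -e !inE eqxx orbT.
  by rewrite !inE => /orP[]/eqP ->; exact: fsvalP.
pose len (v : W) n := exists q, [/\ path (adj [set` T]) (val v) q,
    val o = last (val v) q & size q = n].
have exlen v : exists n, `[< len v n >].
  by have [q hp ep] := conn _ _ (fsvalP v) (fsvalP o); exists (size q); apply/asboolP; exists q.
pose dist v := ex_minn (exlen v).
have /choice[f hf] (v : W) : exists u : W, if v == o then u = o else
    adj [set` T] (val v) (val u) /\ (dist u < dist v)%N.
  case: eqP => [_|/eqP vo]; first by exists o.
  rewrite {2}/dist; case: ex_minnP => n /asboolP[[|u q] [hp ep <-]] _ /=.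
    by move: vo; rewrite -val_eqE ep eqxx.
  move: hp => /= /andP[vu uq]; have uW := T_ends _ _ vu.
  exists [` uW]%fset; split => //; rewrite /dist; case: ex_minnP => m _; apply.
  by apply/asboolP; exists q.
pose p : {ffun W -> W} := [ffun v => f v].
have fo v : v != o -> adj [set` T] (val v) (val (f v)) /\ (dist (f v) < dist v)%N.
  by move=> vo; have := hf v; rewrite (negPf vo).
have rp : rooted o p.
  apply/andP; split; first by rewrite ffunE; have := hf o; rewrite eqxx => ->.
  apply/forallP => v.
  suff h n (u : W) : (dist u <= n)%N -> fconnect p u o by exact: (h (dist v)).
  elim: n u => [|n IH] u du; rewrite fconnect_step; have [//|uo /=] := eqVneq u o.
    by have [_] := fo u uo; lia.
  by rewrite ffunE; apply: IH; have [_] := fo u uo; lia.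
have ip : inner p.
  apply/andP; split => //; apply/forallP => v; apply/implyP => vo.
  rewrite ffunE; have [/andP[]] := fo v vo; rewrite val_eqE => -> /=.
  by rewrite inE => h _; exact: TE.
exists p => //; apply/fsetP => e; apply/idP/idP.
  move=> /tree_ofP[v vo ->]; rewrite ffunE; have [/andP[_]] := fo v vo.
  by rewrite inE.
move=> eT; apply: contraT => ne; exfalso; apply: acyc.
have [x [y [xy ee]]] := E_ends (TE _ eT).
have [conn' _] := tree_of_spanning ip.
have sub : [set` tree_of p] `<=` [set` T].
  move=> e' /= /tree_ofP[v vo ->]; rewrite ffunE; have [/andP[_]] := fo v vo.
  by rewrite inE.
have [q hq eq] := conn' _ _ (fsvalP x) (fsvalP y).
case/shortenP: hq eq => q' hq' uq _ eq.
exists (val x :: q'); split.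
  case: q' hq' uq eq => [|a [|b t]] //=.
    by move=> _ _ /val_inj yx; rewrite yx eqxx in xy.
  rewrite andbT => /andP[_]; rewrite inE => h _ ya.
  by move: ne; rewrite ee (ya : val y = a) h.
apply/andP; split => //=.
rewrite rcons_path (sub_path (fun a b => adj_sub sub) hq') /= -eq.
by rewrite adj_sym /adj -[fsval x == _]/(val x == val y) val_eqE xy inE -ee.
Qed.

Lemma parent_weight_not_inner p : rooted o p -> ~~ inner p -> parent_weight o edge_weight p = 0.
Proof.
move=> rp; rewrite /inner rp /= => /forallPn[v]; rewrite negb_imply => /andP[vo h].
by rewrite /parent_weight (bigD1 v)//= /edge_weight (negPf h) mul0r.
Qed.

Lemma parent_weight_tree p : inner p ->
  parent_weight o edge_weight p = \prod_(e <- tree_of p) wgt e.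
Proof.
move=> ip; have rp := inner_rooted ip.
rewrite big_imfset /=.
  rewrite big_enum /=; apply: eq_bigr => v vo.
  by rewrite /edge_weight; have /andP[-> ->] := innerP ip vo.
move=> v w; rewrite -!topredE /= => vo wo /edge_of_eq[[] //|[vw pvw]].
by have := rooted_acyclic rp vo; rewrite pvw fconnect_step -vw connect0 orbT.
Qed.

Lemma sum_spanning_trees (A : pred {fset {fset V}}) (G : subgraph V) (N : weighted_graph R V) :
  sub_vertices G = W -> sub_edges G = E -> edge_cond N = wgt ->
  \sum_(T <- spanning_trees G | A T) tree_weight N T =
  forest_sum o edge_weight (fun p => A (tree_of p)).
Proof.
move=> GW GE Nw.
have -> : \sum_(T <- spanning_trees G | A T) tree_weight N T =
   \sum_(T <- [seq tree_of p | p <- enum inner] | A T) tree_weight N T.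
  apply: perm_big; apply: uniq_perm.
  - exact: fset_uniq.
  - rewrite map_inj_in_uniq ?enum_uniq// => p p'; rewrite !mem_enum; exact: tree_of_inj.
  move=> T; apply/idP/mapP.
    rewrite !inE /= fpowersetE GE GW => /andP[TE /asboolP hT].
    by have [p ip <-] := spanning_tree_parent TE hT; exists p => //; rewrite mem_enum.
  move=> [p]; rewrite mem_enum => ip ->.
  rewrite !inE /= fpowersetE GE GW tree_of_sub//=; apply/asboolP; exact: tree_of_spanning.
rewrite big_map big_enum_cond /= /forest_sum.
rewrite [RHS](bigID inner) /= [X in _ = _ + X]big1 ?addr0; last first.
  by move=> p /andP[rp ip]; rewrite parent_weight_not_inner// mul0r.
rewrite big_mkcondr /= [RHS](eq_bigl inner); last first.
  by move=> p; rewrite /inner andbA andbb.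
apply: eq_bigr => p ip; rewrite parent_weight_tree// /tree_weight Nw.
by case: (A _); rewrite ?mulr1 ?mulr0.
Qed.

End SpanningTrees.

(** * Finite networks *)

Section FiniteVolume.
Variables (R : realType) (d : nat).
Hypothesis hd : (5 <= d)%N.
Local Notation V := 'rV[int]_d.
Local Notation D := ('I_d * bool)%type.
Local Notation avg := (@avg d R).
Local Notation green := (@green R d).
Variables (o : V) (phi : V -> R).
Hypothesis hphi : forall v, is_hitting_probability (simple_Zd R d) v o (phi v).
Local Notation N := (reweighted_Zd phi).

Let d0 : (0 < d)%N. Proof. by lia. Qed.
Let g0 : 0 < green 0. Proof. exact: green0_gt0. Qed.
Let phi0 x : 0 < phi x. Proof. exact: phi_gt0. Qed.
Let phin x : phi x != 0. Proof. by rewrite gt_eqF. Qed.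

(* The probability that the walk on the network started at [x] hits [u] before [o]
   is at most [green_ratio u x]. *)
Definition green_ratio (u x : V) : R := green (x - u) * phi u / (green 0 * phi x).

Lemma green_ratio_ge0 u x : 0 <= green_ratio u x.
Proof. by rewrite divr_ge0 ?mulr_ge0 ?green_ge0 ?ltW. Qed.

Lemma green_ratio_self u : green_ratio u u = 1.
Proof. by rewrite /green_ratio subrr mulfV// mulf_neq0// gt_eqF. Qed.

(** Times [phi], the ratio is a multiple of [green (_ - u)], superharmonic on the lattice, and [phi]
    is harmonic off [o]. *)
Lemma green_ratio_superharmonic u x : x != o ->
  \sum_k phi (x + dir k) * (green_ratio u (x + dir k) - green_ratio u x) <= 0.
Proof.
move=> xo.
have -> : \sum_k phi (x + dir k) * (green_ratio u (x + dir k) - green_ratio u x) =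
    phi u / green 0 * \sum_k green (x - u + dir k) - green_ratio u x * \sum_k phi (x + dir k).
  rewrite !mulr_sumr -sumrB; apply: eq_bigr => k _.
  rewrite mulrBr [_ * green_ratio u x]mulrC; congr (_ - _).
  rewrite /green_ratio addrAC; have := phin (x + dir k).
  move: (phi (x + dir k)) (green (x - u + dir k)) => a b a0.
  by field; rewrite a0 gt_eqF.
rewrite !sum_dir// (phi_avg hphi)// avg_green// mulrCA [X in _ - X]mulrCA -mulrBr.
rewrite pmulr_rle0 ?ltr0n ?muln_gt0// subr_le0 /green_ratio invfM mulrA divfK//.
rewrite mulrBr -[X in _ <= X]mulrA [X in _ <= X]mulrC gerBl.
by rewrite mulr_ge0 ?ler0n// divr_ge0// ltW.
Qed.

(** [phi * (e / phi)] is constant. This is the barrier of the finite-volume bounds: it exceeds 1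
    wherever [phi < e]. *)
Lemma inv_phi_harmonic x (e : R) : x != o ->
  \sum_k phi (x + dir k) * (e / phi (x + dir k) - e / phi x) = 0.
Proof.
move=> xo.
have -> : \sum_k phi (x + dir k) * (e / phi (x + dir k) - e / phi x) =
    \sum_(k : D) e - e / phi x * \sum_k phi (x + dir k).
  rewrite mulr_sumr -sumrB; apply: eq_bigr => k _.
  by rewrite mulrBr mulrC divfK// mulrC.
rewrite sum_dir// (phi_avg hphi)// sumr_const card_prod card_ord card_bool.
by rewrite mulrCA divfK// mulnC mulr_natl subrr.
Qed.

Variable G : subgraph V.
Hypothesis hG : is_subnetwork N G.
Local Notation W := (sub_vertices G).
Local Notation E := (sub_edges G).
Hypothesis oW : o \in W.
Let o' : W := [` oW]%fset.
Local Notation c := (@edge_weight R V W E (edge_cond N)).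
Local Notation F := (forest_sum o' c).

Lemma subnetwork_edge_ends e : e \in E ->
  exists x y : W, x != y /\ e = [fset val x; val y]%fset.
Proof.
move=> eE; have [x [y [ee h]]] := subnetwork_edges hG eE.
have /fsubsetP sub := subnetwork_ends hG eE.
have xW : x \in W by apply: sub; rewrite ee !inE eqxx.
have yW : y \in W by apply: sub; rewrite ee !inE eqxx orbT.
exists [` xW]%fset, [` yW]%fset; split => //.
rewrite -val_eqE /=; apply/eqP => xy; move: h; rewrite xy big1 => [//|i _].
by rewrite subrr normr0.
Qed.

Lemma edge_weight_ge0 (x y : W) : 0 <= c x y.
Proof. by rewrite /edge_weight; case: ifP => // _; apply: prodr_ge0 => v _; exact: ltW. Qed.

(** At points of such a [B] the piece contains the full lattice neighbourhood, so its weighted sums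
    are those of the infinite network. *)
Definition interior (B : {fset V}) := forall x, x \in B ->
  x \in W /\ forall k, [fset x; (x + dir k)%R]%fset \in E.

Lemma interior_neighbor B x k : interior B -> x \in B -> x + dir k \in W.
Proof.
move=> iB xB; have [_ /(_ k) h] := iB x xB.
by have /fsubsetP := subnetwork_ends hG h; apply; rewrite !inE eqxx orbT.
Qed.

Lemma edge_weight_dir B (x y : W) k : interior B -> val x \in B -> val y = val x + dir k ->
  c x y = phi (val x) * phi (val y).
Proof.
move=> iB xB e; have [_ /(_ k) h] := iB _ xB.
rewrite /edge_weight -val_eqE e /edge_of e h andbT.
rewrite (_ : (_ == _) = false) /=; first exact: condE.
by apply/negbTE; rewrite eq_sym -subr_eq0 addrAC subrr add0r dir_neq0.
Qed.

Lemma sum_edge_weight B (x : W) (g : V -> R) : interior B -> val x \in B ->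
  \sum_y c x y * g (val y) = phi (val x) * \sum_k phi (val x + dir k) * g (val x + dir k).
Proof.
move=> iB xB; rewrite mulr_sumr.
pose nb (k : D) : W := [` interior_neighbor k iB xB]%fset.
have nb_inj : injective nb by move=> k l /(congr1 val) /= /addrI /dir_inj.
rewrite (bigID (fun y : W => y \in codom nb)) /= [X in _ + X]big1 ?addr0; last first.
  move=> y yn; rewrite /edge_weight; case: ifP => [/andP[xy h]|]; last by rewrite mul0r.
  have /zd_edgesP[k hk] : adj (@Zd_edges d) (val x) (val y).
    by rewrite /adj val_eqE xy inE; exact: (subnetwork_edges hG h).
  by case/negP: yn; apply/codomP; exists k; apply: val_inj.
rewrite -big_filter (perm_big (map nb (index_enum D))); last first.
  apply: uniq_perm.
  - by rewrite filter_uniq// index_enum_uniq.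
  - by rewrite map_inj_uniq// index_enum_uniq.
  move=> y; rewrite mem_filter mem_index_enum andbT.
  by apply/codomP/mapP => [[k ->]|[k _ ->]]; exists k => //; exact: mem_index_enum.
rewrite big_map; apply: eq_bigr => k _.
by rewrite (edge_weight_dir (k := k) iB xB)//= mulrA.
Qed.

(** Only points where [f] exceeds [s] need checking. A positive maximum of [f - s] would propagate
    to all lattice neighbours, hence through the whole lattice, and reach [o], where [f <= s]. *)
Lemma maximum_principle B (f : W -> R) (s : V -> R) : interior B -> f o' <= s o ->
  (forall x : W, s (val x) < f x -> [/\ val x \in B,
     0 <= \sum_y c x y * (f y - f x) &
     \sum_k phi (val x + dir k) * (s (val x + dir k) - s (val x)) <= 0]) ->
  forall x : W, f x <= s (val x).
Proof.
move=> iB fo h x1; rewrite -subr_le0; pose D x := f x - s (val x).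
pose x := [arg max_(x > o') D x]%O.
have xmax y : D y <= D x by rewrite /x; case: arg_maxP => // i _; apply.
apply: le_trans (xmax x1) _; rewrite leNgt; apply/negP => Dx.
pose S v := exists2 y : W, val y = v & D y = D x.
have all v : S v.
  apply: (@lattice_ind d S (val x)); first by exists x.
  move=> _ k [y <- Dy]; have sy : s (val y) < f y by rewrite -subr_gt0 -/(D y) Dy.
  have [yB fy ssy] := h y sy.
  have sum0 : 0 <= \sum_z c y z * (D z - D y).
    have e : \sum_z c y z * (D z - D y) = \sum_z c y z * (f z - f y) -
        \sum_z c y z * (s (val z) - s (val y)).
      by rewrite -sumrB; apply: eq_bigr => z _; rewrite /D; ring.
    rewrite e subr_ge0; apply: le_trans fy.
    rewrite (sum_edge_weight (fun v => s v - s (val y)) iB yB).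
    by rewrite pmulr_rle0.
  have neg z : c y z * (D z - D y) <= 0.
    by rewrite mulr_ge0_le0 ?edge_weight_ge0// subr_le0 Dy xmax.
  pose z : W := [` interior_neighbor k iB yB]%fset.
  exists z => //; have cz := edge_weight_dir (y := z) iB yB (erefl (val y + dir k)).
  have : 0 <= c y z * (D z - D y).
    apply: le_trans sum0 _; rewrite (bigD1 z)//= gerDl.
    by apply: sumr_le0 => t _; exact: neg.
  rewrite cz pmulr_rge0 ?mulr_gt0// subr_ge0 Dy => hz.
  by apply/eqP; rewrite eq_le xmax hz.
have [y yo Dy] := all o; have : D y <= 0.
  by rewrite subr_le0 yo (_ : y = o')//; apply: val_inj.
by rewrite Dy leNgt Dx.
Qed.

(** The partition function of the tree measure. Bounds stay multiplied by it until [total_gt0_near]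
    shows that it is positive for large pieces. *)
Definition total : R := F (fun=> true).

Lemma total_ge0 : 0 <= total.
Proof. by apply: forest_sum_ge0; exact: edge_weight_ge0. Qed.

Lemma forest_le_total Q : F Q <= total.
Proof. by apply: forest_sum_le => //; exact: edge_weight_ge0. Qed.

Lemma forest_sum0 Q : (forall p, rooted o' p -> Q p = false) -> F Q = 0.
Proof. by move=> h; rewrite /forest_sum big1// => p rp; rewrite h// mulr0. Qed.

Lemma root_fconnect p (u : W) : rooted o' p -> fconnect p o' u -> u = o'.
Proof. by move=> rp /fconnectP[n]; rewrite iter_root. Qed.

(** The exit event is subharmonic inside [B] off [o] and impossible from [o], while the right side
    is at least [total] outside [B]. *)
Lemma exit_bound B (e : R) (x : W) : interior B -> 0 < e -> o \in B ->
  (forall v, v \notin B -> phi v < e) ->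
  F (fun p => meets (fun u => val u \notin B) p x) <= total * (e / phi (val x)).
Proof.
move=> iB e0 oB hB; have Z0 := total_ge0.
apply: (maximum_principle (B := B) (f := fun x => F (fun p => meets (fun u => val u \notin B) p x))
  (s := fun v => total * (e / phi v))) => //.
  rewrite forest_sum0; first by rewrite mulr_ge0// divr_ge0// ltW.
  move=> p rp; apply/negbTE/existsPn => u; rewrite negb_and negbK orbC -implybE.
  by apply/implyP => /(root_fconnect rp) ->.
move=> y hy; have yB : val y \in B.
  apply: contraT => /hB ye; exfalso; move: hy; apply/negP; rewrite -leNgt.
  apply: le_trans (forest_le_total _) _; rewrite -[leLHS]mulr1 ler_wpM2l//.
  by rewrite ler_pdivlMr// mul1r ltW.
have yo : y != o'.
  apply/eqP => yo; move: hy; apply/negP; rewrite -leNgt forest_sum0.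
    by rewrite mulr_ge0// divr_ge0// ltW.
  move=> p rp; apply/negbTE/existsPn => u; rewrite negb_and negbK orbC -implybE.
  by rewrite yo; apply/implyP => /(root_fconnect rp) ->.
split => //.
  by apply: meets_subharmonic => //; [exact: edge_weight_ge0 | rewrite negbK].
have vyo : val y != o by apply: contra yo => /eqP h; apply/eqP/val_inj.
under eq_bigr do rewrite -mulrBr mulrCA.
by rewrite -mulr_sumr inv_phi_harmonic// mulr0.
Qed.

Definition hit_bound (e : R) (u x : V) : R := green_ratio u x + e / phi x.

Lemma hit_bound_ge0 e u x : 0 < e -> 0 <= hit_bound e u x.
Proof.
by move=> e0; apply: addr_ge0; [exact: green_ratio_ge0 | apply: divr_ge0; exact: ltW].
Qed.

(** In [x], the merging weight is subharmonic off [o] and [u], vanishes at [o], and never exceeds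
    [T], since merging at [u] puts [u] on the branch of [z]. The claimed bound is at least [T] at
    [u] and outside [B], so only interior points remain. *)
Lemma lca_bound_step B (e T : R) (u z : W) : interior B -> 0 < e ->
  (forall v, v \notin B -> phi v < e) -> u != o' ->
  F (fun p => lca u p z u) <= T ->
  forall x : W, F (fun p => lca u p z x) <= T * hit_bound e (val u) (val x).
Proof.
move=> iB e0 hB uo hT; have T0 : 0 <= T.
  by apply: le_trans hT; apply: forest_sum_ge0; exact: edge_weight_ge0.
have lez x : F (fun p => lca u p z x) <= T.
  apply: le_trans hT; apply: forest_sum_le; first exact: edge_weight_ge0.
  by move=> p rp; rewrite lca_self => /and3P[].
have zero : F (fun p => lca u p z o') = 0.
  apply: forest_sum0 => p rp; apply/negbTE/negP => /and3P[_ /(root_fconnect rp) h _].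
  by rewrite h eqxx in uo.
apply: (maximum_principle (B := B) (s := fun v => T * hit_bound e (val u) v)) => //.
  by rewrite zero mulr_ge0// hit_bound_ge0.
move=> y hy.
have lt1 : hit_bound e (val u) (val y) < 1.
  rewrite ltNge; apply/negP => h; move: hy; apply/negP; rewrite -leNgt.
  by apply: le_trans (lez y) _; rewrite -[leLHS]mulr1 ler_wpM2l.
have yB : val y \in B.
  apply: contraT => /hB ye; exfalso; move: lt1; apply/negP; rewrite -leNgt.
  apply: (@le_trans _ _ (e / phi (val y))); first by rewrite ler_pdivlMr// mul1r ltW.
  by rewrite /hit_bound lerDr green_ratio_ge0.
have yu : y != u.
  apply/eqP => yu; move: lt1; apply/negP; rewrite -leNgt yu /hit_bound green_ratio_self.
  by rewrite lerDl divr_ge0// ltW.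
have yo : y != o'.
  apply/eqP => yo; move: hy; apply/negP; rewrite -leNgt yo zero.
  by rewrite mulr_ge0// hit_bound_ge0.
split => //; first by apply: lca_subharmonic => //; exact: edge_weight_ge0.
have vyo : val y != o by apply: contra yo => /eqP h; apply/eqP/val_inj.
have -> : \sum_k phi (val y + dir k) *
    (T * hit_bound e (val u) (val y + dir k) - T * hit_bound e (val u) (val y)) =
  T * (\sum_k phi (val y + dir k) *
         (green_ratio (val u) (val y + dir k) - green_ratio (val u) (val y)) +
       \sum_k phi (val y + dir k) * (e / phi (val y + dir k) - e / phi (val y))).
  rewrite -big_split /= mulr_sumr; apply: eq_bigr => k _; rewrite /hit_bound.
  move: (_ / _) (_ / _) => a b; ring.
by rewrite inv_phi_harmonic// addr0 mulr_ge0_le0// green_ratio_superharmonic.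
Qed.

(** The step is used twice: in [z2], and then, by symmetry of [lca], in [z1] with the other branch
    started at [u]. *)
Lemma lca_bound B (e : R) (u z1 z2 : W) : interior B -> 0 < e ->
  (forall v, v \notin B -> phi v < e) -> u != o' ->
  F (fun p => lca u p z1 z2) <=
    total * hit_bound e (val u) (val z1) * hit_bound e (val u) (val z2).
Proof.
move=> iB e0 hB uo; apply: (lca_bound_step iB e0 hB uo).
have -> : F (fun p => lca u p z1 u) = F (fun p => lca u p u z1).
  by rewrite /forest_sum; apply: eq_bigr => p _; rewrite lcaC.
by apply: (lca_bound_step iB e0 hB uo); exact: forest_le_total.
Qed.

End FiniteVolume.

(** * Disjoint branches *)

Definition fork (V : choiceType) (B : {fset V}) (x y : V) (A : set {fset V}) : Prop :=
  exists u p q, [/\ u \in B, path (adj A) u p /\ last u p = x,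
    path (adj A) u q /\ last u q = y & uniq (u :: p ++ q)].

Section Fork.
Variables (V : choiceType) (W : {fset V}) (E : {fset {fset V}}) (o : W).

(** The branch of [x] read downwards from [u]. That its later vertices are not above [u] makes two
    such paths disjoint when [u] is the merging point. *)
Lemma descending_path (p : {ffun W -> W}) (x u : W) : rooted o p -> fconnect p x u ->
  exists q : seq W, [/\ path (fun a b => [&& b != o, a == p b & fconnect p x b]) u q,
    last u q = x, uniq (u :: q) & forall w, w \in q -> ~~ fconnect p u w].
Proof.
move=> rp /fconnectP[n]; elim: n x => [|n IH] x; first by move=> /= ->; exists [::].
rewrite iterSr => hn; have [->|xu] := eqVneq x u; first by exists [::].
have pxu : fconnect p (p x) u by apply/fconnectP; exists n.
have xo : x != o.
  apply/eqP => xo; have /andP[/eqP po _] := rp.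
  by move: hn; rewrite xo po iter_root// => ou; rewrite xo ou eqxx in xu.
have [q [qp ql qu qn]] := IH _ hn.
have qin w : w \in q -> fconnect p (p x) w.
  move=> wq; move: qp; clear -wq; elim: q u wq => //= a q IH u.
  rewrite inE => /orP[/eqP ->|wq] /andP[/and3P[_ _ h] hq] //.
  exact: IH wq hq.
exists (rcons q x); split.
- rewrite rcons_path ql xo eqxx connect0 /= andbT.
  by apply: sub_path qp => a b /and3P[-> -> h]; rewrite fconnect_step h orbT.
- by rewrite last_rcons.
- rewrite -rcons_cons rcons_uniq qu andbT inE negb_or xu /=.
  by apply/negP => /qin; rewrite (rooted_acyclic rp xo).
move=> w; rewrite mem_rcons inE => /orP[/eqP ->|/qn//].
apply: contra xu => ux; apply/eqP; apply: (rooted_antisym rp) => //.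
by rewrite fconnect_step pxu orbT.
Qed.

(** Branches that stay in [B] use only edges recorded in [K], so the fork is visible in a finite
    window and survives the weak limit. *)
Lemma lca_fork (p : {ffun W -> W}) (Br B : {fset V}) (K : {fset {fset V}}) (u x y : W) :
  inner E o p ->
  (forall a b, a \in B -> b \in B -> [fset a; b]%fset \in E -> [fset a; b]%fset \in K) ->
  ~~ meets (fun u => val u \notin B) p x -> ~~ meets (fun u => val u \notin B) p y ->
  lca u p x y -> val u \in Br -> fork Br (val x) (val y) [set` (tree_of o p `&` K)%fset].
Proof.
move=> ip hK hx hy /and3P[xu yu /forallP hu] uB; have rp := inner_rooted ip.
have inB z w : ~~ meets (fun u => val u \notin B) p z -> fconnect p z w -> val w \in B.
  move=> /existsPn/(_ w); rewrite negb_and negbK => /orP[//|/negP nw zw]; by case: nw.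
have vpath z q : ~~ meets (fun u => val u \notin B) p z ->
    path (fun a b => [&& b != o, a == p b & fconnect p z b]) u q ->
    path (adj [set` (tree_of o p `&` K)%fset]) (val u) (map val q).
  move=> hz; rewrite path_map; apply: sub_path => a b /and3P[bo /eqP -> zb].
  have /andP[bp bE] := innerP ip bo.
  rewrite /= adj_sym /adj val_eqE bp inE /= inE; apply/andP; split.
    by apply/tree_ofP; exists b.
  apply: hK => //; apply: (inB z) => //; apply: connect_trans zb _.
  by rewrite -[connect _ _ _]/(fconnect p b (p b)) fconnect_step connect0 orbT.
have below z q : path (fun a b => [&& b != o, a == p b & fconnect p z b]) u q ->
    forall w, w \in q -> fconnect p z w.
  elim: q {uB hu xu yu vpath} u => //= a q IH u /andP[/and3P[_ _ h] hq] w.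
  by rewrite inE => /orP[/eqP -> //|]; exact: IH hq w.
have [q1 [p1 l1 u1 n1]] := descending_path rp xu.
have [q2 [p2 l2 u2 n2]] := descending_path rp yu.
exists (val u), (map val q1), (map val q2); split => //.
- by split; [exact: vpath hx p1 | rewrite last_map l1].
- by split; [exact: vpath hy p2 | rewrite last_map l2].
rewrite -map_cat -map_cons map_inj_uniq; last exact: val_inj.
move: u1 u2; rewrite !cons_uniq => /andP[uq1 uu1] /andP[uq2 uu2].
rewrite mem_cat negb_or uq1 uq2 cat_uniq uu1 uu2 /=.
rewrite andbT; apply/hasPn => w wq2; apply/negP => wq1.
have := hu w; rewrite (below x q1 p1 w wq1) (below y q2 p2 w wq2) /=.
by rewrite (negPf (n1 w wq1)).
Qed.

End Fork.

(** * Probability of a fork, and choice of the starting points *)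

Section ForkProbability.
Variables (R : realType) (d : nat).
Hypothesis hd : (5 <= d)%N.
Local Notation V := 'rV[int]_d.
Local Notation avg := (@avg d R).
Local Notation green := (@green R d).
Variables (o : V) (phi : V -> R).
Hypothesis hphi : forall v, is_hitting_probability (simple_Zd R d) v o (phi v).
Local Notation N := (reweighted_Zd phi).

Let d0 : (0 < d)%N. Proof. by lia. Qed.
Let d2 : 0 < (2 * d)%:R :> R. Proof. by rewrite ltr0n muln_gt0. Qed.
Let g0 : 0 < green 0. Proof. exact: green0_gt0. Qed.
Let phi0 x : 0 < phi x. Proof. exact: phi_gt0. Qed.

(** Union bound: without a fork, one of the branches leaves [B], or they merge in [B] outside [Br].
    The set [B'] carries a separate error [e'] because that error is summed over points of [B], so
    it has to be chosen after [B]. *)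
Lemma total_fork (G : subgraph V) (oW : o \in sub_vertices G) (Br B B' : {fset V})
    (K : {fset {fset V}}) (e e' : R) (z1 z2 : sub_vertices G) :
  is_subnetwork N G -> interior G B -> interior G B' -> 0 < e -> 0 < e' ->
  (forall v, v \notin B -> phi v < e) -> (forall v, v \notin B' -> phi v < e') ->
  (forall a b, a \in B -> b \in B -> @Zd_edges d [fset a; b]%fset -> [fset a; b]%fset \in K) ->
  o \in Br -> o \in B ->
  total phi oW * (1 - e / phi (val z1) - e / phi (val z2) -
      \sum_(u <- [seq u <- B | u \notin Br])
        hit_bound phi e' u (val z1) * hit_bound phi e' u (val z2)) <=
  forest_sum ([` oW]%fset) (edge_weight (sub_edges G) (edge_cond N))
    (fun p => `[< fork Br (val z1) (val z2) [set` (tree_of [` oW]%fset p `&` K)%fset] >]).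
Proof.
move=> hG iB iB' e0 e0' hB hB' hK oBr oB.
have hK' a b : a \in B -> b \in B -> [fset a; b]%fset \in sub_edges G -> [fset a; b]%fset \in K.
  by move=> aB bB /(subnetwork_edges hG); exact: hK.
set o' := [` oW]%fset; set F := forest_sum _ _; set g := fun p => asbool _.
pose m z := fun p => meets (fun u : sub_vertices G => val u \notin B) p z.
pose P (u : sub_vertices G) := (val u \in B) && (val u \notin Br).
have h1 : total phi oW <= F g + F (m z1) + F (m z2) +
    \sum_(u | P u) F (fun p => lca u p z1 z2).
  rewrite /total -/F /F /forest_sum exchange_big /= -!big_split /=.
  apply: ler_sum => p rp; rewrite -mulr_sumr -!mulrDr.
  have [ip|nip] := boolP (inner (sub_edges G) o' p); last first.
    by rewrite (parent_weight_not_inner _ rp nip) !mul0r.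
  apply: ler_wpM2l; first by apply: parent_weight_ge0 => x y; exact: edge_weight_ge0.
  rewrite -natr_sum -!natrD ler_nat.
  have [u hu] := lca_exists z1 z2 rp.
  case hm1 : (m z1 p).
    by move: (\sum_(_ | _) _)%N (g p) (m z2 p) => S [] [].
  case hm2 : (m z2 p).
    by move: (\sum_(_ | _) _)%N (g p) => S [].
  have uB : val u \in B.
    have /and3P[z1u _ _] := hu.
    have /existsPn/(_ u) := negbT hm1.
    by rewrite negb_and negbK => /orP[//|/negP nw]; case: nw.
  have [uBr|uBr] := boolP (val u \in Br).
    suff -> : g p by [].
    by apply/asboolP; apply: (lca_fork ip hK' _ _ hu uBr); rewrite ?hm1 ?hm2 /m;
      [exact: (negbT hm1) | exact: (negbT hm2)].
  rewrite (bigD1 u) /P ?uB ?uBr//= hu.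
  by move: (\sum_(_ | _) _)%N (g p) => S [].
have h2 z : F (m z) <= total phi oW * (e / phi (val z)) by exact: exit_bound.
have h3 u : P u -> F (fun p => lca u p z1 z2) <=
   total phi oW * (hit_bound phi e' (val u) (val z1) * hit_bound phi e' (val u) (val z2)).
  move=> /andP[_ uBr]; rewrite mulrA; apply: lca_bound hB' _ => //.
  by apply: contra uBr => /eqP ->.
have h4 : \sum_(u | P u) F (fun p => lca u p z1 z2) <=
  total phi oW * \sum_(u <- [seq u <- B | u \notin Br])
        hit_bound phi e' u (val z1) * hit_bound phi e' u (val z2).
  apply: (le_trans (ler_sum _ h3)); rewrite -mulr_sumr.
  rewrite le_eqVlt; apply/orP; left; apply/eqP; congr (_ * _).
  pose Pv v := (v \in B) && (v \notin Br).
  rewrite (eq_bigl (fun u : sub_vertices G => Pv (val u)))//.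
  rewrite -(big_seq_fsetE _ (sub_vertices G) Pv
    (fun v => hit_bound phi e' v (val z1) * hit_bound phi e' v (val z2))) -big_filter.
  apply: perm_big; apply: uniq_perm.
  - by rewrite filter_uniq// fset_uniq.
  - by rewrite filter_uniq// fset_uniq.
  move=> v; rewrite !mem_filter /Pv andbC; have [vB /=|vB] := boolP (v \in B);
    last by rewrite andbF andbC.
  by have [-> _] := iB v vB; rewrite andbT.
rewrite !mulrBr mulr1; have := h2 z1; have := h2 z2; lra.
Qed.

(* Starting points are drawn from [m(z) green (z - o)], where [m = w - avg w] and
   [w = min (phi / c, 1)]: then [w] is the Green potential of [m], so that the total mass is
   [w o = 1] and the average of [green_ratio u] is [w u * phi u <= phi u]. *)
Lemma averaged_start (c : R) : 0 < c -> (2 * d)%:R * c < 1 ->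
  exists (Q : seq V) (nu : V -> R), [/\ uniq Q,
    forall z, z \in Q -> c / (2 * d)%:R < phi z <= (2 * d)%:R * c,
    forall z, 0 <= nu z, \sum_(z <- Q) nu z = 1 &
    forall u, \sum_(z <- Q) nu z * green_ratio phi u z <= phi u].
Proof.
move=> c0 c1; pose w v := Num.min (phi v / c) 1.
have d1 : 1 <= (2 * d)%:R :> R by rewrite ler1n muln_gt0.
have c2 : c < 1 by apply: le_lt_trans c1; rewrite ler_peMl// ltW.
have w0 v : 0 <= w v by rewrite /w le_min ler01 divr_ge0// ltW.
have w1 v : w v <= 1 by rewrite /w ge_min lexx orbT.
have wc v : phi v <= c -> w v = phi v / c.
  by move=> h; rewrite /w min_l// ler_pdivrMr// mul1r.
have wC v : c <= phi v -> w v = 1.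
  by move=> h; rewrite /w min_r// ler_pdivlMr// mul1r.
have harm v : v != o -> forall k, phi (v + dir k) <= (2 * d)%:R * phi v.
  move=> vo k; rewrite -(phi_avg hphi vo) -sum_dir//.
  by rewrite (bigD1 k)//= lerDl sumr_ge0// => l _; exact: ltW.
pose m v := w v - avg w v.
have wo : w o = 1 by apply: wC; rewrite (phi_target hphi) ltW.
have m0 v : 0 <= m v.
  rewrite subr_ge0 /w le_min; apply/andP; split; last first.
    apply: (@le_trans _ _ (avg (fun=> 1) v)); last by rewrite avg_cst.
    by apply: avg_le => x; exact: w1.
  have [->|vo] := eqVneq v o.
    apply: (@le_trans _ _ 1); last first.
      by rewrite (phi_target hphi) ler_pdivlMr// mul1r ltW.
    by rewrite -[leRHS](congr1 (fun f => f o) (avg_cst 1 d0)); apply: avg_le => x; exact: w1.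
  rewrite -(phi_avg hphi vo) mulrC -[leRHS](congr1 (fun f => f v) (avgZ c^-1 phi)).
  by apply: avg_le => x; rewrite mulrC /w ge_min lexx.
(* Outside this window [v] and its neighbours lie on one side of the level [c], by the factor [2 d]
   in [harm], so near [v] the function [w] is [phi / c] or 1. *)
have mout v : ~~ (c / (2 * d)%:R < phi v <= (2 * d)%:R * c) -> m v = 0.
  rewrite negb_and -!leNgt -ltNge => /orP[h|h].
    have vo : v != o.
      apply: contraTneq h => ->; rewrite -ltNge (phi_target hphi) ltr_pdivrMr// mul1r.
      exact: lt_le_trans c2 d1.
    have wv : w v = c^-1 * phi v.
      rewrite wc 1?mulrC//; apply: (le_trans h); rewrite ler_pdivrMr//.
      by rewrite ler_peMr// ltW.
    have -> : m v = c^-1 * (phi v - avg phi v).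
      rewrite /m wv mulrBr; congr (_ - _).
      rewrite -[RHS](congr1 (fun f => f v) (avgZ c^-1 phi)) /avg; congr (_ * _).
      apply: eq_bigr => k _; rewrite wc 1?mulrC//; apply: le_trans (harm v vo k) _.
      by rewrite mulrC -ler_pdivlMr.
    by rewrite (phi_avg hphi vo) subrr mulr0.
  have wv : w v = 1.
    apply: wC; apply: le_trans (ltW h); by rewrite ler_peMl// ltW.
  rewrite /m wv /avg (eq_bigr (fun=> 1)); last first.
    move=> k _; apply: wC; have [ko|ko] := eqVneq (v + dir k) o.
      by rewrite ko (phi_target hphi) ltW.
    have := harm _ ko (opp k); rewrite addr_dirK => h2.
    by rewrite -(ler_pM2l d2); apply: ltW; exact: lt_le_trans h h2.
  by have := congr1 (fun f => f v) (avg_cst (1 : R) d0); rewrite /avg => ->; rewrite subrr.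
have [B hB] := phi_small hd hphi (divr_gt0 c0 d2).
pose Q := [seq z <- B | c / (2 * d)%:R < phi z <= (2 * d)%:R * c].
have uQ : uniq Q by rewrite filter_uniq// fset_uniq.
have mQ v : v \notin Q -> m v = 0.
  rewrite mem_filter negb_and => /orP[|/hB vB]; first exact: mout.
  by apply: mout; rewrite negb_and -leNgt ltW.
(* Both sides differ from their averages by the same [m] and are dominated by functions whose
   iterated averages vanish, so neither difference can be positive. *)
have pot v : \sum_(z <- Q) m z * green (v - z) = w v.
  pose U v := \sum_(z <- Q) m z * green (v - z).
  have avgU x : avg U x = U x - m x.
    rewrite /U avg_sum.
    transitivity (\sum_(z <- Q) (m z * green (x - z) - m z * delta0 R (x - z))).
      by apply: eq_bigr => z _; rewrite avgZ avg_shift avg_green// mulrBr.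
    rewrite sumrB; congr (_ - _); rewrite /delta0.
    have [xQ|xQ] := boolP (x \in Q).
      rewrite (bigD1_seq x)//= subrr eqxx mulr1 big1 ?addr0// => z zx.
      by rewrite subr_eq0 eq_sym (negPf zx) mulr0.
    rewrite mQ// big1_seq// => z /= zQ; rewrite subr_eq0.
    by case: eqP => [xz|_]; rewrite ?mulr0//; rewrite xz zQ in xQ.
  have U0 x : 0 <= U x.
    by apply: sumr_ge0 => z _; rewrite mulr_ge0 ?green_ge0.
  have Ucvg x : iter n avg U x @[n --> \oo] --> (0 : R).
    have -> : (fun n => iter n avg U x) =
        (fun n => \sum_(z <- Q) m z * iter n avg green (x - z)).
      apply/funext => n; rewrite /U iter_avg_sum; apply: eq_bigr => z _.
      by rewrite iter_avgZ iter_avg_shift.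
    have z0 : \sum_(z <- Q) m z * 0 = 0 :> R by rewrite big1// => z _; rewrite mulr0.
    rewrite -[X in _ --> X]z0.
    by apply: cvg_sumr => z _; apply: cvgMl_tmp; exact: iter_avg_green_cvg.
  pose H x := phi x / c.
  have Hcvg x : iter n avg H x @[n --> \oo] --> (0 : R).
    have -> : (fun n => iter n avg H x) =
        (fun n => (c * green 0)^-1 * iter n avg green (x - o)).
      apply/funext => n; rewrite -[iter n avg green _](congr1 (fun f => f x)
        (iter_avg_shift n (- o) green)) -[RHS](congr1 (fun f => f x) (iter_avgZ n _ _)).
      congr (iter n _ _ x); apply/funext => y.
      by rewrite /H (phiE hd hphi) invfM; ring.
    by rewrite -(mulr0 (c * green 0)^-1); apply: cvgMl_tmp; exact: iter_avg_green_cvg.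
  have sumcvg x : iter n avg (fun y => U y + H y) x @[n --> \oo] --> (0 : R).
    have -> : (fun n => iter n avg (fun y => U y + H y) x) =
      (fun n => iter n avg U x + iter n avg H x) by apply/funext => n; rewrite iter_avgD.
    by rewrite -(addr0 (0 : R)); apply: cvgD.
  have avgw x : avg w x = w x - m x by rewrite /m; ring.
  have H0 x : 0 <= H x by rewrite divr_ge0// ltW.
  have wH x : w x <= H x by rewrite /w ge_min lexx.
  apply: le_anti; apply/andP; split; rewrite -subr_le0.
    apply: (@subharmonic_le0 R d (fun x => U x - w x) _ _ _ sumcvg) => x.
      by rewrite avgB avgU avgw; lra.
    by have := U0 x; have := w0 x; have := H0 x; lra.
  apply: (@subharmonic_le0 R d (fun x => w x - U x) _ _ _ sumcvg) => x.
    by rewrite avgB avgU avgw; lra.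
  by have := U0 x; have := wH x; lra.
exists Q, (fun z => m z * green (z - o)); split => //.
- by move=> z; rewrite mem_filter => /andP[].
- by move=> z; rewrite mulr_ge0 ?green_ge0.
- rewrite -wo -(pot o); apply: eq_bigr => z _.
  by rewrite -(opprB z o) greenN_arg.
move=> u.
apply: (@le_trans _ _ (phi u * w u)); last by rewrite ler_piMr// ltW.
rewrite -(pot u) mulr_sumr; apply: ler_sum => z _; rewrite /green_ratio.
(* Since [phi z] is [green (z - o) / green 0], the factor [green (z - o)] of the starting law
   cancels the denominator of [green_ratio]. *)
rewrite (phiE hd hphi z) -[u - z]opprB greenN_arg.
have : green (z - o) != 0 by rewrite gt_eqF ?green_gt0.
have : green 0 != 0 by rewrite gt_eqF.
move: (green (z - o)) (green 0) (green (z - u)) (phi u) (m z) => a b a' p q b0 a0.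
by rewrite le_eqVlt; apply/orP; left; apply/eqP; field; rewrite ?a0 ?b0.
Qed.

(** First moment method: for independent [z1] and [z2] of law [nu], the mean of the left sum is a
    sum of squared means of [green_ratio], and these means are at most [phi u]. *)
Lemma exists_start_pair (c : R) (s : seq V) : 0 < c -> (2 * d)%:R * c < 1 ->
  exists z1 z2, [/\ c / (2 * d)%:R < phi z1 <= (2 * d)%:R * c,
    c / (2 * d)%:R < phi z2 <= (2 * d)%:R * c &
    \sum_(u <- s) green_ratio phi u z1 * green_ratio phi u z2 <= \sum_(u <- s) phi u ^+ 2].
Proof.
move=> c0 c1; have [Q [nu [_ hQ nu0 nu1 nuR]]] := averaged_start c0 c1.
apply: contrapT => none.
pose X z1 z2 := \sum_(u <- s) green_ratio phi u z1 * green_ratio phi u z2 -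
   \sum_(u <- s) phi u ^+ 2.
have Xpos z1 z2 : z1 \in Q -> z2 \in Q -> 0 < X z1 z2.
  move=> h1 h2; rewrite subr_gt0 ltNge; apply/negP => h; apply: none.
  by exists z1, z2; split => //; exact: hQ.
have sumX : \sum_(z1 <- Q) \sum_(z2 <- Q) nu z1 * nu z2 * X z1 z2 <= 0.
  have -> : \sum_(z1 <- Q) \sum_(z2 <- Q) nu z1 * nu z2 * X z1 z2 =
    \sum_(u <- s) ((\sum_(z <- Q) nu z * green_ratio phi u z) ^+ 2 - phi u ^+ 2).
    transitivity (\sum_(z1 <- Q) \sum_(z2 <- Q) \sum_(u <- s)
      ((nu z1 * green_ratio phi u z1) * (nu z2 * green_ratio phi u z2) - nu z1 * nu z2 * phi u ^+ 2)).
      apply: eq_bigr => z1 _; apply: eq_bigr => z2 _.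
      by rewrite /X -sumrB mulr_sumr; apply: eq_bigr => u _; ring.
    under eq_bigr do rewrite exchange_big /=; rewrite exchange_big /=; apply: eq_bigr => u _.
    transitivity (\sum_(z1 <- Q) ((nu z1 * green_ratio phi u z1) *
       (\sum_(z2 <- Q) nu z2 * green_ratio phi u z2) - nu z1 * phi u ^+ 2)).
      apply: eq_bigr => z1 _; rewrite sumrB -mulr_sumr; congr (_ - _).
      by rewrite -mulr_suml -mulr_sumr nu1 mulr1.
    by rewrite sumrB -!mulr_suml nu1 mul1r expr2.
  apply: sumr_le0 => u _; rewrite subr_le0 lerXn2r ?nnegrE//.
    by apply: sumr_ge0 => z _; rewrite mulr_ge0//; exact: (green_ratio_ge0 hd hphi).
  exact: ltW.
have zero z1 z2 : z1 \in Q -> z2 \in Q -> nu z1 * nu z2 = 0.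
  move=> h1 h2; have pos z z' : z \in Q -> z' \in Q -> 0 <= nu z * nu z' * X z z'.
    by move=> hz hz'; rewrite mulr_ge0 ?mulr_ge0// ltW// Xpos.
  have pos' z : z \in Q -> 0 <= \sum_(z' <- Q) nu z * nu z' * X z z'.
    by move=> hz; rewrite big_seq; apply: sumr_ge0 => z' hz'; exact: pos.
  have hle : nu z1 * nu z2 * X z1 z2 <= 0.
    apply: le_trans sumX; apply: (@le_trans _ _ (\sum_(z' <- Q) nu z1 * nu z' * X z1 z')).
      rewrite (big_rem z2)//= lerDl big_seq; apply: sumr_ge0 => z' hz'; apply: pos => //.
      exact: mem_rem hz'.
    rewrite [leRHS](big_rem z1)//= lerDl big_seq; apply: sumr_ge0 => z' hz'; apply: pos'.
    exact: mem_rem hz'.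
  apply/eqP; rewrite eq_le mulr_ge0// andbT.
  by rewrite -(pmulr_lle0 _ (Xpos z1 z2 h1 h2)).
have : \sum_(z1 <- Q) \sum_(z2 <- Q) nu z1 * nu z2 = 1.
  by under eq_bigr do rewrite -mulr_sumr nu1 mulr1.
rewrite big1_seq => [/esym/eqP|z1 /= h1]; first by rewrite oner_eq0.
by rewrite big1_seq// => z2 /= h2; exact: zero.
Qed.

End ForkProbability.

(** * The weak limit *)

Section MoreThanOneEnd.
Variable V : choiceType.
Implicit Types (A : set {fset V}) (x y u : V).

Lemma adj_remove A u x y : adj A x y -> x != u -> y != u ->
  adj (remove_vertices A [fset u]%fset) x y.
Proof.
move=> /andP[xy]; rewrite inE => Axy xu yu; rewrite /adj xy inE; split => //.
by rewrite fdisjointX1 !inE negb_or ![u == _]eq_sym xu yu.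
Qed.

Lemma path_remove A u x p : path (adj A) x p -> u \notin x :: p ->
  path (adj (remove_vertices A [fset u]%fset)) x p.
Proof.
elim: p x => //= y p IH x /andP[xy yp]; rewrite !inE !negb_or => /and3P[ux uy up].
rewrite adj_remove 1?eq_sym//=; apply: IH => //.
by rewrite inE negb_or uy.
Qed.

Lemma path_avoid A u x p : path (adj (remove_vertices A [fset u]%fset)) x p -> x != u ->
  u \notin x :: p /\ path (adj A) x p.
Proof.
elim: p x => [|y p IH] x; first by move=> _ xu; rewrite mem_seq1 eq_sym.
move=> /andP[/andP[xy]]; rewrite inE => -[Axy]; rewrite fdisjointX1 !inE negb_or.
move=> /andP[ux uy] yp xu; have [|h1 h2] := IH y yp; first by rewrite eq_sym.
split; last by rewrite /= h2 andbT /adj xy inE.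
by rewrite (negPf ux) /=; move: h1; rewrite inE.
Qed.

(** A path from [a] to [b] avoiding [u] would close up through [u] to a cycle. *)
Lemma acyclic_component A u a b : acyclic A -> adj A u a -> adj A u b -> a != b ->
  ~ component A [fset u]%fset a b.
Proof.
move=> acyc ua ub ab [r hr er]; apply: acyc.
have au : a != u by move: ua => /andP[]; rewrite eq_sym.
case/shortenP: hr er => r' hr' ur _ er.
have [ur' pr] := path_avoid hr' au.
exists (u :: a :: r'); split.
  by case: r' hr' ur er ur' pr => [|c t] //= _ _ ba; rewrite ba eqxx in ab.
apply/andP; split; last by rewrite cons_uniq ur' ur.
by rewrite /= rcons_path ua pr -er /= adj_sym.
Qed.

(** In terms of [next], containing a given cycle is the presence of finitely many fixed edges, a
    cylinder event. *)
Lemma acyclic_cycleP A : ~ acyclic A -> exists s : seq V, [/\ (2 < size s)%N, uniq s &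
  forall x, x \in s -> A [fset x; next s x]%fset].
Proof.
move=> /contrapT[s [s2 /andP[cs us]]]; exists s; split => // x xs.
by have /andP[_] := next_cycle cs xs; rewrite inE.
Qed.

Lemma cycle_not_acyclic A (s : seq V) : (2 < size s)%N -> uniq s ->
  (forall x, x \in s -> A [fset x; next s x]%fset) -> ~ acyclic A.
Proof.
move=> s2 us h; apply; exists s; split => //; apply/andP; split => //.
apply: (cycle_from_next us) => x xs; apply/andP; split; last by rewrite inE; exact: h.
apply/eqP => xn; have [i s' es] := rot_to xs.
move: xn; rewrite -(next_rot i us) es /=.
have := us; rewrite -(rot_uniq i) es; have := size_rot i s; rewrite es.
case: s' {es} => [|b t] /=; first by move=> h1; rewrite -h1 in s2.
by rewrite eqxx => _ /andP[]; rewrite inE negb_or => /andP[xb _] _ /eqP; rewrite (negPf xb).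
Qed.

Lemma fork_sub (B : {fset V}) x y A A' : A `<=` A' -> fork B x y A -> fork B x y A'.
Proof.
move=> AA' [u [p [q [uB [hp ep] [hq eq] uq]]]]; exists u, p, q; split => //.
  by split => //; apply: sub_path hp => a b; exact: adj_sub.
by split => //; apply: sub_path hq => a b; exact: adj_sub.
Qed.

End MoreThanOneEnd.

Lemma infinite_pigeonhole (T : finType) (f : nat -> T) :
  exists t, forall m, exists2 n, (m <= n)%N & f n = t.
Proof.
apply: contrapT => none.
have /choice[g hg] (t : T) : exists m, forall n, (m <= n)%N -> f n <> t.
  apply: contrapT => ht; apply: none; exists t => m; apply: contrapT => hm.
  by apply: ht; exists m => n mn fn; apply: hm; exists n.
have := hg (f (\max_t g t)) (\max_t g t); apply => //.
exact: leq_bigmax.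
Qed.

(** * From forks with distant endpoints to two ends *)

Section LatticeForks.
Variables (R : realType) (d : nat).
Local Notation V := 'rV[int]_d.
Local Notation D := ('I_d * bool)%type.
Variable phi : V -> R.
Hypothesis phi0 : forall x, 0 < phi x.

Lemma finite_lower_bound (s : seq V) : exists2 e : R, 0 < e & forall x, x \in s -> e <= phi x.
Proof.
elim: s => [|x s [e e0 he]]; first by exists 1.
exists (Num.min e (phi x)); first by rewrite lt_min e0 phi0.
move=> y; rewrite inE ge_min => /orP[/eqP ->|/he ->//]; by rewrite lexx orbT.
Qed.

Lemma forks_more_than_one_end (A : set {fset V}) (B : {fset V}) : acyclic A ->
  (forall m : nat, exists z1 z2, [/\ phi z1 <= m.+1%:R^-1, phi z2 <= m.+1%:R^-1 &
     fork B z1 z2 (A `&` @Zd_edges d)]) ->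
  more_than_one_end A.
Proof.
move=> acyc hf; have [e e0 he] := finite_lower_bound B.
have small (r : R) : 0 < r -> exists m, forall n, (m <= n)%N -> n.+1%:R^-1 < r.
  move=> r0; have [m _ hm] := near_infty_natSinv_lt (PosNum r0).
  by exists m => n mn; apply: hm.
(* Beyond [m0] the endpoints have [phi < e], so they lie outside [B] and both paths are nonempty. *)
have [m0 hm0] := small e e0.
have /choice[t ht] (n : nat) : exists t : B * D * D, exists z1 z2 p q,
  let u := val t.1.1 in let a := u + dir t.1.2 in let b := u + dir t.2 in
  [/\ phi z1 <= (n + m0).+1%:R^-1, phi z2 <= (n + m0).+1%:R^-1,
     path (adj A) u (a :: p) /\ last a p = z1, path (adj A) u (b :: q) /\ last b q = z2 &
     uniq (u :: (a :: p) ++ (b :: q))].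
  have [z1 [z2 [hz1 hz2 [u [p [q [uB [hp ep] [hq eq] uq]]]]]]] := hf (n + m0)%N.
  have zB z : phi z <= (n + m0).+1%:R^-1 -> z \notin B.
    move=> hz; apply/negP => /he; rewrite leNgt => /negP; apply.
    by apply: le_lt_trans hz _; apply: hm0; rewrite leq_addl.
  have sub : subrel (adj (A `&` @Zd_edges d)) (adj A) by move=> a b; apply: adj_sub => c [].
  case: p hp ep uq => [|a p] hp ep uq; first by have := zB z1 hz1; rewrite -ep /= uB.
  case: q hq eq uq => [|b q] hq eq uq; first by have := zB z2 hz2; rewrite -eq /= uB.
  have dirof c : adj (A `&` @Zd_edges d) u c -> exists k, c = u + dir k.
    by move=> h; apply/zd_edgesP; apply: adj_sub h => x [].
  have [k hk] : exists k, a = u + dir k by apply: dirof; case/andP: hp.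
  have [l hl] : exists l, b = u + dir l by apply: dirof; case/andP: hq.
  exists ([` uB]%fset, k, l); exists z1, z2, p, q => /=; rewrite -hk -hl.
  by split => //; split => //; [exact: sub_path hp | exact: sub_path hq].
have [[[u k] l] hinf] := infinite_pigeonhole t.
have far m : exists z1 z2 p q, [/\ phi z1 <= m.+1%:R^-1, phi z2 <= m.+1%:R^-1,
     path (adj A) (val u) ((val u + dir k) :: p) /\ last (val u + dir k) p = z1,
     path (adj A) (val u) ((val u + dir l) :: q) /\ last (val u + dir l) q = z2 &
     uniq (val u :: ((val u + dir k) :: p) ++ ((val u + dir l) :: q))].
  have [n mn tn] := hinf m; have := ht n; rewrite tn /= => -[z1 [z2 [p [q [h1 h2 h3 h4 h5]]]]].
  exists z1, z2, p, q; split => //.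
    by apply: le_trans h1 _; rewrite lef_pV2 ?posrE// ler_nat ltnS (leq_trans mn)// leq_addr.
  by apply: le_trans h2 _; rewrite lef_pV2 ?posrE// ler_nat ltnS (leq_trans mn)// leq_addr.
(* A set on which [phi] takes arbitrarily small values is infinite, because [phi] is bounded below
   on finite sets. *)
have inf (v : V) (S : set V) : S = component A [fset val u]%fset v ->
    (forall m, exists z, phi z <= m.+1%:R^-1 /\ S z) -> infinite_set S.
  move=> _ hS /finite_seqP[s es].
  have [r r0 hr] := finite_lower_bound s; have [m hm] := small r r0.
  have [z [hz Sz]] := hS m; have zs : z \in s by move: Sz; rewrite es.
  by have := lt_le_trans (hm m (leqnn m)) (hr z zs); rewrite ltNge hz.
exists [fset val u]%fset, (val u + dir k), (val u + dir l); split.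
- by rewrite inE -subr_eq0 addrAC subrr add0r dir_neq0.
- by rewrite inE -subr_eq0 addrAC subrr add0r dir_neq0.
- apply: (inf _ _ erefl) => m; have [z1 [z2 [p [q [h1 _ [hp ep] _ uq]]]]] := far m.
  exists z1; split => //; exists p => //; apply: path_remove; first by case/andP: hp.
  move: uq; rewrite cons_uniq mem_cat negb_or => /andP[/andP[h _] _]; exact: h.
- apply: (inf _ _ erefl) => m; have [z1 [z2 [p [q [_ h2 _ [hq eq] uq]]]]] := far m.
  exists z2; split => //; exists q => //; apply: path_remove; first by case/andP: hq.
  move: uq; rewrite cons_uniq mem_cat negb_or => /andP[/andP[_ h] _]; exact: h.
have [z1 [z2 [p [q [_ _ [hp _] [hq _] uq]]]]] := far 0%N.
apply: acyclic_component => //; [by case/andP: hp | by case/andP: hq |].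
move: uq; rewrite cons_uniq cat_uniq => /andP[_ /and3P[_ /hasPn h _]].
apply/eqP => e'; have := h _ (mem_head _ _); rewrite -e' mem_head//.
Qed.

End LatticeForks.

(** * Cylinder events of the limit tree *)

Section Cylinders.
Variables (R : realType) (V : countType).
Context {disp : measure_display} {Omega : measurableType disp}.
Variables (P : probability Omega R) (T : Omega -> set {fset V}).
Variables (N : weighted_graph R V) (G : nat -> subgraph V).
Hypothesis lim : ust_limit N G P T.

Definition trace (K : {fset {fset V}}) (w : Omega) : {fset {fset V}} :=
  [fset e in K | `[< T w e >]]%fset.

Lemma traceE K w A :
  (T w `&` [set` K] = [set` A]) <-> trace K w = A.
Proof.
split => [h|<-].
  apply/fsetP => e; rewrite !inE; apply/andP/idP => [[eK /asboolP Te]|eA].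
    by have : (T w `&` [set` K]) e by []; rewrite h.
  have : [set` A] e by []; rewrite -h => -[Te eK]; split => //; exact/asboolP.
apply/seteqP; split => e /=; first by move=> [Te eK]; rewrite !inE eK; exact/asboolP.
by rewrite !inE => /andP[eK /asboolP].
Qed.

Lemma measurable_trace K A : measurable [set w | trace K w = A].
Proof.
have [mT _] := lim.
have [AK|AK] := boolP (A `<=` K)%fset; last first.
  rewrite (_ : mkset _ = set0)//; apply/seteqP; split => // w /= h.
  by case/negP: AK; rewrite -h; apply/fsubsetP => e; rewrite !inE => /andP[].
have -> : [set w | trace K w = A] =
   \big[setI/setT]_(e <- K) (if e \in A then [set w | T w e] else ~` [set w | T w e]).
  rewrite -bigcap_seq; apply/seteqP; split => w /=.
    by move=> <- e /= eK; rewrite !inE (eK : e \in K) /=; case: asboolP.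
  move=> h; apply/fsetP => e; rewrite !inE.
  have [eK|eK] /= := boolP (e \in K).
    by have := h e eK; case: ifP => _ /=; case: asboolP.
  by apply/esym/negbTE; apply: contra eK; exact: (fsubsetP AK).
apply: bigsetI_measurable => e _; case: ifP => _ //; exact: measurableC.
Qed.

Lemma measurable_trace_event K (Q : pred {fset {fset V}}) :
  measurable [set w | Q (trace K w)].
Proof.
rewrite (_ : mkset _ = \bigcup_(A in [set` fpowerset K]) (if Q A then [set w | trace K w = A] else set0)).
  apply: fin_bigcup_measurable; first exact: finite_fset.
  by move=> A _; case: ifP => // _; exact: measurable_trace.
apply/seteqP; split => w /=.
  move=> h; exists (trace K w); last by rewrite h.
  by rewrite /= fpowersetE; apply/fsubsetP => e; rewrite !inE => /andP[].
by move=> [A _]; case: ifP => // h /= ->.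
Qed.

Lemma finite_cylinder_sum (H : subgraph V) K (Q : pred {fset {fset V}}) :
  finite_ust_prob N H (fun t => Q (t `&` K)%fset) =
  \sum_(A <- fpowerset K | Q A) finite_ust_prob N H (fun t => (t `&` K)%fset == A).
Proof.
rewrite /finite_ust_prob -mulr_suml; congr (_ / _).
under [RHS]eq_bigr do rewrite big_mkcond /=.
rewrite exchange_big /= big_mkcond; apply: eq_bigr => t _ /=.
rewrite -big_mkcondr /=; case: ifP => hQ.
  rewrite -big_filter (perm_big [:: (t `&` K)%fset]) ?big_seq1//.
  apply: uniq_perm => //; first by rewrite filter_uniq// fset_uniq.
  move=> A; rewrite mem_filter inE fpowersetE; apply/idP/eqP => [/andP[/andP[_ /eqP ->]//]|->].
  by rewrite hQ eqxx fsubsetIr.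
by rewrite big1// => A /andP[QA /eqP tA]; rewrite tA QA in hQ.
Qed.

Lemma cylinder_cvg K (Q : pred {fset {fset V}}) :
  finite_ust_prob N (G n) (fun t => Q (t `&` K)%fset) @[n --> \oo] -->
  fine (P [set w | Q (trace K w)]).
Proof.
have [_ hlim] := lim.
have -> : (fun n => finite_ust_prob N (G n) (fun t => Q (t `&` K)%fset)) =
  (fun n => \sum_(A <- fpowerset K | Q A) finite_ust_prob N (G n) (fun t => (t `&` K)%fset == A)).
  by apply/funext => n; exact: finite_cylinder_sum.
have -> : fine (P [set w | Q (trace K w)]) =
    \sum_(A <- fpowerset K | Q A) fine (P [set w | trace K w = A]).
  pose s : seq {fset {fset V}} := [seq A <- fpowerset K | Q A].
  rewrite (@measure_split R {fset {fset V}} _ _ P _ (trace K) s).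
  - rewrite -sum_fine; last by move=> A _; rewrite fin_num_measure//; apply: measurableI;
      [exact: measurable_trace_event | exact: measurable_trace].
    rewrite /s big_filter; apply: eq_bigr => A QA; congr (fine (P _)).
    by apply/seteqP; split => w /=; [case | move=> h; split => //; rewrite h].
  - exact: measurable_trace_event.
  - exact: measurable_trace.
  - by rewrite filter_uniq// fset_uniq.
  move=> A As; rewrite (_ : _ `&` _ = set0) ?measure0//; apply/seteqP; split => // w [/= Qw tw].
  move: As; rewrite mem_filter -tw Qw fpowersetE => /negP; apply.
  by apply/fsubsetP => e; rewrite !inE => /andP[].
apply: cvg_sumr => A _.
rewrite (_ : [set w | trace K w = A] = [set w | T w `&` [set` K] = [set` A]]); first exact: hlim.
by apply/seteqP; split => w /= /traceE.
Qed.

(** No finite tree contains a given cycle, so the limit contains it with probability 0, and there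
    are countably many cycles. *)
Lemma ust_limit_acyclic : {ae P, forall w, acyclic (T w)}.
Proof.
pose K (s : seq V) := [fset [fset x; next s x]%fset | x in s]%fset.
pose U (s : seq V) := [set w | trace (K s) w = K s].
pose bad : set (seq V) := [set s | (2 < size s)%N /\ uniq s].
have mU s : measurable (U s) by exact: measurable_trace.
have U0 s : bad s -> P (U s) = 0%E.
  move=> [s2 us].
  have h := @cylinder_cvg (K s) (pred1 (K s)).
  have z : (fun n => finite_ust_prob N (G n) (fun t => pred1 (K s) (t `&` K s)%fset)) = (fun=> 0).
    apply/funext => n; rewrite /finite_ust_prob big1_seq ?mul0r// => t /andP[/eqP /= tK].
    rewrite !inE /= => /andP[_ /asboolP[_ ac]]; exfalso; move: ac.
    apply: (cycle_not_acyclic s2 us) => x xs /=.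
    have : [fset x; next s x]%fset \in K s by apply/imfsetP; exists x.
    by rewrite -tK inE => /andP[].
  have e0 : fine (P (U s)) = 0.
    rewrite z in h; have -> : U s = [set w | pred1 (K s) (trace (K s) w)].
      by apply/seteqP; split => w /= /eqP.
    by apply: (cvg_unique _ h) => //; exact: cvg_cst.
  by rewrite -(fineK (fin_num_measure P _ (mU s))) e0.
have [mN PN] := @countable_bigcup_null R (seq V) _ _ P U bad mU U0.
exists (\bigcup_(s in bad) U s); split => // w /= /acyclic_cycleP[s [s2 us hs]].
exists s => //; apply/fsetP => e; rewrite !inE; apply: andb_idr => /imfsetP[x /= xs ->].
by apply/asboolP; exact: hs.
Qed.

End Cylinders.

Section LimsupEvent.
Variable R : realType.
Context {disp : measure_display} {Omega : measurableType disp}.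
Variable P : probability Omega R.

(** The event that only finitely many [E k] occur is an increasing union of intersections, each
    contained in the complement of a single [E m]. *)
Lemma limsup_event_compl (E : nat -> set Omega) (e : R) :
  (forall k, measurable (E k)) -> (forall k, ((1 - e)%:E <= P (E k))%E) ->
  measurable (\bigcup_m \bigcap_(k in [set k | (m <= k)%N]) ~` E k) /\
  (P (\bigcup_m \bigcap_(k in [set k | (m <= k)%N]) ~` E k) <= e%:E)%E.
Proof.
move=> mE hE; pose D m := \bigcap_(k in [set k | (m <= k)%N]) ~` E k.
have mD m : measurable (D m).
  apply: bigcap_measurable; first by exists m => /=.
  by move=> k _; exact: measurableC.
have mU : measurable (\bigcup_m D m) by exact: bigcup_measurable.
split => //; have c : (P \o D) m @[m --> \oo] --> P (\bigcup_m D m).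
  apply: nondecreasing_cvg_mu => // n m nm; apply/subsetPset => w h k /= mk.
  by apply: h; exact: leq_trans nm mk.
apply: (cvge_to_le c); apply: nearW => m /=.
apply: (@le_trans _ _ (P (~` E m))).
  apply: le_measure; rewrite ?inE//; first exact: measurableC.
  by move=> w h; apply: h => /=.
rewrite probability_setC//; have := hE m.
rewrite -[P (E m)]fineK ?fin_num_measure// -EFinB !lee_fin; lra.
Qed.

End LimsupEvent.

(** * The uniform spanning tree *)

Section UniformSpanningTree.
Variables (R : realType) (d : nat).
Hypothesis hd : (5 <= d)%N.
Local Notation V := 'rV[int]_d.
Local Notation D := ('I_d * bool)%type.
Local Notation green := (@green R d).
Variables (o : V) (phi : V -> R).
Hypothesis hphi : forall v, is_hitting_probability (simple_Zd R d) v o (phi v).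
Local Notation N := (reweighted_Zd phi).

Let d0 : (0 < d)%N. Proof. by lia. Qed.
Let d2 : 0 < (2 * d)%:R :> R. Proof. by rewrite ltr0n muln_gt0. Qed.
Let phi0 x : 0 < phi x. Proof. exact: phi_gt0. Qed.

Lemma phi_sqr_tail (e : R) : 0 < e -> exists B : {fset V}, o \in B /\
  forall s : seq V, uniq s -> (forall x, x \in s -> x \notin B) -> \sum_(x <- s) phi x ^+ 2 <= e.
Proof.
move=> e0; have [B hB] := green_tail hd e0.
exists (o |` [fset (x + o)%R | x in B])%fset; split; first by rewrite !inE eqxx.
move=> s us sB; apply: (@le_trans _ _ (\sum_(x <- [seq y - o | y <- s]) green x ^+ 2)).
  rewrite big_map; apply: ler_sum => x _; rewrite (phiE hd hphi) lerXn2r ?nnegrE//.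
  - by rewrite divr_ge0 ?green_ge0.
  - exact: green_ge0.
  by rewrite ler_pdivrMr ?green0_gt0// ler_peMr ?green_ge0// green0_ge1.
apply: hB; first by rewrite map_inj_uniq// => x y /addIr.
move=> _ /mapP[x xs ->]; apply: contra (sB x xs) => xB.
by rewrite !inE; apply/orP; right; apply/imfsetP; exists (x - o) => //=; rewrite subrK.
Qed.

Variables (G : nat -> subgraph V).
Hypothesis hG : exhaustion N G.

Lemma exhaustion_mono n m : (n <= m)%N ->
  (sub_vertices (G n) `<=` sub_vertices (G m))%fset /\
  (sub_edges (G n) `<=` sub_edges (G m))%fset.
Proof.
elim: m => [|m IH]; first by rewrite leqn0 => /eqP ->.
rewrite leq_eqVlt => /orP[/eqP ->//|/IH[h1 h2]]; split.
  by apply: fsubset_trans h1 _; exact: exhaustion_vertices hG _.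
by apply: fsubset_trans h2 _; exact: exhaustion_edges hG _.
Qed.

Lemma exhaustion_interior (B : {fset V}) : \forall n \near \oo, interior (G n) B.
Proof.
have edge x k : exists n, forall m, (n <= m)%N -> [fset x; (x + dir k)%R]%fset \in sub_edges (G m).
  have [|n hn] := exhaustion_all_edges hG (e := [fset x; (x + dir k)%R]%fset).
    by have /andP[_] := adj_dir x k; rewrite inE.
  exists n => m /exhaustion_mono[_ /fsubsetP h]; exact: h.
have /choice[f hf] (p : V * D) : exists n, forall m, (n <= m)%N ->
    [fset p.1; (p.1 + dir p.2)%R]%fset \in sub_edges (G m) by exact: edge.
exists (\max_(x <- B) \max_k f (x, k))%N => // n /= hn x xB.
have hk k : [fset x; (x + dir k)%R]%fset \in sub_edges (G n).
  apply: (hf (x, k)); apply: leq_trans hn.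
  rewrite (big_rem x)//=; apply: leq_trans (leq_maxl _ _).
  exact: (leq_bigmax (F := fun k => f (x, k))).
split => //; have /fsubsetP := subnetwork_ends (exhaustion_sub hG n) (hk (Ordinal d0, true)).
by apply; rewrite !inE eqxx.
Qed.

Lemma interior_sub n (B B' : {fset V}) : (B `<=` B')%fset -> interior (G n) B' -> interior (G n) B.
Proof. by move=> /fsubsetP h iB x /h; exact: iB. Qed.

Context {disp : measure_display} {Omega : measurableType disp}.
Variables (P : probability Omega R) (T : Omega -> set {fset V}).
Hypothesis hT : ust_limit N G P T.

Lemma finite_ust_probE n (Q : pred {fset {fset V}}) (oW : o \in sub_vertices (G n)) :
  finite_ust_prob N (G n) Q =
  forest_sum [` oW]%fset (edge_weight (sub_edges (G n)) (edge_cond N))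
    (fun p => Q (tree_of [` oW]%fset p)) / total phi oW.
Proof.
have ends := fun e => @subnetwork_edge_ends R d phi (G n) (exhaustion_sub hG n) e.
rewrite /finite_ust_prob (sum_spanning_trees [` oW]%fset ends Q (N := N) erefl erefl erefl).
by rewrite (sum_spanning_trees [` oW]%fset ends xpredT (N := N) erefl erefl erefl).
Qed.

(** If the total weight were 0, division by 0 would give the sure event the value 0, whereas these
    values converge to 1. *)
Lemma total_gt0_near : \forall n \near \oo, forall oW : o \in sub_vertices (G n), 0 < total phi oW.
Proof.
have h := @cylinder_cvg R V disp Omega P T N G hT fset0 xpredT.
have e1 : fine (P [set w | xpredT (trace T fset0 w)]) = 1.
  rewrite (_ : mkset _ = setT); last by apply/seteqP; split.
  by rewrite probability_setT.
rewrite e1 in h.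
have h0 : \forall n \near \oo, 0 < finite_ust_prob N (G n) (fun t => xpredT (t `&` fset0)%fset).
  exact: cvgr_gt h _ ltr01.
apply: filterS h0 => n hn oW.
rewrite lt_neqAle (total_ge0 hd hphi) andbT eq_sym; apply/eqP => Z0.
by move: hn; rewrite (finite_ust_probE _ oW) Z0 invr0 mulr0 ltxx.
Qed.

Lemma fork_event (e c : R) (Br : {fset V}) : 0 < e -> 0 < c -> (2 * d)%:R * c < 1 ->
  o \in Br -> (forall s : seq V, uniq s -> (forall x, x \in s -> x \notin Br) ->
    \sum_(x <- s) phi x ^+ 2 <= e) ->
  exists z1 z2 K, [/\ phi z1 <= (2 * d)%:R * c, phi z2 <= (2 * d)%:R * c,
    [set` K] `<=` @Zd_edges d &
    ((1 - 4 * e)%:E <= P [set w | `[< fork Br z1 z2 [set` trace T K w] >]])%E].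
Proof.
move=> e0 c0 c1 oBr hBr.
(* Scaled so that [e1 / phi z <= e] for every admissible start, where [phi z > c / (2 d)]. *)
pose e1 := e * (c / (2 * d)%:R).
have e10 : 0 < e1 by rewrite mulr_gt0// divr_gt0.
have [B0 hB0] := phi_small hd hphi e10.
pose B := (o |` B0)%fset.
have hB v : v \notin B -> phi v < e1 by rewrite !inE negb_or => /andP[_ /hB0].
pose s := [seq u <- B | u \notin Br].
have [z1 [z2 [/andP[l1 u1] /andP[l2 u2] hs]]] := exists_start_pair hd hphi s c0 c1.
have {}hs : \sum_(u <- s) green_ratio phi u z1 * green_ratio phi u z2 <= e.
  apply: le_trans hs _; apply: hBr; first by rewrite filter_uniq// fset_uniq.
  by move=> x; rewrite mem_filter => /andP[].
pose K := [fset x in [fset [fset a; b]%fset | a in B, b in B] | `[< @Zd_edges d x >]]%fset.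
have hK a b : a \in B -> b \in B -> @Zd_edges d [fset a; b]%fset -> [fset a; b]%fset \in K.
  move=> aB bB ab; rewrite !inE; apply/andP; split; last exact/asboolP.
  by apply/imfset2P; exists a => //; exists b.
exists z1, z2, K; split => //.
  by move=> x /=; rewrite !inE => /andP[_ /asboolP].
have small z : c / (2 * d)%:R < phi z -> e1 / phi z <= e.
  by move=> h; rewrite ler_pdivrMr// /e1 ler_wpM2l// ltW.
pose a := (phi z1)^-1; pose b := (phi z2)^-1.
(* [C] collects the cross terms that the error [e2 / phi] adds to the products; [e2] can depend on
   it because [s], [z1] and [z2] are already fixed. *)
pose C := \sum_(u <- s) (green_ratio phi u z1 * b + green_ratio phi u z2 * a + a * b).
have ratio0 u z : 0 <= green_ratio phi u z by exact: (green_ratio_ge0 hd hphi).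
have a0 : 0 <= a by rewrite invr_ge0 ltW.
have b0 : 0 <= b by rewrite invr_ge0 ltW.
have C0 : 0 <= C by apply: sumr_ge0 => u _; rewrite !addr_ge0// mulr_ge0.
have C1 : 0 < C + 1 by rewrite ltr_wpDl.
pose e2 := Num.min 1 (e / (C + 1)).
have e20 : 0 < e2 by rewrite lt_min ltr01 divr_gt0.
have e21 : e2 <= 1 by rewrite ge_min lexx.
have e2C : e2 * C <= e.
  apply: (@le_trans _ _ (e / (C + 1) * C)); first by rewrite ler_wpM2r// ge_min lexx orbT.
  by rewrite mulrAC ler_pdivrMr// ler_wpM2l ?(ltW e0)// lerDl.
have [B' hB'] := phi_small hd hphi e20.
have hsum : \sum_(u <- s) hit_bound phi e2 u z1 * hit_bound phi e2 u z2 <= 2 * e.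
  apply: (@le_trans _ _ (\sum_(u <- s) green_ratio phi u z1 * green_ratio phi u z2 + e2 * C)).
    rewrite /C mulr_sumr -big_split /=; apply: ler_sum => u _.
    rewrite /hit_bound -/a -/b; have := ratio0 u z1; have := ratio0 u z2.
    move: (green_ratio phi u z1) (green_ratio phi u z2) => p q q0 p0.
    have -> : (p + e2 * a) * (q + e2 * b) = p * q + e2 * (p * b + q * a + e2 * (a * b)) by ring.
    rewrite lerD2l ler_wpM2l ?(ltW e20)// lerD2l ler_piMl// mulr_ge0//.
  lra.
pose Q (t : {fset {fset V}}) := `[< fork Br z1 z2 [set` t] >].
have hc := @cylinder_cvg R V disp Omega P T N G hT K Q.
rewrite -[leRHS]fineK ?fin_num_measure//; last exact: (measurable_trace_event hT K Q).
rewrite lee_fin; apply: (cvgr_to_ge hc).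
have hall := exhaustion_interior (z1 |` (z2 |` (B `|` B')))%fset.
near=> n.
have iall : interior (G n) (z1 |` (z2 |` (B `|` B')))%fset by near: n.
have iB : interior (G n) B.
  by apply: interior_sub iall; apply/fsubsetP => x xB; rewrite !inE -/B in xB *; rewrite xB !orbT.
have iB' : interior (G n) B'.
  by apply: interior_sub iall; apply/fsubsetP => x xB; rewrite !inE xB !orbT.
have [|z1W _] := iall z1; first by rewrite !inE eqxx.
have [|z2W _] := iall z2; first by rewrite !inE eqxx orbT.
have oB : o \in B by rewrite !inE eqxx.
have [oW _] := iB o oB.
have Z0 : 0 < total phi oW by move: oW; near: n; exact: total_gt0_near.
rewrite (finite_ust_probE _ oW) ler_pdivlMr// mulrC.
apply: le_trans (total_fork hd hphi oW [` z1W]%fset [` z2W]%fset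
  (exhaustion_sub hG n) iB iB' e10 e20 hB hB' hK oBr oB).
rewrite ler_wpM2l ?(ltW Z0)//=.
have := small z1 l1; have := small z2 l2; rewrite -/s; lra.
Unshelve. all: by end_near. Qed.

Lemma ust_limit_more_than_one_end : {ae P, forall w, more_than_one_end (T w)}.
Proof.
have [mT _] := hT.
(* Makes the loss [4 * e j] of [fork_event] equal to 1 / (j + 1); likewise [c k] below makes
   [2 d * c k] equal to 1 / (k + 2), which is below 1. *)
pose e (j : nat) : R := (4 * j.+1%:R)^-1.
have e0 j : 0 < e j by rewrite invr_gt0 mulr_gt0.
have /choice[Br hBr] (j : nat) : exists B : {fset V}, o \in B /\
    forall s : seq V, uniq s -> (forall x, x \in s -> x \notin B) ->
      \sum_(x <- s) phi x ^+ 2 <= e j by exact: phi_sqr_tail.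
pose c (k : nat) : R := ((2 * d)%:R * k.+2%:R)^-1.
have cE k : (2 * d)%:R * c k = k.+2%:R^-1.
  by rewrite /c invfM mulrA mulfV ?mul1r// gt_eqF.
have /choice[t ht] (i : nat * nat) : exists t : V * V * {fset {fset V}},
    [/\ phi t.1.1 <= i.2.+2%:R^-1, phi t.1.2 <= i.2.+2%:R^-1, [set` t.2] `<=` @Zd_edges d &
    ((1 - i.1.+1%:R^-1)%:E <= P [set w | `[< fork (Br i.1) t.1.1 t.1.2 [set` trace T t.2 w] >]])%E].
  have [oB hB] := hBr i.1.
  have [||z1 [z2 [K]]] := @fork_event (e i.1) (c i.2) (Br i.1) (e0 _) _ _ oB hB.
  - by rewrite invr_gt0 mulr_gt0.
  - by rewrite cE invf_lt1// ltr1n.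
  rewrite cE => -[h1 h2 h3 h4]; exists (z1, z2, K); split => //=.
  by move: h4; rewrite /e invfM mulrA mulfV ?mul1r// pnatr_eq0.
pose E j k := [set w | `[< fork (Br j) (t (j, k)).1.1 (t (j, k)).1.2
   [set` trace T (t (j, k)).2 w] >]].
have mE j k : measurable (E j k) by exact: (measurable_trace_event hT _
   (fun A : {fset {fset V}} => `[< fork (Br j) (t (j, k)).1.1 (t (j, k)).1.2 [set` A] >])).
(* On [L j] the fork events [E j k] fail from some [k] on. Its probability is at most 1 / (j + 1),
   so almost surely a single [Br j] carries forks for infinitely many [k]. *)
pose L j := \bigcup_m \bigcap_(k in [set k | (m <= k)%N]) ~` E j k.
have hL j : measurable (L j) /\ (P (L j) <= (j.+1%:R^-1)%:E)%E.
  by apply: limsup_event_compl => // k; have [_ _ _] := ht (j, k).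
have mL : measurable (\bigcap_j L j).
  by apply: bigcap_measurable => [|j _]; [exists 0%N | case: (hL j)].
have h1 : {ae P, forall w, ~ (\bigcap_j L j) w}.
  exists (\bigcap_j L j); split => //; last by move=> w /= /contrapT.
  apply/eqP; rewrite eq_le measure_ge0 andbT; apply/lee_addgt0Pr => r r0.
  rewrite add0e; have [n _ /(_ n (leqnn n)) hn] := near_infty_natSinv_lt (PosNum r0).
  apply: (@le_trans _ _ (P (L n))).
    by apply: le_measure; rewrite ?inE//; [case: (hL n) | exact: bigcap_inf].
  by apply: (le_trans (hL n).2); rewrite lee_fin ltW.
apply: filterS2 (ust_limit_acyclic hT) h1 => w acyc nL.
have [j hj] : exists j, ~ L j w.
  by apply: contrapT => hn; apply: nL => j _; apply: contrapT => hn'; apply: hn; exists j.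
apply: (forks_more_than_one_end phi0 (B := Br j) acyc) => m.
have [k mk Ek] : exists2 k, (m <= k)%N & E j k w.
  apply: contrapT => hn; apply: hj; exists m => // k /= mk Ek.
  by apply: hn; exists k.
have [p1 p2 sub _] := ht (j, k).
exists (t (j, k)).1.1, (t (j, k)).1.2; split.
- by apply: le_trans p1 _; rewrite lef_pV2 ?posrE// ler_nat ltnS (leq_trans mk).
- by apply: le_trans p2 _; rewrite lef_pV2 ?posrE// ler_nat ltnS (leq_trans mk).
apply: fork_sub (asboolW Ek) => x /=; rewrite !inE => /andP[xK /asboolP Tx]; split => //.
exact: sub.
Qed.

End UniformSpanningTree.

Theorem proposition6p3 (R : realType) (d : nat) (hd : (5 <= d)%N)
    (o : 'rV[int]_d) (phi : 'rV[int]_d -> R)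
    (hphi : forall v, is_hitting_probability (simple_Zd R d) v o (phi v)) :
  [/\ is_network (reweighted_Zd phi),
      recurrent (reweighted_Zd phi),
      exists! h : 'rV[int]_d -> R, potential (reweighted_Zd phi) o h,
      forall h : 'rV[int]_d -> R, potential (reweighted_Zd phi) o h ->
        h_processes_intersect_finitely (reweighted_Zd phi) o h
    & ust_more_than_one_end (reweighted_Zd phi)].
Proof.
split.
- exact: (reweighted_is_network hd hphi).
- exact: (reweighted_recurrent hd hphi).
- exists (potential_kernel phi); split; first exact: (potential_kernelP hd hphi).
  by move=> h /(potential_unique hd hphi).
- by move=> h /(potential_unique hd hphi) hh; exact: (h_processes_finite_intersection hd hphi hh).
move=> disp Omega P T [G hG hT]; exact: (ust_limit_more_than_one_end hd hphi hG hT).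
Qed.
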